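(* Let $H$ be a Hopf algebra over a field $\Bbbk$. There is a bijective correspondence between (isomorphism classes of) bicovariant first order vector field calculi $(\mathfrak{X},\mathscr{L})$ on $H$ with $\dim{}^{\mathrm{co}H}\mathfrak{X}<\infty$ and bicovariant quantum tangent spaces $\mathfrak{g}\subseteq H^\circ$; under it a bicovariant quantum tangent space $\mathfrak{g}$ corresponds to the calculus $(H\otimes\mathfrak{g},\mathscr{L})$ with $\mathscr{L}_{h\otimes\chi}(g)=hg_1\chi(g_2)$.
   Context: $H^\circ$ is the finite dual Hopf algebra of $H$, $\Delta(u)(h\otimes g)=u(hg)$, unit $\varepsilon$; $(H^\circ)^+=\{u\mid u(1)=0\}$. A quantum tangent space is a finite-dimensional subspace $\mathfrak{g}\subset(H^\circ)^+$ with $\Delta(\mathfrak{g})\subset\mathfrak{g}\otimes\varepsilon+H^\circ\otimes\mathfrak{g}$; for a basis $\{\chi_i\}$ write $\Delta(\chi_i)=\chi_i\otimes\varepsilon+\sum_jf_i^j\otimes\chi_j$, $f_i^j\in H^\circ$. Define $\mathrm{ad}_{\mathfrak{g}}\colon\mathfrak{g}\to\mathrm{End}_\Bbbk(H)$ by $\mathrm{ad}_{\mathfrak{g}}(\chi)(h)=h_1S(h_3)\chi(h_2)$; $\mathfrak{g}$ is bicovariant if $\mathrm{ad}_{\mathfrak{g}}(\mathfrak{g})\subseteq\mathfrak{g}\otimes H$, where $\mathfrak{g}\otimes H\subseteq\mathrm{End}_\Bbbk(H)$ via $(\chi\otimes k)(h)=\chi(h)k$. In that case write $\mathrm{ad}_{\mathfrak{g}}(\chi_i)=\sum_j\chi_j\otimes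 N_i^j$. The space $H\otimes\mathfrak{g}$ has bimodule structure $h'\cdot(h\otimes\chi_i)\cdot g=\sum_jh'hg_1f_i^j(g_2)\otimes\chi_j$, left coaction $h\otimes\chi\mapsto h_1\otimes h_2\otimes\chi$ and right coaction $h\otimes\chi_i\mapsto\sum_jh_1\otimes\chi_j\otimes h_2N_i^j$. A first order vector field calculus (FOVC) on $H$ is a pair $(\mathfrak{X},\mathscr{L})$: $\mathfrak{X}$ an $H$-bimodule, $\mathscr{L}\colon\mathfrak{X}\to\mathrm{End}_\Bbbk(H)$ $\Bbbk$-linear, injective, left $H$-linear, with $\mathscr{L}_X(hg)=\mathscr{L}_X(h)g+\mathscr{L}_{X\cdot h}(g)$. It is bicovariant if $\mathfrak{X}$ has commuting left and right $H$-coactions $\delta$, each satisfying $\delta(h\cdot X\cdot h')=\Delta(h)\delta(X)\Delta(h')$, such that $\mathfrak{X}\otimes H\to H$, $X\otimes h\mapsto\mathscr{L}_X(h)$, is left and right $H$-colinear for the diagonal coactions on the source and $\Delta$ on the target. ${}^{\mathrm{co}H}\mathfrak{X}$ is the space of left coinvariants. Isomorphisms are bicolinear bimodule isomorphisms $\Phi$ with $\mathscr{L}'\circ\Phi=\mathscr{L}$. *)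

(* Defs.v *)
From HB Require Import structures.
From mathcomp Require Import all_boot all_algebra.
From mathcomp Require Import boolp classical_sets functions.

Set Implicit Arguments.
Unset Strict Implicit.
Unset Printing Implicit Defensive.

Import GRing.Theory.
Local Open Scope ring_scope.
Local Open Scope quotient_scope.

Reserved Notation "V \ot W" (at level 38, left associativity).

Notation bilinear_fun f := (bilinear_for *:%R *:%R f).

(** * Tensor products of vector spaces *)

Section TensorProduct.
Context {k : fieldType} (V W : lmodType k).
Implicit Types s t : seq (V * W).

(* Finite formal sums of pairs, modulo the congruence generated by
   commutativity of the sum and bilinearity. *)
Inductive tensor_eqv : seq (V * W) -> seq (V * W) -> Prop :=
| TeqvRefl s : tensor_eqv s s
| TeqvSym s t : tensor_eqv s t -> tensor_eqv t s
| TeqvTrans s t u : tensor_eqv s t -> tensor_eqv t u -> tensor_eqv s u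
| TeqvCat s s' t t' :
    tensor_eqv s s' -> tensor_eqv t t' -> tensor_eqv (s ++ t) (s' ++ t')
| TeqvC s t : tensor_eqv (s ++ t) (t ++ s)
| Teqv0 w : tensor_eqv [:: (0, w)] [::]
| TeqvDl v v' w : tensor_eqv [:: (v + v', w)] [:: (v, w); (v', w)]
| TeqvDr v w w' : tensor_eqv [:: (v, w + w')] [:: (v, w); (v, w')]
| TeqvZ a v w : tensor_eqv [:: (a *: v, w)] [:: (v, a *: w)].

Definition tensor_rel s t := `[< tensor_eqv s t >].

Lemma tensor_rel_refl : reflexive tensor_rel.
Proof. by move=> s; apply/asboolP; exact: TeqvRefl. Qed.

Lemma tensor_rel_sym : symmetric tensor_rel.
Proof. by move=> s t; apply/asboolP/asboolP; exact: TeqvSym. Qed.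

Lemma tensor_rel_trans : transitive tensor_rel.
Proof.
by move=> t s u /asboolP st /asboolP tu; apply/asboolP; exact: TeqvTrans tu.
Qed.

Canonical tensor_equiv :=
  EquivRel tensor_rel tensor_rel_refl tensor_rel_sym tensor_rel_trans.

Definition tensor := {eq_quot tensor_equiv}.
HB.instance Definition _ := Choice.on tensor.
HB.instance Definition _ := EqQuotient.on tensor.

Lemma tensorP s t : tensor_eqv s t <-> s = t %[mod tensor].
Proof. by split=> [st|/eqmodP/asboolP //]; apply/eqmodP/asboolP. Qed.

Lemma tensor_repr s : tensor_eqv (repr (\pi_tensor s)) s.
Proof. by apply/tensorP; rewrite reprK. Qed.

Lemma tensor_pi (x : tensor) : exists s, x = \pi_tensor s.
Proof. by exists (repr x); rewrite reprK. Qed.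

Definition tensor_scale_seq (a : k) s := [seq (a *: p.1, p.2) | p <- s].

Lemma tensor_scale_seq_eqv a s t :
  tensor_eqv s t -> tensor_eqv (tensor_scale_seq a s) (tensor_scale_seq a t).
Proof.
elim=> {s t} [s|s t _|s t u _ st _ tu|s s' t t' _ ss _ tt|s t|w|v v' w|v w w'|b v w].
- exact: TeqvRefl.
- exact: TeqvSym.
- exact: TeqvTrans tu.
- by rewrite /tensor_scale_seq !map_cat; exact: TeqvCat.
- by rewrite /tensor_scale_seq !map_cat; exact: TeqvC.
- by rewrite /= scaler0; exact: Teqv0.
- by rewrite /= scalerDr; exact: TeqvDl.
- exact: TeqvDr.
- by rewrite /= scalerA mulrC -scalerA; exact: TeqvZ.
Qed.

Definition tensor_zero : tensor := \pi_tensor [::].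
Definition tensor_add (x y : tensor) : tensor := \pi_tensor (repr x ++ repr y).
Definition tensor_scale (a : k) (x : tensor) : tensor :=
  \pi_tensor (tensor_scale_seq a (repr x)).
Definition tensor_opp (x : tensor) : tensor := tensor_scale (-1) x.

Lemma tensor_addE s t :
  tensor_add (\pi_tensor s) (\pi_tensor t) = \pi_tensor (s ++ t).
Proof. by apply/tensorP; apply: TeqvCat; exact: tensor_repr. Qed.

Lemma tensor_scaleE a s :
  tensor_scale a (\pi_tensor s) = \pi_tensor (tensor_scale_seq a s).
Proof. by apply/tensorP; apply: tensor_scale_seq_eqv; exact: tensor_repr. Qed.

Lemma tensor_addA : associative tensor_add.
Proof.
move=> x y z; case: (tensor_pi x) => s ->; case: (tensor_pi y) => t ->; case: (tensor_pi z) => u ->.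
by rewrite !tensor_addE catA.
Qed.

Lemma tensor_addC : commutative tensor_add.
Proof.
move=> x y; case: (tensor_pi x) => s ->; case: (tensor_pi y) => t ->; rewrite !tensor_addE.
by apply/tensorP; exact: TeqvC.
Qed.

Lemma tensor_add0 : left_id tensor_zero tensor_add.
Proof. by move=> x; case: (tensor_pi x) => s ->; rewrite tensor_addE. Qed.

Lemma tensor_scaleDl x a b :
  tensor_scale (a + b) x = tensor_add (tensor_scale a x) (tensor_scale b x).
Proof.
case: (tensor_pi x) => s ->; rewrite !tensor_scaleE tensor_addE; apply/tensorP.
elim: s => [|[v w] s IHs] /=; first exact: TeqvRefl.
have dist : tensor_eqv [:: ((a + b) *: v, w)] [:: (a *: v, w); (b *: v, w)].
  by rewrite scalerDl; exact: TeqvDl.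
apply: TeqvTrans (TeqvCat dist IHs) _.
rewrite -(cat1s (b *: v, w)) -(cat1s (b *: v, w) (tensor_scale_seq b s)) catA.
rewrite -(cat1s (a *: v, w)) -(cat1s (a *: v, w) (_ ++ _)) -!catA.
apply: TeqvCat; first exact: TeqvRefl.
by rewrite !catA; apply: TeqvCat; [exact: TeqvC | exact: TeqvRefl].
Qed.

Lemma tensor_addN : left_inverse tensor_zero tensor_opp tensor_add.
Proof.
move=> x; have {2}-> : x = tensor_scale 1 x.
  case: (tensor_pi x) => s ->; rewrite tensor_scaleE /tensor_scale_seq.
  by under eq_map do rewrite scale1r -surjective_pairing; rewrite map_id.
rewrite /tensor_opp -tensor_scaleDl addNr; case: (tensor_pi x) => s ->.
rewrite tensor_scaleE; apply/tensorP.
elim: s => [|[v w] s IHs] /=; first exact: TeqvRefl.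
rewrite scale0r -cat1s -[X in tensor_eqv _ X]cat0s.
by apply: TeqvCat => //; exact: Teqv0.
Qed.

HB.instance Definition _ :=
  GRing.isZmodule.Build tensor tensor_addA tensor_addC tensor_add0 tensor_addN.

Lemma tensor_scaleA a b x :
  tensor_scale a (tensor_scale b x) = tensor_scale (a * b) x.
Proof.
case: (tensor_pi x) => s ->; rewrite !tensor_scaleE /tensor_scale_seq -map_comp.
by congr (\pi _); apply: eq_map => p /=; rewrite scalerA.
Qed.

Lemma tensor_scale1 : left_id 1 tensor_scale.
Proof.
move=> x; case: (tensor_pi x) => s ->; rewrite tensor_scaleE /tensor_scale_seq.
by under eq_map do rewrite scale1r -surjective_pairing; rewrite map_id.
Qed.

Lemma tensor_scaleDr : right_distributive tensor_scale +%R.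
Proof.
move=> a x y; case: (tensor_pi x) => s ->; case: (tensor_pi y) => t ->.
rewrite [_ + _ in LHS]tensor_addE !tensor_scaleE.
by rewrite [RHS]tensor_addE /tensor_scale_seq map_cat.
Qed.

HB.instance Definition _ := GRing.Zmodule_isLmodule.Build k tensor
  tensor_scaleA tensor_scale1 tensor_scaleDr (fun x a b => tensor_scaleDl x a b).

Definition tens (v : V) (w : W) : tensor := \pi_tensor [:: (v, w)].

Lemma pi_tensorD s t :
  \pi_tensor s + \pi_tensor t = \pi_tensor (s ++ t) :> tensor.
Proof. exact: tensor_addE. Qed.

Lemma pi_tensorZ a s :
  a *: (\pi_tensor s : tensor) = \pi_tensor (tensor_scale_seq a s).
Proof. exact: tensor_scaleE. Qed.

Lemma tens_bilinear : bilinear_fun tens.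
Proof.
split=> [w a v v'|v a w w']; rewrite /= /tens pi_tensorZ pi_tensorD; apply/tensorP.
  exact: TeqvDl.
apply: TeqvTrans (TeqvDr _ _ _) _; rewrite -[X in tensor_eqv X _]cat1s.
by apply: TeqvCat; [apply: TeqvSym; exact: TeqvZ | exact: TeqvRefl].
Qed.

Lemma tensor_span (x : tensor) : x = \sum_(p <- repr x) tens p.1 p.2.
Proof.
rewrite -[LHS]reprK; elim: (repr x) => [|[v w] s IHs]; first by rewrite big_nil.
by rewrite big_cons -IHs pi_tensorD.
Qed.

(* The linear map induced by a bilinear map; a junk value if [f] is not
   bilinear. *)
Definition tlift (U : lmodType k) (f : V -> W -> U) (x : tensor) : U :=
  \sum_(p <- repr x) f p.1 p.2.

Section Lift.
Variables (U : lmodType k) (f : V -> W -> U).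
Hypothesis f_bilinear : bilinear_fun f.

Let fl w : {linear V -> U} := HB.pack (f ^~ w) (GRing.isLinear.Build _ _ _ _ _ (f_bilinear.1 w)).
Let fr v : {linear W -> U} := HB.pack (f v) (GRing.isLinear.Build _ _ _ _ _ (f_bilinear.2 v)).

Lemma tlift_pi s : tlift f (\pi_tensor s) = \sum_(p <- s) f p.1 p.2.
Proof.
suff eqv_sum t t' : tensor_eqv t t' ->
    \sum_(p <- t) f p.1 p.2 = \sum_(p <- t') f p.1 p.2.
  exact: eqv_sum (tensor_repr s).
elim=> {t t'} [t|t t' _|t t' u _ -> _|t t' u u' _ tt _ uu|t t'|w|v v' w|v w w'|a v w] //.
- by rewrite !big_cat /= tt uu.
- by rewrite !big_cat /= addrC.
- by rewrite big_cons !big_nil addr0; exact: (linear0 (fl w)).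
- by rewrite !big_cons !big_nil !addr0; exact: (linearD (fl w)).
- by rewrite !big_cons !big_nil !addr0; exact: (linearD (fr v)).
- by rewrite !big_cons !big_nil !addr0 /=; exact: etrans (linearZZ (fl w) _ _) (esym (linearZZ (fr v) _ _)).
Qed.

Lemma tlift_tens v w : tlift f (tens v w) = f v w.
Proof. by rewrite /tens tlift_pi big_cons big_nil addr0. Qed.

Lemma tlift_linear : linear (tlift f).
Proof.
move=> a x y; case: (tensor_pi x) => s ->; case: (tensor_pi y) => t ->.
rewrite pi_tensorZ pi_tensorD !tlift_pi big_cat /=.
rewrite scaler_sumr big_map; congr (_ + _); apply: eq_bigr => p _.
exact: (linearZZ (fl p.2)).
Qed.

End Lift.

End TensorProduct.

Notation "V \ot W" := (tensor V%type W%type) : type_scope.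
Notation "v \ot w" := (tens v w) : ring_scope.

Section TensorMaps.
Context {k : fieldType}.
Implicit Types U V W : lmodType k.

Definition tmap V V' W W' (f : V -> V') (g : W -> W') : V \ot W -> V' \ot W' :=
  tlift (fun v w => f v \ot g w).

(* [(u \ot v, u' \ot v') |-> f u u' \ot g v v'] *)
Definition tmap2 U U' U'' V V' V'' (f : U -> U' -> U'') (g : V -> V' -> V'')
    (x : U \ot V) (y : U' \ot V') : U'' \ot V'' :=
  tlift (fun u v => tlift (fun u' v' => f u u' \ot g v v') y) x.

Definition tassoc U V W : (U \ot V) \ot W -> U \ot (V \ot W) :=
  tlift (fun x w => tlift (fun u v => u \ot (v \ot w)) x).

End TensorMaps.

(** * Hopf algebras *)

HB.mixin Record Algebra_isHopf (k : fieldType) H of GRing.Algebra k H := {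
  comul : {linear H -> (H \ot H)%type};
  counit : {linear H -> k^o};
  antipode : {linear H -> H};
  comulA : forall h : H,
    tassoc (tmap comul idfun (comul h)) = tmap idfun comul (comul h);
  counitl : forall h : H, tlift (fun a b => counit a *: b) (comul h) = h;
  counitr : forall h : H, tlift (fun a b => counit b *: a) (comul h) = h;
  comul1 : comul 1 = 1 \ot 1;
  comulM : forall g h : H,
    comul (g * h) = tmap2 *%R *%R (comul g) (comul h);
  counit1 : counit 1 = 1;
  counitM : forall g h : H, counit (g * h) = counit g * counit h;
  antipodel : forall h : H,
    tlift (fun a b => antipode a * b) (comul h) = counit h *: 1;
  antipoder : forall h : H,
    tlift (fun a b => a * antipode b) (comul h) = counit h *: 1
}.

#[short(type="hopfAlgType")]
HB.structure Definition HopfAlgebra (k : fieldType) :=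
  {H of GRing.Algebra k H & Algebra_isHopf k H}.

Section FiniteDual.
Context {k : fieldType}.

Section Sweedler.
Variables (H : hopfAlgType k) (U : lmodType k).

(* [sweedler2 h F] is the Sweedler sum of [F h_1 h_2]. *)
Definition sweedler2 (h : H) (F : H -> H -> U) : U := tlift F (comul h).

Definition sweedler3 (h : H) (F : H -> H -> H -> U) : U :=
  sweedler2 h (fun h1 h' => sweedler2 h' (F h1)).

End Sweedler.

Definition two_sided_ideal (A : algType k) (I : {pred A}) :=
  submod_closed I /\
  forall a x, x \in I -> (a * x \in I) /\ (x * a \in I).

(* [V / I] is spanned by the classes of finitely many vectors. *)
Definition finite_codim (V : lmodType k) (I : {pred V}) :=
  exists n (e : 'I_n -> V),
    forall v, exists c : 'I_n -> k, v - \sum_i c i *: e i \in I.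

Definition finite_dual (A : algType k) : {pred A -> k^o} := fun u =>
  `[< linear u /\ exists I : {pred A},
      [/\ two_sided_ideal I, finite_codim I & forall x, x \in I -> u x = 0] >].

Lemma finite_codim_cap_ker (V : lmodType k) (I : {pred V}) (u : V -> k^o) :
  submod_closed I -> finite_codim I -> linear u ->
  finite_codim [pred v | (v \in I) && (u v == 0)].
Proof.
move=> subI [n [e eP]] u_lin.
pose ul : {linear V -> k^o} := HB.pack u (GRing.isLinear.Build _ _ _ _ _ u_lin).
have subB := GRing.submod_closedB subI.
have [u0|/existsNP[x /not_implyP[xI /eqP ux0]]] := pselect (forall x, x \in I -> u x = 0).
  exists n, e => v; have [c cP] := eP v.
  by exists c; rewrite inE cP u0 ?eqxx.
exists n.+1, (fun i => oapp e x (unlift ord0 i)) => v; have [c cP] := eP v.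
set y := v - _ in cP.
exists (fun i => oapp c (u y / u x) (unlift ord0 i)).
rewrite big_ord_recl unlift_none /=.
under eq_bigr do rewrite liftK /=.
rewrite opprD addrA addrAC -/y inE; apply/andP; split.
  by rewrite -scaleNr addrC subI.2.
rewrite -[u _]/(ul _) linearB linearZ /= subr_eq0.
by rewrite [_ *: _]divfK.
Qed.

Lemma finite_codimS (V : lmodType k) (I J : {pred V}) :
  {subset I <= J} -> finite_codim I -> finite_codim J.
Proof.
move=> sIJ [n [e eP]]; exists n, e => v.
by have [c /sIJ cP] := eP v; exists c.
Qed.

Lemma finite_codim_basis (V : lmodType k) (I : {pred V}) :
  submod_closed I -> finite_codim I ->
  exists n (e : 'I_n -> V) (c : 'I_n -> V -> k^o),
    [/\ forall i, linear (c i), forall i v, v \in I -> c i v = 0 &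
        forall v, v - \sum_i c i v *: e i \in I].
Proof.
move=> subI codI.
have subB := GRing.submod_closedB subI; have I0 := subI.1.
have IZ a v : v \in I -> a *: v \in I.
  by move=> vI; rewrite -[_ *: _]addr0; apply: subI.2.
have ID v w : v \in I -> w \in I -> v + w \in I.
  by move=> vI wI; rewrite -[v]scale1r; apply: subI.2.
pose P n := `[< exists e : 'I_n -> V,
  forall v, exists c : 'I_n -> k, v - \sum_i c i *: e i \in I >].
have exP : exists n, P n by have [n ne] := codI; exists n; apply/asboolP.
case: (ex_minnP exP) => n /asboolP[e eP] n_min.
have free (a : 'I_n -> k) : \sum_i a i *: e i \in I -> forall i, a i = 0.
  move=> aI j; apply/eqP/negPn/negP => aj0.
  case: n => [|n] in e eP n_min a aI j aj0 *; first by case: j aj0.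
  suff /n_min : P n by rewrite ltnn.
  apply/asboolP; exists (fun i => e (lift j i)) => v; have [c cP] := eP v.
  exists (fun i => c (lift j i) - c j / a j * a (lift j i)).
  have := ID _ _ cP (IZ (c j / a j) _ aI); congr (_ \in I).
  rewrite -addrA; congr (_ + _).
  rewrite !(bigD1_ord j) //= scalerDr scalerA divfK // opprD addrACA addNr add0r.
  rewrite scaler_sumr -!sumrN -big_split /=; apply: eq_bigr => i _.
  by rewrite scalerA -scaleNr -scalerDl -scaleNr opprB addrC.
pose c i v : k^o := sval (cid (eP v)) i.
have cP v : v - \sum_i c i v *: e i \in I by rewrite /c; case: (cid (eP v)).
have c_uniq v (b : 'I_n -> k) : v - \sum_i b i *: e i \in I -> forall i, c i v = b i.
  move=> bP i; apply/eqP; rewrite -subr_eq0; apply/eqP; move: i; apply: free.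
  have := subB.2 _ _ bP (cP v); congr (_ \in I).
  rewrite opprB addrC addrA subrK -sumrN -big_split /=.
  by apply: eq_bigr => i _; rewrite scalerBl.
exists n, e, c; split=> // [i a v w|i v vI].
  pose b i : k := a * c i v + c i w.
  apply: (c_uniq _ b).
  have := subI.2 a _ _ (cP v) (cP w); congr (_ \in I).
  rewrite scalerBr addrACA -opprD scaler_sumr -big_split /=; congr (_ - _).
  by apply: eq_bigr => j _; rewrite scalerDl scalerA.
apply: (c_uniq _ (fun=> 0)); rewrite big1 ?subr0 // => j _.
by rewrite scale0r.
Qed.

Lemma finite_codim_cap (V : lmodType k) (I J : {pred V}) :
  submod_closed I -> submod_closed J -> finite_codim I -> finite_codim J ->
  finite_codim [pred v | (v \in I) && (v \in J)].
Proof.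
move=> subI subJ codI codJ.
have [m [e [c [c_lin _ cP]]]] := finite_codim_basis subJ codJ.
suff [K [_ codK sK]] : exists K : {pred V}, [/\ submod_closed K, finite_codim K &
    forall v, v \in K -> v \in I /\ forall i, c i v = 0].
  apply: finite_codimS codK => v /sK[vI cv0]; rewrite inE vI /=.
  rewrite -[v]subr0; have := cP v; congr (_ - _ \in J).
  by apply: big1 => i _; rewrite cv0 scale0r.
elim: m c c_lin {e cP} => [|m IHm] c c_lin.
  by exists I; split=> // v vI; split=> // -[].
have [K [subK codK sK]] := IHm (fun i => c (lift ord0 i)) (fun i => c_lin _).
pose cl : {linear V -> k^o} :=
  HB.pack (c ord0) (GRing.isLinear.Build _ _ _ _ _ (c_lin ord0)).
exists ([pred v | (v \in K) && (c ord0 v == 0)] : {pred V}); split.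
- split=> [|a x y /andP[xK /eqP x0] /andP[yK /eqP y0]].
    by rewrite inE subK.1 -[c _ _]/(cl _) linear0 eqxx.
  by rewrite inE subK.2 //= c_lin x0 y0 scaler0 addr0 eqxx.
- exact: finite_codim_cap_ker.
- move=> v /andP[/sK[vI cv] /eqP c0]; split=> // i.
  by case: (unliftP ord0 i) => [j|] ->.
Qed.

Lemma finite_dual_submod (A : algType k) : submod_closed (@finite_dual A).
Proof.
split=> [|a u v /asboolP[u_lin [I [[subI idI] codI uI]]]
              /asboolP[v_lin [J [[subJ idJ] codJ vJ]]]].
  apply/asboolP; split; first by move=> a x y; rewrite /= scaler0 addr0.
  exists (predT : {pred A}); split=> //; exists 0%N, (fun=> 0) => v; exists (fun=> 0).
  by rewrite inE.
have uvE x : (a *: u + v) x = a *: u x + v x by [].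
apply/asboolP; split=> [b x y|].
  rewrite !uvE u_lin v_lin !scalerDr addrACA !scalerA.
  by rewrite [a * b]mulrC.
exists ([pred x | (x \in I) && (x \in J)] : {pred A}); split.
- split; first split.
  + by rewrite inE subI.1 subJ.1.
  + move=> b x y /andP[xI xJ] /andP[yI yJ].
    by rewrite inE subI.2 // subJ.2.
  + move=> b x /andP[xI xJ]; have [] := idI b x xI; have [] := idJ b x xJ.
    by rewrite !inE => -> -> -> ->.
- exact: finite_codim_cap.
- move=> x /andP[xI xJ].
  by rewrite uvE uI // vJ // scaler0 addr0.
Qed.

HB.instance Definition _ (A : algType k) :=
  GRing.isSubmodClosed.Build k (A -> k^o) (@finite_dual A)
    (GRing.submod_closed_semi (@finite_dual_submod A)).

End FiniteDual.

(** * Subspaces as vector spaces *)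

Section Subspace.
Context {k : fieldType} {V : lmodType k}.

Record subspace (S : submodClosed V) :=
  Subspace { subspace_val :> V; subspace_valP : subspace_val \in S }.

Variable S : submodClosed V.
HB.instance Definition _ := [isSub for @subspace_val S].
HB.instance Definition _ := [Choice of subspace S by <:].
HB.instance Definition _ := [SubChoice_isSubLmodule of subspace S by <:].

End Subspace.

Definition is_basis (k : fieldType) (V : lmodType k) n (e : 'I_n -> V) :=
  forall v, exists! c : {ffun 'I_n -> k}, v = \sum_i c i *: e i.

Definition finite_dim (k : fieldType) (V : lmodType k) :=
  exists n (e : 'I_n -> V), is_basis e.

(** * The finite dual *)

Definition fdual (k : fieldType) (A : algType k) :=
  subspace (@finite_dual k A).
HB.instance Definition _ k A := GRing.Lmodule.on (@fdual k A).

Section FiniteDualHopf.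
Context {k : fieldType}.

Definition ev {A : algType k} (u : fdual A) : A -> k := subspace_val u.
Arguments ev : simpl never.

Section Comultiplication.
Variable A : algType k.

Lemma ev_linear (a : A) : scalar (fun u : fdual A => ev u a).
Proof. by []. Qed.

(* [<u \ot v, a \ot b> = u(a) v(b)] *)
Definition fdual_pair (t : fdual A \ot fdual A) (a b : A) : k^o :=
  tlift (fun u v : fdual A => ev u a * ev v b : k^o) t.

Lemma fdual_pair_bilinear a b :
  bilinear_fun (fun u v : fdual A => ev u a * ev v b : k^o).
Proof.
split=> [w c x y|w c x y]; rewrite /= ev_linear.
  by rewrite mulrDl scalerAl.
by rewrite mulrDr scalerAr.
Qed.

Lemma fdual_pair_tens (u v : fdual A) a b :
  fdual_pair (u \ot v) a b = ev u a * ev v b.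
Proof. exact: tlift_tens (fdual_pair_bilinear a b) u v. Qed.

Lemma fdual_pair_linear a b : linear (fun t => fdual_pair t a b).
Proof. exact: tlift_linear (fdual_pair_bilinear a b). Qed.

Lemma fdual_comul_exists (u : fdual A) :
  exists t : fdual A \ot fdual A,
    forall a b, fdual_pair t a b = ev u (a * b).
Proof.
case: u => u; rewrite /ev /= => /asboolP[u_lin [I [[subI idI] codI uI]]].
have [n [e [c [c_lin cI cP]]]] := finite_codim_basis subI codI.
pose ul : {linear A -> k^o} := HB.pack u (GRing.isLinear.Build _ _ _ _ _ u_lin).
pose r i : A -> k^o := fun a => u (a * e i).
have rD i : r i \in @finite_dual k A.
  apply/asboolP; split=> [a x y|].
    by rewrite /r mulrDl -scalerAl u_lin.
  by exists I; split=> // x /(idI (e i))[_ /uI].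
have cD i : c i \in @finite_dual k A.
  by apply/asboolP; split=> //; exists I; split=> // x; exact: cI.
pose rd i : fdual A := Subspace (rD i).
pose cd i : fdual A := Subspace (cD i).
exists (\sum_i rd i \ot cd i) => a b.
pose pl : {linear (fdual A \ot fdual A)%type -> k^o} :=
  HB.pack (fun t => fdual_pair t a b)
    (GRing.isLinear.Build _ _ _ _ _ (fdual_pair_linear a b)).
rewrite -[LHS]/(pl _) linear_sum /=.
under eq_bigr do rewrite fdual_pair_tens /ev /= mulrC.
have -> : u (a * b) = ul (a * \sum_i c i b *: e i).
  apply/eqP; rewrite -subr_eq0 -[u _]/(ul _) -linearB -mulrBr; apply/eqP/uI.
  by have [] := idI a _ (cP b).
rewrite mulr_sumr linear_sum; apply: eq_bigr => i _.
by rewrite -scalerAr linearZ.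
Qed.

Definition fdual_comul (u : fdual A) : fdual A \ot fdual A :=
  sval (cid (fdual_comul_exists u)).

Lemma fdual_comulE u a b : fdual_pair (fdual_comul u) a b = ev u (a * b).
Proof. exact: svalP (cid (fdual_comul_exists u)) a b. Qed.

End Comultiplication.

Lemma counit_finite_dual (H : hopfAlgType k) :
  (@counit k H : H -> k^o) \in @finite_dual k H.
Proof.
apply/asboolP; split; first exact: linearP.
exists ([pred h | counit h == 0] : {pred H}); split.
- split; first split.
  + by rewrite inE linear0.
  + move=> a x y; rewrite !inE linearP => /eqP -> /eqP ->.
    by rewrite scaler0 addr0.
  + by move=> a x; rewrite !inE !counitM => /eqP ->; rewrite mulr0 mul0r.
- exists 1%N, (fun=> 1) => v; exists (fun=> counit v).
  by rewrite big_ord1 inE linearB linearZ /= counit1 [_ *: _]mulr1 subrr.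
- by move=> x /eqP.
Qed.

Definition fdual_unit (H : hopfAlgType k) : fdual H :=
  Subspace (counit_finite_dual H).

End FiniteDualHopf.

(** * Quantum tangent spaces *)

Section QuantumTangentSpace.
Context {k : fieldType} {H : hopfAlgType k}.
Implicit Type g : submodClosed (fdual H).

(* The last clause is [Delta(g) <= g \ot epsilon + H^o \ot g] inside
   [H^o \ot H^o]. *)
Definition quantum_tangent_space g :=
  [/\ finite_dim (subspace g),
      forall x, x \in g -> ev x 1 = 0 &
      forall x, x \in g ->
        exists2 y, y \in g &
        exists t : fdual H \ot subspace g,
          fdual_comul x
            = y \ot fdual_unit H + tmap idfun (@subspace_val k _ g) t].

(* [h |-> h_1 S(h_3) x(h_2)] *)
Definition ad (x : fdual H) (h : H) : H :=
  sweedler3 h (fun h1 h2 h3 => ev x h2 *: (h1 * antipode h3)).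

Definition tangent_bicovariant g :=
  forall x, x \in g ->
    exists t : subspace g \ot H,
      forall h, ad x h = tlift (fun (y : subspace g) a => ev (\val y) h *: a) t.

End QuantumTangentSpace.

Record bicovQTS (k : fieldType) (H : hopfAlgType k) := BicovQTS {
  qts_space :> submodClosed (fdual H);
  qts_tangent : quantum_tangent_space qts_space;
  qts_bicovariant : tangent_bicovariant qts_space
}.

(** * First order vector field calculi *)

Section VectorFields.
Context {k : fieldType} (H : hopfAlgType k).

Record bimodule (X : lmodType k) := Bimodule {
  lact : H -> X -> X;
  ract : X -> H -> X;
  lact_bilinear : bilinear_fun lact;
  ract_bilinear : bilinear_fun ract;
  lact1 : forall x, lact 1 x = x;
  ract1 : forall x, ract x 1 = x;
  lactM : forall a b x, lact (a * b) x = lact a (lact b x);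
  ractM : forall x a b, ract x (a * b) = ract (ract x a) b;
  lract : forall a x b, ract (lact a x) b = lact a (ract x b)
}.

(* [lie] is the map L : X -> End_k(H), with End_k(H) seen inside the vector
   space of all functions H -> H. *)
Record fovc (X : lmodType k) := Fovc {
  to_bimodule :> bimodule X;
  lie : {linear X -> (H -> H)};
  lie_endo : forall x, linear (lie x);
  lie_inj : injective lie;
  lie_lact : forall h x g, lie (lact to_bimodule h x) g = h * lie x g;
  lie_leibniz : forall x h g,
    lie x (h * g) = lie x h * g + lie (ract to_bimodule x h) g
}.

Record bicov_fovc (X : lmodType k) := BicovFovc {
  to_fovc :> fovc X;
  lcoact : {linear X -> (H \ot X)%type};
  rcoact : {linear X -> (X \ot H)%type};
  lcoactA : forall x,
    tassoc (tmap comul idfun (lcoact x)) = tmap idfun lcoact (lcoact x);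
  lcoact_counit : forall x,
    tlift (fun (a : H) (y : X) => counit a *: y) (lcoact x) = x;
  rcoactA : forall x,
    tassoc (tmap rcoact idfun (rcoact x)) = tmap idfun comul (rcoact x);
  rcoact_counit : forall x,
    tlift (fun (y : X) (a : H) => counit a *: y) (rcoact x) = x;
  lrcoact : forall x,
    tassoc (tmap lcoact idfun (rcoact x)) = tmap idfun rcoact (lcoact x);
  lcoact_bimodule : forall a x b,
    lcoact (ract to_fovc (lact to_fovc a x) b)
      = tmap2 *%R (ract to_fovc)
          (tmap2 *%R (lact to_fovc) (comul a) (lcoact x)) (comul b);
  rcoact_bimodule : forall a x b,
    rcoact (ract to_fovc (lact to_fovc a x) b)
      = tmap2 (ract to_fovc) *%R
          (tmap2 (lact to_fovc) *%R (comul a) (rcoact x)) (comul b);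
  (* Colinearity of [X \ot H -> H, x \ot h |-> lie x h]: with
     [lcoact x = x_(-1) \ot x_0] and [rcoact x = x_0 \ot x_1],
     [Delta(lie x h) = x_(-1) h_1 \ot lie x_0 h_2 = lie x_0 h_1 \ot x_1 h_2]. *)
  lie_lcolinear : forall x h,
    comul (lie to_fovc x h)
      = tmap2 *%R (lie to_fovc) (lcoact x) (comul h);
  lie_rcolinear : forall x h,
    comul (lie to_fovc x h)
      = tmap2 (lie to_fovc) *%R (rcoact x) (comul h)
}.

Definition left_coinvariants X (C : bicov_fovc X) : {pred X} :=
  fun x => `[< lcoact C x = 1 \ot x >].

Lemma left_coinvariants_submod X (C : bicov_fovc X) :
  submod_closed (left_coinvariants C).
Proof.
split=> [|a x y /asboolP xC /asboolP yC]; apply/asboolP.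
  rewrite linear0; have := (@tens_bilinear k H X).2 1 (-1) 0 0.
  by rewrite /= scaler0 addr0 scaleN1r addNr.
by rewrite linearP xC yC (@tens_bilinear k H X).2.
Qed.

HB.instance Definition _ X (C : bicov_fovc X) :=
  GRing.isSubmodClosed.Build k X (left_coinvariants C)
    (GRing.submod_closed_semi (left_coinvariants_submod C)).

Record fin_bicov_fovc := FinBicovFovc {
  vfields : lmodType k;
  vfields_calculus :> bicov_fovc vfields;
  vfields_fin : finite_dim (subspace (left_coinvariants vfields_calculus))
}.

Definition fovc_iso (C D : fin_bicov_fovc) :=
  exists Phi : {linear vfields C -> vfields D},
    [/\ bijective Phi,
        forall h x, Phi (lact C h x) = lact D h (Phi x),
        forall x h, Phi (ract C x h) = ract D (Phi x) h,
        forall x, lcoact D (Phi x) = tmap idfun Phi (lcoact C x) &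
        forall x, rcoact D (Phi x) = tmap Phi idfun (rcoact C x)]
    /\ forall x, lie D (Phi x) = lie C x.

(* Isomorphism classes, as the predicates [fovc_iso C]. *)
Definition fovc_isoclass :=
  {P : fin_bicov_fovc -> Prop | exists C, P = fovc_iso C}.

Definition isoclass (C : fin_bicov_fovc) : fovc_isoclass :=
  exist _ (fovc_iso C) (ex_intro _ C erefl).

Definition tangent_calculus (g : submodClosed (fdual H))
    (C : bicov_fovc (H \ot subspace g)%type) :=
  [/\ forall h a (x : subspace g), lact C a (h \ot x) = (a * h) \ot x,
      forall h (x : subspace g),
        lcoact C (h \ot x) = sweedler2 h (fun h1 h2 => h1 \ot (h2 \ot x)),
      forall h (x : subspace g) a,
        lie C (h \ot x) a
          = sweedler2 a (fun a1 a2 => ev (\val x) a2 *: (h * a1)) &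
      forall n (chi : 'I_n -> subspace g)
          (f : 'I_n -> 'I_n -> fdual H) (N : 'I_n -> 'I_n -> H),
        is_basis chi ->
        (forall i, fdual_comul (\val (chi i))
            = \val (chi i) \ot fdual_unit H
              + \sum_j f i j \ot \val (chi j)) ->
        (forall i h, ad (\val (chi i)) h
            = \sum_j ev (\val (chi j)) h *: N i j) ->
        (forall h a b i, ract C (lact C a (h \ot chi i)) b
            = \sum_j sweedler2 b
                (fun b1 b2 => (ev (f i j) b2 *: (a * h * b1)) \ot chi j))
        /\ (forall h i, rcoact C (h \ot chi i)
            = \sum_j sweedler2 h
                (fun h1 h2 => (h1 \ot chi j) \ot (h2 * N i j)))].

End VectorFields.

(* Main.v *)
From HB Require Import structures.
Require Import Defs.
From mathcomp Require Import all_boot all_algebra.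
From mathcomp Require Import boolp classical_sets functions.

(** A coinvariant vector field [x] acts by [h |-> h_1 chi(h_2)] with
    [chi = epsilon \o lie x]. So a calculus gives the space of these functionals, and
    the fundamental theorem of Hopf modules identifies the calculus with the free
    left module on it ([coinv_expand], [tangent_reconstruction]). The Leibniz rule
    says that the functionals are matrix coefficients of a finite-dimensional
    representation, hence lie in the finite dual, and right colinearity is
    bicovariance ([tangent_ad]). Conversely the structure on [H \ot g] is built in
    [TangentCalculus]; [g] is recovered as the space of functionals of the
    coinvariants ([tangent_recover]).

    The delicate point is that [H \ot g -> End(H)] is injective ([Dl_free]); the
    direct argument applies the inverse of the antipode, which need not exist. Let
    [chi_i] be a basis of [g], with coefficients [f i j] of the comultiplication and
    [N i j] of [ad]. The right invariant fields [Dr i = chi_i(h_1) h_2] are free over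
    [H] by the antipode axiom, and [Dl i = h_1 chi_i(h_2)] is [\sum_j N i j * Dr j];
    so one needs a right inverse of the matrix [N]. The antipode gives inverses for
    the transpose of [N] and for [S^2 N], but none for [N].

    The Leibniz rule makes [f] and [N] the action and the coaction of a
    Yetter-Drinfeld module ([yetter_drinfeld]), whose Drinfeld element
    [u(v) = v_0 S(v_1)], the scalar matrix [U = drinfeld], satisfies
    [U N = S^2(N) U], [f(h) U = U f(S^2 h)] and [v = u(v_0) v_1]
    ([drinfeldN], [coeff_drinfeld], [drinfeld_unit]). If [U] is invertible, then it
    conjugates [N] to [S^2 N], and [N] has a right inverse. Let [e] be the projection
    to the part of the space on which [U] is invertible, along the part on which it
    is nilpotent (Fitting). Powers of [U] intertwine [N] with [S^(2m) N], which shows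
    that [S^(2m) N] commutes with [e]; since [S^(n+1) N] is the inverse of [S^n N],
    up to transposition for even [n], so does [N] ([scomm_fitting]). Thus the
    nilpotent part is stable under the coaction, and [v = u(v_0) v_1] expresses its
    elements through the image of [U] on it, so that it vanishes ([drinfeld_nilp]). *)

Set Implicit Arguments.
Unset Strict Implicit.
Unset Printing Implicit Defensive.

Import GRing.Theory.
Local Open Scope ring_scope.

(** * Linear maps on tensor products *)

Section LinearMaps.
Context {k : fieldType}.
Implicit Types U V W : lmodType k.

Lemma lin_linear U V (f : {linear U -> V}) : linear f.
Proof. exact: linearP. Qed.

Lemma lin0 U V (f : U -> V) : linear f -> f 0 = 0.
Proof.
by move=> fL; have := fL (-1) 0 0; rewrite scaler0 addr0 scaleN1r addNr.
Qed.

Lemma linZ U V (f : U -> V) a x : linear f -> f (a *: x) = a *: f x.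
Proof. by move=> fL; have := fL a x 0; rewrite (lin0 fL) !addr0. Qed.

Lemma linD U V (f : U -> V) x y : linear f -> f (x + y) = f x + f y.
Proof. by move=> fL; have := fL 1 x y; rewrite !scale1r. Qed.

Lemma linN U V (f : U -> V) x : linear f -> f (- x) = - f x.
Proof. by move=> fL; rewrite -scaleN1r linZ // scaleN1r. Qed.

Lemma linB U V (f : U -> V) x y : linear f -> f (x - y) = f x - f y.
Proof. by move=> fL; rewrite linD // linN. Qed.

Lemma linS U V (f : U -> V) I (r : seq I) (P : pred I) (F : I -> U) :
  linear f -> f (\sum_(i <- r | P i) F i) = \sum_(i <- r | P i) f (F i).
Proof.
by move=> fL; apply: big_morph => [x y|]; [exact: linD|exact: lin0].
Qed.

Lemma linSZ U V (f : U -> V) I (r : seq I) (c : I -> k) (F : I -> U) :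
  linear f -> f (\sum_(i <- r) c i *: F i) = \sum_(i <- r) c i *: f (F i).
Proof. by move=> fL; rewrite linS //; apply: eq_bigr => i _; rewrite linZ. Qed.

Lemma lin_id V : linear (fun x : V => x).
Proof. by []. Qed.

Lemma lin_app U V W (f : V -> W) (g : U -> V) :
  linear f -> linear g -> linear (fun x => f (g x)).
Proof. by move=> fL gL a x y; rewrite gL fL. Qed.

Lemma lin_add U V (f g : U -> V) :
  linear f -> linear g -> linear (fun x => f x + g x).
Proof. by move=> fL gL a x y; rewrite fL gL scalerDr addrACA. Qed.

Lemma lin_sum U V (I : Type) (r : seq I) (P : pred I) (F : U -> I -> V) :
  (forall i, linear (F ^~ i)) -> linear (fun x => \sum_(i <- r | P i) F x i).
Proof.
move=> FL a x y; rewrite scaler_sumr -big_split /=.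
by apply: eq_bigr => i _; rewrite FL.
Qed.

Lemma lin_scale U V (f : U -> V) (c : k) :
  linear f -> linear (fun x => c *: f x).
Proof. by move=> fL a x y; rewrite fL scalerDr !scalerA mulrC. Qed.

Lemma lin_scalar U V (f : U -> k^o) (v : V) :
  linear f -> linear (fun x => (f x : k) *: v).
Proof. by move=> fL a x y; rewrite fL scalerDl scalerA. Qed.

Lemma lin_mull U (A : algType k) (f : U -> A) (c : A) :
  linear f -> linear (fun x => f x * c).
Proof. by move=> fL a x y; rewrite fL mulrDl scalerAl. Qed.

Lemma lin_mulr U (A : algType k) (f : U -> A) (c : A) :
  linear f -> linear (fun x => c * f x).
Proof. by move=> fL a x y; rewrite fL mulrDr scalerAr. Qed.

Lemma lin_mulk U (f : U -> k^o) (c : k) :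
  linear f -> linear (fun x => (f x : k) * c : k^o).
Proof. by move=> fL a x y; rewrite fL mulrDl scalerAl. Qed.

Lemma lin_kmul U (f : U -> k^o) (c : k) :
  linear f -> linear (fun x => c * (f x : k) : k^o).
Proof. by move=> fL a x y; rewrite fL mulrDr scalerAr. Qed.

Lemma lin_tensl U V W (f : U -> V) (w : W) :
  linear f -> linear (fun x => f x \ot w).
Proof. by move=> fL a x y; rewrite fL; exact: (tens_bilinear V W).1. Qed.

Lemma lin_tensr U V W (f : U -> W) (v : V) :
  linear f -> linear (fun x => v \ot f x).
Proof. by move=> fL a x y; rewrite fL; exact: (tens_bilinear V W).2. Qed.

Lemma lin_fun U V (T : Type) (F : U -> T -> V) :
  (forall t, linear (F ^~ t)) -> linear (F : U -> (T -> V)).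
Proof. by move=> FL a x y; apply/funext => t; exact: FL. Qed.

Lemma lin_tlift_fun U V W (X : lmodType k) (F : U -> V -> W -> X) (t : V \ot W) :
  (forall v w, linear (fun x => F x v w)) ->
  linear (fun x => tlift (F x) t).
Proof. by move=> FL; apply: lin_sum => p; exact: FL. Qed.

Lemma bilin V W (X : lmodType k) (F : V -> W -> X) :
  (forall w, linear (fun v => F v w)) -> (forall v, linear (fun w => F v w)) ->
  bilinear_fun F.
Proof. by []. Qed.

Lemma lin_tlift U V W (X : lmodType k) (F : V -> W -> X) (g : U -> V \ot W) :
  bilinear_fun F -> linear g -> linear (fun x => tlift F (g x)).
Proof. by move=> /tlift_linear FL; exact: lin_app. Qed.

End LinearMaps.

Section TensorExt.
Context {k : fieldType}.
Implicit Types U V W : lmodType k.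

Lemma tlift_comp U U' V W (L : U -> U') (F : V -> W -> U) (t : V \ot W) :
  linear L -> L (tlift F t) = tlift (fun v w => L (F v w)) t.
Proof.
move=> LL; pose l : {linear U -> U'} := HB.pack L (GRing.isLinear.Build _ _ _ _ _ LL).
by rewrite -[L]/(l : U -> U') /tlift linear_sum.
Qed.

Lemma eq_tlift U V W (F G : V -> W -> U) (t : V \ot W) :
  (forall v w, F v w = G v w) -> tlift F t = tlift G t.
Proof. by move=> FG; apply: eq_bigr => p _. Qed.

Lemma tlift_tensK V W (t : V \ot W) : tlift (@tens k V W) t = t.
Proof. exact: esym (tensor_span t). Qed.

Lemma tensor_ext U V W (f g : V \ot W -> U) :
  linear f -> linear g -> (forall v w, f (v \ot w) = g (v \ot w)) -> f =1 g.
Proof.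
move=> fL gL fg t; rewrite -[t]tlift_tensK !tlift_comp //; exact: eq_tlift.
Qed.

End TensorExt.

Lemma lin_bilinl (k : fieldType) (U V W X : lmodType k) (F : V -> W -> X)
    (g : U -> V) (w : W) :
  bilinear_fun F -> linear g -> linear (fun x => F (g x) w).
Proof. by move=> [FL _] gL a x y; rewrite gL FL. Qed.

Lemma lin_bilinr (k : fieldType) (U V W X : lmodType k) (F : V -> W -> X)
    (g : U -> W) (v : V) :
  bilinear_fun F -> linear g -> linear (fun x => F v (g x)).
Proof. by move=> [_ FL] gL a x y; rewrite gL FL. Qed.

Lemma tmap_linear (k : fieldType) (V V' W W' : lmodType k)
    (f : V -> V') (g : W -> W') : linear f -> linear g -> linear (tmap f g).
Proof.
move=> fL gL; apply: tlift_linear; apply: bilin => ?.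
  exact: lin_tensl.
exact: lin_tensr.
Qed.

Lemma tassoc_linear (k : fieldType) (U V W : lmodType k) :
  linear (@tassoc k U V W).
Proof.
apply: tlift_linear; apply: bilin => [w|x].
  apply: tlift_linear; apply: bilin => ?.
    exact: lin_tensl (@lin_id _ _).
  by apply: lin_tensr; exact: lin_tensl (@lin_id _ _).
apply: (@lin_tlift_fun _ _ _ _ _ (fun w u v => u \ot (v \ot w)) x) => ? ?.
by apply: lin_tensr; exact: lin_tensr (@lin_id _ _).
Qed.

Lemma tmap2_bilinear (k : fieldType) (U U' U'' V V' V'' : lmodType k)
    (f : U -> U' -> U'') (g : V -> V' -> V'') :
  bilinear_fun f -> bilinear_fun g -> bilinear_fun (tmap2 f g).
Proof.
move=> fB gB; apply: bilin => [y|x].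
  apply: tlift_linear; apply: bilin => [v|u].
    apply: (@lin_tlift_fun _ _ _ _ _ (fun u u' v' => f u u' \ot g v v') y) => u' v'.
    apply: lin_tensl; exact: (lin_bilinl _ fB (@lin_id _ _)).
  apply: (@lin_tlift_fun _ _ _ _ _ (fun v u' v' => f u u' \ot g v v') y) => u' v'.
  apply: lin_tensr; exact: (lin_bilinl _ gB (@lin_id _ _)).
apply: (@lin_tlift_fun _ _ _ _ _
  (fun y u v => tlift (fun u' v' => f u u' \ot g v v') y) x) => u v.
apply: tlift_linear; apply: bilin => ?.
  apply: lin_tensl; exact: (lin_bilinr _ fB (@lin_id _ _)).
apply: lin_tensr; exact: (lin_bilinr _ gB (@lin_id _ _)).
Qed.

Lemma lin_sweedler2 (k : fieldType) (H : hopfAlgType k) (U V : lmodType k)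
    (F : H -> H -> V) (g : U -> H) :
  bilinear_fun F -> linear g -> linear (fun x => sweedler2 (g x) F).
Proof. by move=> FB gL; apply: lin_tlift => // a x y; rewrite gL linearP. Qed.

Ltac lin_hyp :=
  match goal with
  | H : linear _ |- _ => exact H
  | H : forall _, linear _ |- _ => exact (H _)
  | H : forall _ _, linear _ |- _ => exact (H _ _)
  | H : bilinear_for _ _ _ |- _ => first [exact H | exact (H.1 _) | exact (H.2 _)]
  | H : forall _, bilinear_for _ _ _ |- _ =>
      first [exact (H _) | exact ((H _).1 _) | exact ((H _).2 _)]
  end.

Ltac lin_head :=
  first [ lin_hyp | exact: linearP | exact: tassoc_linear
        | apply: tmap_linear
        | apply: (tmap2_bilinear _ _).2
        | apply: tlift_linear ].

(* Extended below by the linearity of further operations. *)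
Ltac lin_ext := fail.

(** Decomposes the claim that a map is linear, or bilinear, along its body; the
    operations have to be those above, or linear by a hypothesis. The patterns
    [fun _ => ?c] recognize a factor that does not depend on the variable. *)
Ltac lin_step :=
  cbv beta;
  lazymatch goal with
  | |- forall _, _ => intro
  | |- bilinear_for _ _ (tmap2 _ _) => apply: tmap2_bilinear
  | |- bilinear_for _ _ (@tens _ _ _) => exact: tens_bilinear
  | |- bilinear_for _ _ _ => first [lin_hyp | apply: bilin]
  | |- linear (fun x => x) => exact: lin_id
  | |- linear (@GRing.mul _ _) => exact: lin_mulr (@lin_id _ _)
  | |- linear (@tens _ _ _ _) => exact: lin_tensr (@lin_id _ _)
  | |- linear (fun x => (@?f x + @?g x)%R) => apply: (@lin_add _ _ _ f g)
  | |- linear (fun x => bigop _ ?r (fun i => BigBody i _ (@?P i) (@?F x i))) =>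
      apply: (@lin_sum _ _ _ _ r P F)
  | |- linear (fun x => (@?f x) \ot (@?g x)) =>
      lazymatch f with
      | fun _ => ?c => apply: (@lin_tensr _ _ _ _ g c)
      | _ => lazymatch g with fun _ => ?c => apply: (@lin_tensl _ _ _ _ f c) end
      end
  | |- linear (fun x => (@?f x) *: (@?g x)) =>
      lazymatch f with
      | fun _ => ?c => apply: (@lin_scale _ _ _ g c)
      | _ => lazymatch g with fun _ => ?c => apply: (@lin_scalar _ _ _ f c) end
      end
  | |- linear (fun x => (@?f x * @?g x)%R) =>
      lazymatch f with
      | fun _ => ?c =>
          first [apply: (@lin_mulr _ _ _ g c) | apply: (@lin_kmul _ _ g c)]
      | _ => lazymatch g with
             | fun _ => ?c =>
                 first [apply: (@lin_mull _ _ _ f c) | apply: (@lin_mulk _ _ f c)]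
             end
      end
  | |- linear (fun x => tlift (@?F x) (@?g x)) =>
      lazymatch F with
      | fun _ => ?G => apply: (@lin_tlift _ _ _ _ _ G g)
      | _ => lazymatch g with
             | fun _ => ?t => apply: (@lin_tlift_fun _ _ _ _ _ F t) => ? ?
             end
      end
  | |- linear (fun x => sweedler2 (@?g x) (@?F x)) =>
      lazymatch F with
      | fun _ => ?G => apply: (@lin_sweedler2 _ _ _ _ G g)
      | _ => lazymatch g with
             | fun _ => ?t =>
                 apply: (@lin_tlift_fun _ _ _ _ _ F (comul t)) => ? ?
             end
      end
  | |- linear (fun x => ?f (@?h x)) =>
      first [ lin_hyp
            | apply: (@lin_app _ _ _ _ f h); [solve [lin_head] | ]
            | apply: (@lin_app _ _ _ _ f h)
            | lazymatch goal with
              | |- linear (fun x => ?f' (@?g x) (@?h x)) =>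
                  lazymatch h with fun _ => ?c =>
                    apply: (@lin_bilinl _ _ _ _ _ f' g c) end
              end ]
  | |- linear _ => first [lin_ext | lin_head]
  end.

Ltac lin := repeat lin_step.

(** * The algebra structure on the tensor square *)

Section TensorEval.
Context {k : fieldType}.
Implicit Types U V W : lmodType k.

Lemma tmap_tens V V' W W' (f : V -> V') (g : W -> W') v w :
  linear f -> linear g -> tmap f g (v \ot w) = f v \ot g w.
Proof. by move=> fL gL; rewrite /tmap tlift_tens //; lin. Qed.

Lemma tassoc_tensl U V W (t : U \ot V) (w : W) :
  tassoc (t \ot w) = tlift (fun u v => u \ot (v \ot w)) t.
Proof. by rewrite /tassoc !tlift_tens //; lin. Qed.

Lemma tmap2_tens U U' U'' V V' V'' (f : U -> U' -> U'') (g : V -> V' -> V'')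
    u v u' v' :
  bilinear_fun f -> bilinear_fun g ->
  tmap2 f g (u \ot v) (u' \ot v') = f u u' \ot g v v'.
Proof. by move=> fB gB; rewrite /tmap2 !tlift_tens //; lin. Qed.

Lemma tens0l V W (w : W) : (0 : V) \ot w = 0.
Proof. exact: lin0 (lin_tensl w (@lin_id _ V)). Qed.

Lemma tens0r V W (v : V) : v \ot (0 : W) = 0.
Proof. exact: lin0 (lin_tensr v (@lin_id _ W)). Qed.

Lemma tensDl V W (v v' : V) (w : W) : (v + v') \ot w = v \ot w + v' \ot w.
Proof. exact: linD _ _ (lin_tensl w (@lin_id _ V)). Qed.

Lemma tensDr V W (v : V) (w w' : W) : v \ot (w + w') = v \ot w + v \ot w'.
Proof. exact: linD _ _ (lin_tensr v (@lin_id _ W)). Qed.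

Lemma tensZl V W a (v : V) (w : W) : (a *: v) \ot w = a *: (v \ot w).
Proof. exact: linZ _ _ (lin_tensl w (@lin_id _ V)). Qed.

Lemma tensZr V W a (v : V) (w : W) : v \ot (a *: w) = a *: (v \ot w).
Proof. exact: linZ _ _ (lin_tensr v (@lin_id _ W)). Qed.

Lemma tens_suml V W I (r : seq I) P (F : I -> V) (w : W) :
  (\sum_(i <- r | P i) F i) \ot w = \sum_(i <- r | P i) F i \ot w.
Proof.
by apply: (big_morph (fun v => v \ot w)) => [? ?|]; rewrite ?tensDl ?tens0l.
Qed.

Lemma tens_sumr V W I (r : seq I) P (F : I -> W) (v : V) :
  v \ot (\sum_(i <- r | P i) F i) = \sum_(i <- r | P i) v \ot F i.
Proof.
by apply: (big_morph (fun w => v \ot w)) => [? ?|]; rewrite ?tensDr ?tens0r.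
Qed.

End TensorEval.

Section TensorAlgebra.
Context {k : fieldType} {H : hopfAlgType k}.
Local Notation HH := (H \ot H)%type.

Let m : HH -> HH -> HH := tmap2 *%R *%R.

Let mB : bilinear_fun m.
Proof. rewrite /m; lin. Qed.

Let mE a b c d : m (a \ot b) (c \ot d) = (a * c) \ot (b * d).
Proof. rewrite /m tmap2_tens //; lin. Qed.

Lemma tmulA : associative m.
Proof.
move=> x y z; move: x; apply: tensor_ext; [lin|lin|move=> x1 x2].
move: y; apply: tensor_ext; [lin|lin|move=> y1 y2].
move: z; apply: tensor_ext; [lin|lin|move=> z1 z2].
by rewrite !mE !mulrA.
Qed.

Lemma tmul1l : left_id (1 \ot 1) m.
Proof. by apply: tensor_ext; [lin|lin|move=> x1 x2]; rewrite mE !mul1r. Qed.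

Lemma tmul1r : right_id (1 \ot 1) m.
Proof. by apply: tensor_ext; [lin|lin|move=> x1 x2]; rewrite mE !mulr1. Qed.

Let bilD : left_distributive m +%R * right_distributive m +%R.
Proof.
split=> [x y z|z x y]; first by have := mB.1 z 1 x y; rewrite /= !scale1r.
by have := mB.2 z 1 x y; rewrite /= !scale1r.
Qed.

Lemma tens11_neq0 : (1 : H) \ot (1 : H) != 0.
Proof.
apply/eqP => /(congr1 (tlift (fun a b : H => (counit a : k) * (counit b : k) : k^o))).
have B : bilinear_fun (fun a b : H => (counit a : k) * (counit b : k) : k^o) by lin.
rewrite tlift_tens // !counit1 mulr1 -[0](tens0l _ (0 : H)) tlift_tens // linear0 mul0r.
by apply/eqP; exact: oner_neq0.
Qed.

HB.instance Definition _ := GRing.Zmodule_isNzRing.Build HH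
  tmulA tmul1l tmul1r bilD.1 bilD.2 tens11_neq0.

Let scaleAl (a : k) (x y : HH) : a *: (x * y) = (a *: x) * y.
Proof.
have := mB.1 y a x 0; rewrite /= addr0.
by rewrite -[m 0 y]/((0 : HH) * y) mul0r addr0.
Qed.

HB.instance Definition _ := GRing.Lmodule_isLalgebra.Build k HH scaleAl.

Let scaleAr (a : k) (x y : HH) : a *: (x * y) = x * (a *: y).
Proof.
have := mB.2 x a y 0; rewrite /= addr0.
by rewrite -[m x 0]/(x * (0 : HH)) mulr0 addr0.
Qed.

HB.instance Definition _ := GRing.Lalgebra_isAlgebra.Build k HH scaleAr.

Lemma mul_tens (a b c d : H) : (a \ot b) * (c \ot d) = (a * c) \ot (b * d).
Proof. exact: mE. Qed.

Lemma comul_mul (g h : H) : comul (g * h) = comul g * comul h.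
Proof. exact: comulM. Qed.

End TensorAlgebra.

(** * Convolution *)

Section Sweedler.
Context {k : fieldType} {H : hopfAlgType k}.
Implicit Type U : lmodType k.

Lemma sweedler_comp U U' (L : U -> U') (F : H -> H -> U) (h : H) :
  linear L -> L (sweedler2 h F) = sweedler2 h (fun a b => L (F a b)).
Proof. exact: tlift_comp. Qed.

Lemma eq_sweedler U (F G : H -> H -> U) (h : H) :
  (forall a b, F a b = G a b) -> sweedler2 h F = sweedler2 h G.
Proof. exact: eq_tlift. Qed.

Lemma sweedler_tmap U (V W : lmodType k) (f : H -> V) (g : H -> W) (F : V -> W -> U) (h : H) :
  linear f -> linear g -> bilinear_fun F ->
  tlift F (tmap f g (comul h)) = sweedler2 h (fun a b => F (f a) (g b)).
Proof.
move=> fL gL FB; rewrite /tmap tlift_comp; last by lin.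
by apply: eq_tlift => a b; rewrite tlift_tens.
Qed.

Lemma sweedler_coassoc U (F : H -> H -> H -> U) (h : H) :
  (forall b c, linear (fun a => F a b c)) ->
  (forall a c, linear (fun b => F a b c)) ->
  (forall a b, linear (fun c => F a b c)) ->
  sweedler2 h (fun a b => sweedler2 a (fun a1 a2 => F a1 a2 b))
    = sweedler2 h (fun a b => sweedler2 b (fun b1 b2 => F a b1 b2)).
Proof.
move=> F1 F2 F3.
pose L (t : H \ot (H \ot H)) := tlift (fun a s => tlift (F a) s) t.
have LB a : bilinear_fun (F a) by lin.
have LL : linear L by rewrite /L; lin.
have := congr1 L (comulA h).
have -> : L (tmap idfun comul (comul h)) = sweedler2 h (fun a b => sweedler2 b (F a)).
  by rewrite /L sweedler_tmap //; lin.
move=> <-; rewrite /tmap [RHS](_ : _ = sweedler2 h (fun a b => L (tassoc (comul a \ot b)))).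
  apply: eq_tlift => a b; rewrite tassoc_tensl [RHS]tlift_comp //.
  by apply: eq_tlift => a1 a2; rewrite /L tlift_tens ?tlift_tens //; lin.
rewrite -[LHS]/((fun t => L (tassoc t)) _) tlift_comp //.
by lin.
Qed.

Lemma sweedler_counitl U (L : H -> U) (h : H) :
  linear L -> sweedler2 h (fun a b => (counit a : k) *: L b) = L h.
Proof.
move=> LL; rewrite -[in RHS](counitl h) tlift_comp //.
by apply: eq_tlift => a b; rewrite linZ.
Qed.

Lemma sweedler_counitr U (L : H -> U) (h : H) :
  linear L -> sweedler2 h (fun a b => (counit b : k) *: L a) = L h.
Proof.
move=> LL; rewrite -[in RHS](counitr h) tlift_comp //.
by apply: eq_tlift => a b; rewrite linZ.
Qed.

Lemma sweedler_exchange U (F : H -> H -> H -> H -> U) (g h : H) :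
  sweedler2 g (fun a b => sweedler2 h (F a b))
    = sweedler2 h (fun c d => sweedler2 g (fun a b => F a b c d)).
Proof. exact: exchange_big. Qed.

Lemma sweedler_mul U (F : H -> H -> U) (g h : H) :
  bilinear_fun F ->
  sweedler2 (g * h) F
    = sweedler2 g (fun a b => sweedler2 h (fun c d => F (a * c) (b * d))).
Proof.
move=> FB; rewrite /sweedler2 comulM /tmap2 tlift_comp; last by lin.
apply: eq_tlift => a b; rewrite tlift_comp; last by lin.
by apply: eq_tlift => c d; rewrite tlift_tens.
Qed.

Lemma sweedler_unit U (F : H -> H -> U) : bilinear_fun F -> sweedler2 1 F = F 1 1.
Proof. by move=> FB; rewrite /sweedler2 comul1 tlift_tens. Qed.

End Sweedler.

Section Embeddings.
Context {k : fieldType} {H : hopfAlgType k}.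

(** The two embeddings of [H] in its tensor square; [comul] is their
    convolution product. *)
Definition inl_ (h : H) : H \ot H := h \ot 1.
Definition inr_ (h : H) : H \ot H := 1 \ot h.

Lemma lin_inl : linear inl_. Proof. by rewrite /inl_; lin. Qed.
Lemma lin_inr : linear inr_. Proof. by rewrite /inr_; lin. Qed.

End Embeddings.

Section Convolution.
Context {k : fieldType} {H : hopfAlgType k}.
Variable A : algType k.
Implicit Types (f g : H -> A) (u : H -> k^o).

Definition conv f g : H -> A := fun h => sweedler2 h (fun a b => f a * g b).

(** Lets functionals be convolved with maps to [A]. *)
Definition scal u : H -> A := fun h => (u h : k) *: 1.

Lemma lin_conv f g : linear f -> linear g -> linear (conv f g).
Proof. by move=> fL gL; rewrite /conv; lin. Qed.

Lemma lin_scal u : linear u -> linear (scal u).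
Proof. by move=> uL; rewrite /scal; lin. Qed.

Lemma convA f1 f2 f3 :
  linear f1 -> linear f2 -> linear f3 ->
  conv f1 (conv f2 f3) = conv (conv f1 f2) f3.
Proof.
move=> L1 L2 L3; apply/funext => h; rewrite /conv.
transitivity (sweedler2 h (fun a b => sweedler2 b (fun c d => f1 a * f2 c * f3 d))).
  apply: eq_sweedler => a b; rewrite sweedler_comp; last by lin.
  by apply: eq_sweedler => c d; rewrite mulrA.
apply: etrans (esym (sweedler_coassoc (F := fun a c d => f1 a * f2 c * f3 d) _ _ _ _)) _; try by lin.
apply: eq_sweedler => a b; rewrite [RHS](sweedler_comp (L := fun x => x * f3 b)) //.
by lin.
Qed.

Lemma conv1l f : linear f -> conv (scal counit) f = f.
Proof.
move=> fL; apply/funext => h; rewrite -[RHS](sweedler_counitl h fL).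
by apply: eq_sweedler => a b; rewrite /scal -scalerAl mul1r.
Qed.

Lemma conv1r f : linear f -> conv f (scal counit) = f.
Proof.
move=> fL; apply/funext => h; rewrite -[RHS](sweedler_counitr h fL).
by apply: eq_sweedler => a b; rewrite /scal -scalerAr mulr1.
Qed.

Lemma conv_mull c f g : conv (fun h => c * f h) g = (fun h => c * conv f g h).
Proof.
apply/funext => h; rewrite /conv sweedler_comp; last by lin.
by apply: eq_sweedler => a b; rewrite mulrA.
Qed.

Lemma conv_mulr c f g : conv f (fun h => g h * c) = (fun h => conv f g h * c).
Proof.
apply/funext => h; rewrite /conv [RHS](sweedler_comp (L := fun x => x * c)); last by lin.
by apply: eq_sweedler => a b; rewrite mulrA.
Qed.

Lemma conv_suml I (r : seq I) P (F : I -> H -> A) g :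
  conv (fun h => \sum_(i <- r | P i) F i h) g
    = (fun h => \sum_(i <- r | P i) conv (F i) g h).
Proof.
apply/funext => h; rewrite /conv /sweedler2 /tlift exchange_big /=.
by apply: eq_bigr => p _; rewrite mulr_suml.
Qed.

Lemma conv_sumr I (r : seq I) P (F : I -> H -> A) f :
  conv f (fun h => \sum_(i <- r | P i) F i h)
    = (fun h => \sum_(i <- r | P i) conv f (F i) h).
Proof.
apply/funext => h; rewrite /conv /sweedler2 /tlift exchange_big /=.
by apply: eq_bigr => p _; rewrite mulr_sumr.
Qed.

End Convolution.

Ltac lin_ext ::=
  lazymatch goal with
  | |- linear (conv _ _) => apply: lin_conv
  | |- linear (scal _ _) => apply: lin_scal
  | |- linear inl_ => exact: lin_inl
  | |- linear inr_ => exact: lin_inr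
  end.

Section Antipode.
Context {k : fieldType} {H : hopfAlgType k}.
Local Notation HH := (H \ot H)%type.
Local Notation S := (@antipode k H).

Lemma conv_antipodel : conv antipode id = scal H counit.
Proof. by apply/funext => h; exact: antipodel. Qed.

Lemma conv_antipoder : conv id antipode = scal H counit.
Proof. by apply/funext => h; exact: antipoder. Qed.

Lemma conv_inv_uniq (A : algType k) (f g g' : H -> A) :
  linear f -> linear g -> linear g' ->
  conv g f = scal A counit -> conv f g' = scal A counit -> g = g'.
Proof.
move=> fL gL gL' gf fg.
by rewrite -[g]conv1r // -fg convA // gf conv1l.
Qed.

Lemma conv_constl (A : algType k) (u : H -> k^o) (c : A) (f : H -> A) :
  linear u -> linear f ->
  conv (fun h => (u h : k) *: c) f = (fun h => c * conv (scal A u) f h).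
Proof.
move=> uL fL; rewrite -conv_mull; congr conv; apply/funext => h.
by rewrite /scal -scalerAr mulr1.
Qed.

(** Both sides are convolution inverse to the multiplication, as maps of two
    variables. *)
Lemma antipodeM (g h : H) : S (g * h) = S h * S g.
Proof.
(* The two variables are treated one after the other: [step] removes [h]. *)
have step a :
    sweedler2 a (fun a1 a2 => S (a1 * h) * a2) = (counit a : k) *: S h.
  pose F a1 : H -> H := fun b => S (a1 * b).
  have FL a1 : linear (F a1) by rewrite /F; lin.
  transitivity (sweedler2 a (fun a1 a2 => conv (conv (F a1) (fun b => a2 * b)) S h)).
    apply: eq_sweedler => a1 a2; rewrite -convA; try by lin.
    rewrite (conv_mull a2 id) conv_antipoder /conv.
    rewrite -[LHS](sweedler_counitr (L := fun b => F a1 b * a2)); last by lin.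
    by apply: eq_sweedler => c d; rewrite /scal -!scalerAr mulr1.
  rewrite [LHS]sweedler_exchange.
  transitivity (conv (fun b => (counit b : k) *: ((counit a : k) *: (1 : H))) S h).
    apply: eq_sweedler => b1 b2.
    rewrite -[LHS](sweedler_comp (L := fun x => x * S b2)); last by lin.
    congr (_ * _).
    have -> : (counit b1 : k) *: ((counit a : k) *: (1 : H))
        = (counit (a * b1) : k) *: 1 by rewrite counitM scalerA mulrC.
    rewrite -antipodel [RHS]sweedler_mul //; lin.
  rewrite conv_constl; [|lin..].
  by rewrite conv1l -?scalerAl ?mul1r //; lin.
transitivity (conv (conv (fun a => S (a * h)) id) S g).
  rewrite -convA; [|lin..].
  by rewrite conv_antipoder conv1r //; lin.
have -> : conv (fun a => S (a * h)) id = (fun a => (counit a : k) *: S h).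
  by apply/funext => a; exact: step.
rewrite conv_constl; [|lin..].
by rewrite conv1l //; lin.
Qed.

Lemma antipode1 : S 1 = 1.
Proof.
have := antipodel (1 : H); rewrite -[LHS]/(sweedler2 _ _) sweedler_unit; last by lin.
by rewrite mulr1 counit1 scale1r.
Qed.

Lemma counit_antipode (h : H) : counit (S h) = counit h.
Proof.
have := congr1 counit (antipodel h).
rewrite -[tlift _ _]/(sweedler2 h (fun a b => S a * b)).
rewrite (sweedler_comp (L := @counit k H)); last exact: linearP.
rewrite linearZ /= counit1 [X in _ = X -> _]mulr1 => <-.
rewrite -[LHS](sweedler_counitr (L := fun b => counit (S b))); last by lin.
by apply: eq_sweedler => a b; rewrite counitM mulrC.
Qed.

Lemma conv_inl_inr : conv inl_ inr_ = @comul k H.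
Proof.
apply/funext => h; rewrite -[RHS]tlift_tensK; apply: eq_tlift => a b.
by rewrite mul_tens mulr1 mul1r.
Qed.

Lemma conv_inl (f g : H -> H) :
  conv (fun h => inl_ (f h)) (fun h => inl_ (g h)) = (fun h => inl_ (conv f g h)).
Proof.
apply/funext => h; rewrite [RHS]sweedler_comp; last by lin.
by apply: eq_sweedler => a b; rewrite mul_tens mulr1.
Qed.

Lemma conv_inr (f g : H -> H) :
  conv (fun h => inr_ (f h)) (fun h => inr_ (g h)) = (fun h => inr_ (conv f g h)).
Proof.
apply/funext => h; rewrite [RHS]sweedler_comp; last by lin.
by apply: eq_sweedler => a b; rewrite mul_tens mulr1.
Qed.

Lemma inl_scal (u : H -> k^o) : (fun h => inl_ (scal H u h)) = scal HH u.
Proof. by apply/funext => h; rewrite /inl_ /scal tensZl. Qed.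

Lemma inr_scal (u : H -> k^o) : (fun h => inr_ (scal H u h)) = scal HH u.
Proof. by apply/funext => h; rewrite /inr_ /scal tensZr. Qed.

Lemma conv_comul (f g : H -> H) :
  conv (fun h => comul (f h)) (fun h => comul (g h)) = (fun h => comul (conv f g h)).
Proof.
apply/funext => h; rewrite [RHS](sweedler_comp (L := @comul k H)); last exact: linearP.
by apply: eq_sweedler => a b; rewrite comul_mul.
Qed.

Lemma comul_scal (u : H -> k^o) : (fun h => comul (scal H u h)) = scal HH u.
Proof. by apply/funext => h; rewrite /scal linearZ /= comul1. Qed.

(** Both sides are convolution inverse to [comul], which is [conv inl_ inr_]. *)
Lemma comul_antipode_conv :
  (fun h => comul (S h)) = conv (fun h => inr_ (S h)) (fun h => inl_ (S h)).
Proof.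
apply: (conv_inv_uniq (f := comul)); try by lin.
  by rewrite [conv _ comul](conv_comul S id) conv_antipodel comul_scal.
transitivity (conv (conv inl_ (conv inr_ (fun h => inr_ (S h)))) (fun h => inl_ (S h))).
  by rewrite -conv_inl_inr !convA //; lin.
rewrite [conv inr_ _](conv_inr id S) conv_antipoder inr_scal conv1r; [|lin].
by rewrite [conv inl_ _](conv_inl id S) conv_antipoder inl_scal.
Qed.

Lemma comul_antipode (h : H) :
  comul (S h) = sweedler2 h (fun a b => S b \ot S a).
Proof.
have := congr1 (fun f => f h) comul_antipode_conv; rewrite /= => ->.
by apply: eq_sweedler => a b; rewrite mul_tens mulr1 mul1r.
Qed.

Lemma sweedler_antipode (U : lmodType k) (F : H -> H -> U) (h : H) :
  bilinear_fun F ->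
  sweedler2 (S h) F = sweedler2 h (fun a b => F (S b) (S a)).
Proof.
move=> FB; rewrite {1}/sweedler2 comul_antipode [LHS]tlift_comp; last by lin.
by apply: eq_sweedler => a b; rewrite tlift_tens.
Qed.

End Antipode.

(** * Matrices of coefficients of comodules *)

Section Comatrix.
Context {k : fieldType} {H : hopfAlgType k} {n : nat}.
Local Notation S := (@antipode k H).

(** The entries of [M] are the coefficients of a right comodule structure
    [e_i |-> \sum_j e_j \ot M i j]. *)
Definition comatrix (M : 'M[H]_n) :=
  (forall i l, comul (M i l) = \sum_j M j l \ot M i j) /\
  (forall i l, counit (M i l) = (i == l)%:R).

Lemma sweedler_comatrix (U : lmodType k) (F : H -> H -> U) (M : 'M[H]_n) i l :
  comatrix M -> bilinear_fun F ->
  sweedler2 (M i l) F = \sum_j F (M j l) (M i j).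
Proof.
move=> [MD _] FB; rewrite /sweedler2 MD.
pose L : {linear (H \ot H)%type -> U} :=
  HB.pack (tlift F) (GRing.isLinear.Build _ _ _ _ _ (tlift_linear FB)).
rewrite -[LHS]/(L _) linear_sum; apply: eq_bigr => j _.
exact: tlift_tens.
Qed.

Variable M : 'M[H]_n.
Hypothesis MC : comatrix M.

(** The antipode axiom for [M i l]. The left factor of [comul (M i l)] has the
    column index [l]: it is the transposes of [M] and [S M] that are inverse to each
    other. *)
Lemma comatrix_antipoder i l : \sum_j M j l * S (M i j) = (i == l)%:R.
Proof.
have := antipoder (M i l); rewrite MC.2 -[tlift _ _]/(sweedler2 _ _).
by rewrite sweedler_comatrix //; [move=> ->; rewrite scaler_nat|lin].
Qed.

Lemma comatrix_antipodel i l : \sum_j S (M j l) * M i j = (i == l)%:R.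
Proof.
have := antipodel (M i l); rewrite MC.2 -[tlift _ _]/(sweedler2 _ _).
by rewrite sweedler_comatrix //; [move=> ->; rewrite scaler_nat|lin].
Qed.

(** The antipode axiom for the entries of [S M]; their comultiplication is
    reversed, so that here the matrices themselves are inverse. *)
Lemma antipode2_mulr : map_mx (S \o S) M *m map_mx S M = 1%:M.
Proof.
apply/matrixP => i l; rewrite !mxE.
have := antipodel (S (M i l)); rewrite -[tlift _ _]/(sweedler2 _ _).
rewrite counit_antipode MC.2 sweedler_antipode ?sweedler_comatrix //; try by lin.
by rewrite scaler_nat => <-; apply: eq_bigr => j _; rewrite !mxE.
Qed.

Lemma antipode2_mull : map_mx S M *m map_mx (S \o S) M = 1%:M.
Proof.
apply/matrixP => i l; rewrite !mxE.
have := antipoder (S (M i l)); rewrite -[tlift _ _]/(sweedler2 _ _).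
rewrite counit_antipode MC.2 sweedler_antipode ?sweedler_comatrix //; try by lin.
by rewrite scaler_nat => <-; apply: eq_bigr => j _; rewrite !mxE.
Qed.

Lemma comatrix_antipode2 : comatrix (map_mx (S \o S) M).
Proof.
split=> i l; rewrite !mxE; last by rewrite /= !counit_antipode MC.2.
rewrite /= comul_antipode sweedler_antipode; last by lin.
rewrite sweedler_comatrix //; last by lin.
by apply: eq_bigr => j _; rewrite !mxE.
Qed.

End Comatrix.

(** * The Yetter-Drinfeld structure of a tangent space *)

Section TangentMatrices.
Context {k : fieldType} {H : hopfAlgType k} {n : nat}.
Local Notation HH := (H \ot H)%type.
Local Notation S := (@antipode k H).
Variables (chi : 'I_n -> H -> k^o) (f : 'I_n -> 'I_n -> H -> k^o).
Variables (N : 'M[H]_n) (d : 'I_n -> H).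
Hypothesis chiL : forall i, linear (chi i).
Hypothesis fL : forall i j, linear (f i j).
Hypothesis chi1 : forall i, chi i 1 = 0.
Hypothesis chi_dual : forall i j, chi i (d j) = (i == j)%:R.
Hypothesis chiM : forall i a b,
  chi i (a * b) = (chi i a : k) * counit b + \sum_j (f i j a : k) * chi j b.

(** The left invariant vector field of [chi i], and the right invariant one. *)
Definition Dl i : H -> H := conv id (scal H (chi i)).
Definition Dr i : H -> H := conv (scal H (chi i)) id.

Hypothesis chi_ad : forall i,
  conv (Dl i) S = (fun h => \sum_j (chi j h : k) *: N i j).

Lemma sum_delta (V : lmodType k) (v : 'I_n -> V) i :
  \sum_j ((i == j)%:R : k) *: v j = v i.
Proof.
rewrite (bigD1 i) //= eqxx scale1r big1 ?addr0 // => j ji.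
by rewrite eq_sym (negbTE ji) scale0r.
Qed.

Lemma sum_deltak (v : 'I_n -> k) i : \sum_j (i == j)%:R * v j = v i.
Proof. exact: (@sum_delta k^o). Qed.

Lemma sum_chi_d (V : lmodType k) (v : 'I_n -> V) i :
  \sum_j (chi j (d i) : k) *: v j = v i.
Proof.
rewrite -[RHS]sum_delta; apply: eq_bigr => j _.
by rewrite chi_dual eq_sym.
Qed.

Lemma chi_free (V : lmodType k) (v w : 'I_n -> V) :
  (forall h, \sum_j (chi j h : k) *: v j = \sum_j (chi j h : k) *: w j) ->
  forall j, v j = w j.
Proof. by move=> vw j; rewrite -[LHS]sum_chi_d vw sum_chi_d. Qed.

(** Compares the two ways to evaluate [chi] at a triple product. *)
Lemma coeffM i l a b : f i l (a * b) = \sum_j (f i j a : k) * f j l b.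
Proof.
have := chiM i (a * b) (d l); rewrite -mulrA !chiM counitM.
have -> : \sum_j (f i j (a * b) : k) * chi j (d l) = f i l (a * b).
  by rewrite -[RHS](sum_chi_d (fun j => f i j (a * b)));
    apply: eq_bigr => j _; rewrite mulrC.
under eq_bigr do rewrite chiM mulrDr.
rewrite big_split /= mulrDl -!mulrA -addrA => /addrI.
rewrite mulr_suml; under eq_bigr do rewrite mulrA.
move=> /addrI <-; apply: eq_bigr => j _; congr (_ * _).
rewrite -[RHS](sum_chi_d (fun m => f j m b)).
by apply: eq_bigr => m _; rewrite mulrC.
Qed.

Lemma coeff1 i l : f i l 1 = (i == l)%:R.
Proof.
have := chiM i 1 (d l); rewrite mul1r chi1 mul0r add0r chi_dual => ->.
rewrite -[LHS](sum_chi_d (fun m => f i m 1)).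
by apply: eq_bigr => m _; rewrite mulrC.
Qed.

Lemma lin_Dl i : linear (Dl i). Proof. by rewrite /Dl; lin. Qed.
(** [h_1 chi(h_2)] is [h_1 chi(h_2) S(h_3) h_4]. *)
Lemma DlE i h : Dl i h = \sum_j N i j * Dr j h.
Proof.
have -> : Dl i = conv (conv (Dl i) S) id.
  rewrite -convA; [|exact: lin_Dl|lin..].
  by rewrite conv_antipodel conv1r //; exact: lin_Dl.
rewrite chi_ad conv_suml; apply: eq_bigr => j _.
by rewrite conv_constl; [|lin..].
Qed.

(** [chi(h_1) h_2 S(h_3)] is [chi(h)]. *)
Lemma conv_Dr_antipode (u : 'I_n -> H) :
  conv (fun h => \sum_j u j * Dr j h) S = (fun h => \sum_j (chi j h : k) *: u j).
Proof.
rewrite conv_suml; apply/funext => h; apply: eq_bigr => j _.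
rewrite conv_mull /Dr -convA; [|lin..].
by rewrite conv_antipoder conv1r /scal -?scalerAr ?mulr1 //; lin.
Qed.

Lemma Dr_free (v w : 'I_n -> H) :
  (forall h, \sum_j v j * Dr j h = \sum_j w j * Dr j h) -> forall j, v j = w j.
Proof.
move=> vw; apply: chi_free => h.
rewrite -[LHS](congr1 (fun F => F h) (conv_Dr_antipode v)).
rewrite -[RHS](congr1 (fun F => F h) (conv_Dr_antipode w)).
by congr (conv _ _ h); apply/funext.
Qed.

Lemma counit_conv (g1 g2 : H -> H) h : linear g1 -> linear g2 ->
  counit (conv g1 g2 h)
    = sweedler2 h (fun a b => (counit (g1 a) : k) * counit (g2 b) : k^o).
Proof.
move=> L1 L2; rewrite (sweedler_comp (L := @counit k H)); last exact: linearP.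
by apply: eq_sweedler => a b; rewrite counitM.
Qed.

Lemma counitN i l : counit (N i l) = (i == l)%:R.
Proof.
have := congr1 (fun F => counit (F (d l))) (chi_ad i).
rewrite sum_chi_d => <-; rewrite counit_conv; [|exact: lin_Dl|lin].
have -> : (fun a b => (counit (Dl i a) : k) * counit (S b) : k^o)
    = (fun a b => (counit b : k) *: (chi i a : k^o)).
  apply/funext => a; apply/funext => b; rewrite counit_antipode mulrC.
  congr (_ * _); rewrite counit_conv; [|lin..].
  rewrite -[RHS](sweedler_counitl a (chiL i)); apply: eq_sweedler => x y.
  by rewrite /scal linearZ /= counit1 [_ *: 1]mulr1.
by rewrite sweedler_counitr // chi_dual.
Qed.

(** The comultiplication of [ad chi h = h_1 S(h_3) chi(h_2)] is
    [h_1 S(h_3) \ot ad chi h_2]; expand this in the basis twice. *)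
Lemma comulN i l : comul (N i l) = \sum_j N j l \ot N i j.
Proof.
move: l; apply: chi_free => h.
have -> : \sum_j (chi j h : k) *: comul (N i j) = comul (conv (Dl i) S h).
  by rewrite chi_ad linear_sum; apply: eq_bigr => j _; rewrite linearZ.
transitivity (conv (conv inl_ (fun h => inr_ (conv (Dl i) S h))) (fun h => inl_ (S h)) h).
  rewrite -[LHS]/((fun h => comul (conv (Dl i) S h)) h) -conv_comul comul_antipode_conv.
  rewrite /Dl -(conv_comul id) comul_scal -(conv_inr (conv _ _)) -(conv_inr id).
  rewrite inr_scal -[fun h => comul (id h)]/(@comul k H : H -> HH) -conv_inl_inr.
  by rewrite !convA; [|lin..].
rewrite chi_ad.
have -> : (fun h => inr_ (\sum_j (chi j h : k) *: N i j))
    = (fun h => \sum_j scal HH (chi j) h * inr_ (N i j)).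
  apply/funext => x; rewrite /inr_ tens_sumr; apply: eq_bigr => j _.
  by rewrite /scal -scalerAl mul1r tensZr.
rewrite conv_sumr conv_suml; under eq_bigr do rewrite conv_mulr.
have comm j : conv (fun h => conv inl_ (scal HH (chi j)) h * inr_ (N i j))
      (fun h => inl_ (S h))
    = (fun h => (fun h' => inl_ (conv (Dl j) S h')) h * inr_ (N i j)).
  have E : conv (conv inl_ (scal HH (chi j))) (fun h => inl_ (S h))
      = (fun h => inl_ (conv (Dl j) S h)).
    by rewrite -(conv_inl (Dl j) S) -(conv_inl id) inl_scal.
  apply/funext => x; rewrite -[inl_ _](congr1 (fun F => F x) E) /conv.
  rewrite [RHS](sweedler_comp (L := fun y => y * inr_ (N i j))); last by lin.
  by apply: eq_sweedler => a b; rewrite -!mulrA !mul_tens !mulr1 !mul1r.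
under eq_bigr do rewrite comm chi_ad /inl_ tens_suml mulr_suml.
rewrite exchange_big /=; apply: eq_bigr => l _.
rewrite scaler_sumr; apply: eq_bigr => j _.
by rewrite tensZl -scalerAl mul_tens mulr1 mul1r.
Qed.

Lemma comatrixN : comatrix N.
Proof. by split=> i l; [exact: comulN | exact: counitN]. Qed.

(** The coefficients of the right action in the frames [Dl] and [Dr], by [DlM] and
    [DrM]. *)
Definition El i j : H -> H := conv id (scal H (f i j)).
Definition Er i j : H -> H := conv (scal H (f i j)) id.

Lemma lin_El i j : linear (El i j). Proof. by rewrite /El; lin. Qed.
Lemma lin_Er i j : linear (Er i j). Proof. by rewrite /Er; lin. Qed.

Lemma mulr_scal (u : H -> k^o) x y : x * scal H u y = (u y : k) *: x.
Proof. by rewrite /scal -scalerAr mulr1. Qed.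

Lemma scal_mulr (u : H -> k^o) x y : scal H u y * x = (u y : k) *: x.
Proof. by rewrite /scal -scalerAl mul1r. Qed.

Lemma DlM i a b : Dl i (a * b) = Dl i a * b + \sum_j El i j a * Dl j b.
Proof.
transitivity (sweedler2 a (fun a1 a2 => sweedler2 b (fun b1 b2 =>
    (chi i a2 : k) *: (a1 * ((counit b2 : k) *: b1)) +
    \sum_j a1 * (scal H (f i j) a2) * (b1 * scal H (chi j) b2)))).
  rewrite [LHS]sweedler_mul; last by rewrite /scal; lin.
  apply: eq_sweedler => a1 a2; apply: eq_sweedler => b1 b2.
  rewrite mulr_scal chiM scalerDl -scalerAr scalerA scaler_suml.
  congr (_ + _); apply: eq_bigr => j _.
  by rewrite !mulr_scal -scalerAl -scalerAr scalerA.
rewrite (_ : (fun a1 a2 => _) = (fun a1 a2 => (chi i a2 : k) *: (a1 * b)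
    + \sum_j (a1 * scal H (f i j) a2) * Dl j b)); last first.
  apply/funext => a1; apply/funext => a2.
  rewrite /sweedler2 /tlift big_split /=; congr (_ + _).
    rewrite -[LHS]/(sweedler2 b (fun b1 b2 => (chi i a2 : k) *: (a1 * ((counit b2 : k) *: b1)))).
    rewrite -(sweedler_comp (L := fun x => (chi i a2 : k) *: (a1 * x))); last by lin.
    by rewrite (sweedler_counitr (L := id)).
  rewrite exchange_big; apply: eq_bigr => j _ /=.
  by rewrite -mulr_sumr.
rewrite /sweedler2 /tlift big_split /=; congr (_ + _).
  rewrite /Dl /conv /sweedler2 /tlift mulr_suml; apply: eq_bigr => p _.
  by rewrite mulr_scal scalerAl.
rewrite exchange_big; apply: eq_bigr => j _ /=.
by rewrite -mulr_suml.
Qed.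

Lemma DrM i a b : Dr i (a * b) = Dr i a * b + \sum_j Er i j a * Dr j b.
Proof.
transitivity (sweedler2 a (fun a1 a2 => sweedler2 b (fun b1 b2 =>
    (chi i a1 : k) *: (a2 * ((counit b1 : k) *: b2)) +
    \sum_j scal H (f i j) a1 * a2 * (scal H (chi j) b1 * b2)))).
  rewrite [LHS]sweedler_mul; last by rewrite /scal; lin.
  apply: eq_sweedler => a1 a2; apply: eq_sweedler => b1 b2.
  rewrite scal_mulr chiM scalerDl -scalerAr scalerA scaler_suml.
  congr (_ + _); apply: eq_bigr => j _.
  by rewrite !scal_mulr -scalerAl -scalerAr scalerA.
rewrite (_ : (fun a1 a2 => _) = (fun a1 a2 => (chi i a1 : k) *: (a2 * b)
    + \sum_j (scal H (f i j) a1 * a2) * Dr j b)); last first.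
  apply/funext => a1; apply/funext => a2.
  rewrite /sweedler2 /tlift big_split /=; congr (_ + _).
    rewrite -[LHS]/(sweedler2 b (fun b1 b2 => (chi i a1 : k) *: (a2 * ((counit b1 : k) *: b2)))).
    rewrite -(sweedler_comp (L := fun x => (chi i a1 : k) *: (a2 * x))); last by lin.
    by rewrite (sweedler_counitl (L := id)).
  rewrite exchange_big; apply: eq_bigr => j _ /=.
  by rewrite -mulr_sumr.
rewrite /sweedler2 /tlift big_split /=; congr (_ + _).
  rewrite /Dr /conv /sweedler2 /tlift mulr_suml; apply: eq_bigr => p _.
  by rewrite scal_mulr scalerAl.
rewrite exchange_big; apply: eq_bigr => j _ /=.
by rewrite -mulr_suml.
Qed.

(** Both sides are the coefficients of [Dl i (b * c) - Dl i b * c] in the frame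
    [Dr]. *)
Lemma yetter_drinfeld i j b : \sum_l El i l b * N l j = \sum_l N i l * Er l j b.
Proof.
move: j; apply: Dr_free => c.
transitivity (Dl i (b * c) - Dl i b * c).
  rewrite DlM addrC addKr.
  under eq_bigr do rewrite mulr_suml.
  rewrite exchange_big; apply: eq_bigr => l _ /=.
  by rewrite DlE mulr_sumr; apply: eq_bigr => j _; rewrite mulrA.
rewrite !DlE mulr_suml -sumrB.
under eq_bigr do rewrite DrM mulrDr mulrA addrC addKr.
under [RHS]eq_bigr do rewrite mulr_suml.
rewrite exchange_big /=; apply: eq_bigr => l _.
by rewrite mulr_sumr; apply: eq_bigr => j _; rewrite mulrA.
Qed.

(** The compatibility of a Yetter-Drinfeld module, with the factor [h_1] of
    [yetter_drinfeld] moved to the other side. *)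
Lemma yetter_drinfeld_antipode i j h :
  \sum_l (f i l h : k) *: N l j
    = sweedler2 h (fun a b => S a * \sum_l N i l * Er l j b).
Proof.
transitivity (conv S (fun b => \sum_l El i l b * N l j) h).
  rewrite conv_sumr; apply: eq_bigr => l _; rewrite conv_mulr /El convA; [|lin..].
  by rewrite conv_antipodel conv1l ?/scal -?scalerAl ?mul1r //; lin.
by apply: eq_sweedler => a b; rewrite yetter_drinfeld.
Qed.

(** The Drinfeld element [v |-> v_0 S(v_1)] of the Yetter-Drinfeld module with
    action [f] and coaction [N]. *)
Definition drinfeld : 'M[k]_n := \matrix_(i, l) \sum_j (f j l (S (N i j)) : k).

(** The Drinfeld element is colinear up to [S^2]: take [h = S (N i j)] in
    [yetter_drinfeld_antipode], and cancel [S (N q j)] against [N j l]. *)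
Lemma drinfeldN i m :
  \sum_l drinfeld i l *: N l m = \sum_q drinfeld q m *: S (S (N i q)).
Proof.
have ErS l m' p j :
    Er l m' (S (N p j)) = \sum_q (f l m' (S (N p q)) : k) *: S (N q j).
  rewrite /Er /conv sweedler_antipode; last by lin.
  rewrite sweedler_comatrix; [|exact: comatrixN|lin].
  by apply: eq_bigr => q _; rewrite scal_mulr.
transitivity (\sum_j \sum_l (f j l (S (N i j)) : k) *: N l m).
  under eq_bigr do rewrite mxE scaler_suml.
  exact: exchange_big.
transitivity (\sum_j \sum_p \sum_l \sum_q
    (f l m (S (N p q)) : k) *: (S (S (N i p)) * (N j l * S (N q j)))).
  apply: eq_bigr => j _; rewrite yetter_drinfeld_antipode sweedler_antipode; last first.
    by have := lin_Er; lin.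
  rewrite sweedler_comatrix; [|exact: comatrixN|by have := lin_Er; lin].
  apply: eq_bigr => p _; rewrite mulr_sumr; apply: eq_bigr => l _.
  rewrite ErS !mulr_sumr; apply: eq_bigr => q _.
  by rewrite -!scalerAr.
rewrite exchange_big /= [RHS](_ : _ = \sum_q \sum_p (f p m (S (N q p)) : k) *: S (S (N i q))).
  apply: eq_bigr => p _.
  rewrite exchange_big /=; apply: eq_bigr => l _.
  rewrite exchange_big /=; under eq_bigr => q _.
    rewrite -scaler_sumr -mulr_sumr (comatrix_antipoder comatrixN) scalerAr.
    over.
  rewrite -[LHS]mulr_sumr.
  rewrite (eq_bigr (fun q => ((l == q)%:R : k) *: ((f l m (S (N p q)) : k) *: (1 : H)))).
    by rewrite sum_delta -scalerAr mulr1.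
  by move=> q _; rewrite eq_sym -scaler_nat !scalerA mulrC.
by apply: eq_bigr => q _; rewrite mxE scaler_suml.
Qed.

(** [v_0 S(v_1) v_2 = v]: the element [v] is the sum of [u(v_0) v_1]. *)
Lemma drinfeld_unit i m :
  \sum_j \sum_l drinfeld j l * (f l m (N i j) : k) = (i == m)%:R.
Proof.
transitivity (\sum_p (f p m (\sum_j S (N j p) * N i j) : k)).
  under [RHS]eq_bigr => p _.
    rewrite [f p m _](_ : _ = \sum_j \sum_l (f p l (S (N j p)) : k) * f l m (N i j)).
      over.
    pose fl : {linear H -> k^o} :=
      HB.pack (f p m) (GRing.isLinear.Build _ _ _ _ _ (fL p m)).
    rewrite -[f p m _]/(fl _) linear_sum; apply: eq_bigr => j _.
    exact: coeffM.
  rewrite [RHS]exchange_big /=; apply: eq_bigr => j _.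
  rewrite [RHS]exchange_big /=; apply: eq_bigr => l _.
  by rewrite mxE mulr_suml.
under eq_bigr do rewrite (comatrix_antipodel comatrixN).
rewrite (eq_bigr (fun p => (i == p)%:R * (p == m)%:R)) ?sum_deltak // => p _.
by rewrite -scaler_nat linZ // coeff1.
Qed.

(** The Drinfeld element is linear up to [S^2]: apply the Yetter-Drinfeld condition
    to [v h], and cancel [h_2] against [S(h_3)]. *)
Lemma coeff_drinfeld i m h :
  \sum_l (f i l h : k) * drinfeld l m = \sum_l drinfeld i l * (f l m (S (S h)) : k).
Proof.
pose fl j : {linear H -> k^o} :=
  HB.pack (f j m) (GRing.isLinear.Build _ _ _ _ _ (fL j m)).
transitivity (\sum_j (f j m (S (\sum_l (f i l h : k) *: N l j)) : k)).
  under [RHS]eq_bigr => j _.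
    rewrite linear_sum -[f j m _]/(fl j _) linear_sum.
    under eq_bigr do rewrite linearZ /= linZ //.
    over.
  rewrite [RHS]exchange_big /=; apply: eq_bigr => l _.
  by rewrite mxE mulr_sumr.
transitivity (\sum_j sweedler2 h (fun a b => \sum_l sweedler2 b (fun b1 b2 =>
    (f l j b1 : k) * (f j m (S b2 * (S (N i l) * S (S a))) : k) : k^o))).
  apply: eq_bigr => j _; rewrite yetter_drinfeld_antipode.
  rewrite (sweedler_comp (L := fun x => f j m (S x))); last by lin.
  apply: (@eq_sweedler _ H k^o) => a b; rewrite mulr_sumr linear_sum -[f j m _]/(fl j _) linear_sum.
  apply: eq_bigr => l _; rewrite /Er /conv.
  rewrite -[LHS]/((fun x => f j m (S (S a * (N i l * x)))) _).
  rewrite sweedler_comp; last by lin.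
  apply: eq_sweedler => b1 b2; rewrite scal_mulr -!scalerAr linearZ /= linZ //.
  by rewrite !antipodeM mulrA.
transitivity (sweedler2 h (fun a b => (counit b : k) *:
    ((\sum_l f l m (S (N i l) * S (S a))) : k^o))).
  rewrite /sweedler2 /tlift exchange_big /=; apply: eq_bigr => p _.
  rewrite exchange_big /= scaler_sumr; apply: eq_bigr => l _.
  set a := p.1; set b := p.2; set c := _ * S (S a).
  transitivity (sweedler2 b (fun b1 b2 => f l m (b1 * S b2 * c))).
    rewrite exchange_big /=; apply: eq_bigr => q _.
    by rewrite -mulrA coeffM.
  rewrite -[LHS](sweedler_comp (L := fun x => f l m (x * c))); last by lin.
  by rewrite [sweedler2 b _]antipoder -scalerAl mul1r linZ.
rewrite sweedler_counitr; last by lin.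
rewrite (eq_bigr (fun l => \sum_r (f l r (S (N i l)) : k) * f r m (S (S h)))); last first.
  by move=> l _; exact: coeffM.
rewrite exchange_big /=; apply: eq_bigr => r _.
by rewrite mxE mulr_suml.
Qed.

End TangentMatrices.

(** * Invertibility of the Drinfeld element *)

Section ScalarMatrices.
Context {k : fieldType} {H : hopfAlgType k}.
Local Notation S := (@antipode k H).

Definition smx n (U : 'M[k]_n) : 'M[H]_n := map_mx (in_alg H) U.

Lemma smxM n (U V : 'M[k]_n) : smx (U *m V) = smx U *m smx V.
Proof. exact: map_mxM. Qed.

Lemma smx1 n : smx (1%:M : 'M[k]_n) = 1%:M.
Proof. exact: map_mx1. Qed.

Lemma smx_mull n (U : 'M[k]_n) (X : 'M[H]_n) i j :
  (smx U *m X) i j = \sum_l U i l *: X l j.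
Proof. by rewrite mxE; apply: eq_bigr => l _; rewrite mxE -scalerAl mul1r. Qed.

Lemma smx_mulr n (U : 'M[k]_n) (X : 'M[H]_n) i j :
  (X *m smx U) i j = \sum_l U l j *: X i l.
Proof. by rewrite mxE; apply: eq_bigr => l _; rewrite mxE -scalerAr mulr1. Qed.

Lemma map_smx_mull n (L : {linear H -> H}) (U : 'M[k]_n) (X : 'M[H]_n) :
  map_mx L (smx U *m X) = smx U *m map_mx L X.
Proof.
apply/matrixP => i j; rewrite mxE !smx_mull linear_sum.
by apply: eq_bigr => l _; rewrite linearZ mxE.
Qed.

Lemma map_smx_mulr n (L : {linear H -> H}) (U : 'M[k]_n) (X : 'M[H]_n) :
  map_mx L (X *m smx U) = map_mx L X *m smx U.
Proof.
apply/matrixP => i j; rewrite mxE !smx_mulr linear_sum.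
by apply: eq_bigr => l _; rewrite linearZ mxE.
Qed.

Definition scomm n (e : 'M[k]_n) (X : 'M[H]_n) := smx e *m X = X *m smx e.

Lemma scomm_inv n (e : 'M[k]_n) (X Y : 'M[H]_n) :
  X *m Y = 1%:M -> Y *m X = 1%:M -> scomm e X -> scomm e Y.
Proof.
rewrite /scomm => XY YX eX.
rewrite -[LHS]mul1mx -YX -mulmxA [X *m _]mulmxA -eX -!mulmxA.
by rewrite XY mulmx1.
Qed.

Lemma scomm_tr n (e : 'M[k]_n) (X : 'M[H]_n) : scomm e X -> scomm e^T X^T.
Proof.
move=> /matrixP eX; apply/matrixP => i j; rewrite smx_mull smx_mulr.
have := eX j i; rewrite smx_mull smx_mulr => E.
by under eq_bigr do rewrite !mxE; rewrite -E; apply: eq_bigr => l _; rewrite !mxE.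
Qed.

(** Passing from [S^2 M] to [S M] and then to [M]: each is the inverse of the
    previous one, the second time for the product of transposed matrices. *)
Lemma scomm_antipode2 n (e : 'M[k]_n) (M : 'M[H]_n) :
  comatrix M -> scomm e (map_mx (S \o S) M) -> scomm e M.
Proof.
move=> MC /(scomm_inv (antipode2_mulr MC) (antipode2_mull MC)) /scomm_tr.
have inv1 : (map_mx S M)^T *m M^T = 1%:M.
  apply/matrixP => l i; rewrite !mxE eq_sym -(comatrix_antipodel MC).
  by apply: eq_bigr => j _; rewrite !mxE.
have inv2 : M^T *m (map_mx S M)^T = 1%:M.
  apply/matrixP => l i; rewrite !mxE eq_sym -(comatrix_antipoder MC).
  by apply: eq_bigr => j _; rewrite !mxE.
by move=> /(scomm_inv inv1 inv2)/scomm_tr; rewrite !trmxK.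
Qed.

End ScalarMatrices.

Section Fitting.
Context {k : fieldType} {n : nat}.

(** The Fitting decomposition: [1 - e] projects to the nilpotent part of [U]. *)
Lemma fitting (U : 'M[k]_n.+1) :
  exists m e A, [/\ e = A * U ^+ m.+1, e = U ^+ m.+1 * A & U ^+ m.+1 * (1 - e) = 0].
Proof.
(* [char_poly U = 'X^m * q] with [q] prime to ['X]. The exponent [m.+1] makes [U]
   a factor of [e], also for [m = 0]. *)
have p0 : char_poly U != 0 by rewrite monic_neq0 ?char_poly_monic.
have [m [q /implyP q0 pE]] := multiplicity_XsubC (char_poly U) 0.
have {q0} q0 : ~~ root q 0 by apply: q0.
have cop : coprimep ('X^(m.+1)) q.
  by rewrite coprimep_expl // coprimep_sym -['X]subr0 -polyC0 coprimep_XsubC.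
have [[u v] /= uv] := Bezout_eq1_coprimepP _ _ cop.
exists m, (horner_mx U (u * 'X^(m.+1))), (horner_mx U u).
have XE : horner_mx U 'X^(m.+1) = U ^+ m.+1 by rewrite rmorphXn /= horner_mx_X.
split; first by rewrite rmorphM /= XE.
  by rewrite mulrC rmorphM /= XE.
rewrite -XE -(rmorph1 (horner_mx U)) -rmorphB -rmorphM /= -uv addrC addKr.
have -> : 'X^(m.+1) * (v * q) = ('X * v) * char_poly U.
  by rewrite pE polyC0 subr0 exprS mulrACA ['X^m * q]mulrC.
by rewrite rmorphM /= Cayley_Hamilton mulr0.
Qed.

End Fitting.

Section RightInverse.
Context {k : fieldType} {H : hopfAlgType k} {n : nat}.
Local Notation S := (@antipode k H).
Variables (N : 'M[H]_n.+1) (U : 'M[k]_n.+1).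
Variable f : 'I_n.+1 -> 'I_n.+1 -> H -> k^o.
Hypothesis NC : comatrix N.
Hypothesis fL : forall i j, linear (f i j).
Hypothesis UN : forall i m, \sum_l U i l *: N l m = \sum_q U q m *: S (S (N i q)).
Hypothesis Uf : forall i m, \sum_j \sum_l U j l * (f l m (N i j) : k) = (i == m)%:R.
Hypothesis fU : forall i m h,
  \sum_l (f i l h : k) * U l m = \sum_l U i l * (f l m (S (S h)) : k).

Let S2 : {linear H -> H} := S \o S.
Let T m := iter m (map_mx S2) N.
Let F h : 'M[k]_n.+1 := \matrix_(i, j) (f i j h : k).

Let TC m : comatrix (T m).
Proof. by elim: m => [//|m IHm]; exact: comatrix_antipode2. Qed.

Let UT m : smx U *m T m = T m.+1 *m smx U.
Proof.
elim: m => [|m IHm].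
  apply/matrixP => i j; rewrite smx_mull smx_mulr UN.
  by apply: eq_bigr => q _; rewrite !mxE.
by rewrite [T m.+1]/= -map_smx_mull -/(T m) IHm map_smx_mulr.
Qed.

Let UXT m : smx (U ^+ m) *m N = T m *m smx (U ^+ m).
Proof.
elim: m => [|m IHm]; first by rewrite expr0 smx1 mul1mx mulmx1.
by rewrite exprS smxM -mulmxA IHm !mulmxA UT.
Qed.

Let FU m h : F h * U ^+ m = U ^+ m * F (iter m S2 h).
Proof.
elim: m h => [|m IHm] h; first by rewrite mulr1 mul1r.
rewrite iterSr exprS mulrA [F h * U](_ : _ = U * F (S2 h)); last first.
  apply/matrixP => i j; rewrite !mxE; under eq_bigr do rewrite mxE.
  by rewrite fU; apply: eq_bigr => l _; rewrite mxE.
by rewrite -mulrA IHm mulrA.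
Qed.

(** [U^m] intertwines [N] with [S^(2m) N]: the image of [e] is stable under [N], the
    kernel of [e] under [S^(2m) N]. The former passes to [S^(2m) N], as [S] acts
    entrywise; so [S^(2m) N] commutes with [e], and [scomm_antipode2] descends to
    [N]. *)
Lemma scomm_fitting e A m :
  e = A * U ^+ m -> e = U ^+ m * A -> U ^+ m * (1 - e) = 0 -> scomm e N.
Proof.
move=> eA Ae Ue.
have s0 : smx (0 : 'M[k]_n.+1) = 0 :> 'M[H]_n.+1 by exact: map_mx0.
have seA : smx e = smx A *m smx (U ^+ m) :> 'M[H]_n.+1 by rewrite eA smxM.
have sAe : smx e = smx (U ^+ m) *m smx A :> 'M[H]_n.+1 by rewrite Ae smxM.
have sU1 : smx (U ^+ m) *m smx (1 - e) = 0 :> 'M[H]_n.+1.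
  by rewrite -smxM -[_ *m _]/(_ * _) Ue s0.
have s1U : smx (1 - e) *m smx (U ^+ m) = 0 :> 'M[H]_n.+1.
  rewrite -smxM -[_ *m _]/(_ * _) mulrBl mul1r Ae -mulrA -eA.
  by rewrite -[X in X - _]mulr1 -mulrBr Ue s0.
have stab0 : smx e *m N *m smx (1 - e) = 0.
  by rewrite seA -[_ *m _ *m N]mulmxA UXT -!mulmxA sU1 !mulmx0.
have stab : smx e *m T m *m smx (1 - e) = 0.
  elim: (m) => [//|p IHp] /=.
  by rewrite -map_smx_mull -map_smx_mulr IHp map_mx0.
have costab : smx (1 - e) *m T m *m smx e = 0.
  by rewrite sAe !mulmxA -[_ *m smx (U ^+ m)]mulmxA -UXT !mulmxA s1U !mul0mx.
have sE : smx (1 - e) = 1%:M - smx e :> 'M[H]_n.+1.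
  by rewrite /smx map_mxB map_mx1.
have : scomm e (T m).
  rewrite /scomm; move: stab costab; rewrite sE mulmxBr mulmx1 !mulmxBl mul1mx.
  move=> /subr0_eq st /subr0_eq cost; exact: etrans st (esym cost).
by elim: (m) => [//|p IHp] /(scomm_antipode2 (TC p)).
Qed.

(** By [Uf] and [fU], [u^m(v)] is the sum of [u^(m+1)(v_0) S^(2m)(v_1)]; here [v_0]
    stays in the range of [Q], which is stable under the coaction. *)
Lemma drinfeld_nilp Q m : scomm Q N -> Q * U ^+ m = 0 -> Q = 0.
Proof.
move=> QN; elim: m => [|m IHm]; first by rewrite mulr1.
move=> QU; apply: IHm; apply/matrixP => p q; rewrite [RHS]mxE.
pose G r h : k^o := F (iter m S2 h) r q.
have S2L j : linear (iter j S2 : H -> H).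
  by elim: j => [a x y|j IHj]; [|exact: lin_app (linearP S2) IHj].
have GL r : linear (G r).
  move=> a x y; rewrite /G !mxE (S2L m) fL //.
have NG r i : \sum_l Q p l *: G r (N l i) = \sum_l Q l i *: G r (N p l).
  have sumG (c : 'I_n.+1 -> k) (v : 'I_n.+1 -> H) :
      G r (\sum_l c l *: v l) = \sum_l c l *: G r (v l).
    pose g : {linear H -> k^o} := HB.pack (G r) (GRing.isLinear.Build _ _ _ _ _ (GL r)).
    by rewrite -[LHS]/(g _) linear_sum; apply: eq_bigr => l _; rewrite linearZ.
  have /matrixP/(_ p i) := QN; rewrite smx_mull smx_mulr => QNE.
  by rewrite -!sumG QNE.
have E i : (U ^+ m) i q = \sum_j \sum_r (U ^+ m.+1) j r * G r (N i j).
  transitivity (\sum_j (U * F (N i j) * U ^+ m) j q).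
    rewrite -[U ^+ m in LHS]mul1r; under [RHS]eq_bigr do rewrite mxE.
    rewrite mxE exchange_big /=; apply: eq_bigr => l _; rewrite -mulr_suml.
    congr (_ * _); rewrite mxE -Uf; apply: eq_bigr => j _.
    by rewrite mxE; apply: eq_bigr => r _; rewrite !mxE.
  apply: eq_bigr => j _; rewrite -mulrA FU mulrA -exprS mxE.
  by apply: eq_bigr.
rewrite mxE; under eq_bigr do rewrite E mulr_sumr.
rewrite exchange_big /=.
under eq_bigr => j _.
  under eq_bigr do rewrite mulr_sumr.
  rewrite exchange_big /=.
  under eq_bigr => r _.
    under eq_bigr do rewrite mulrCA.
    rewrite -mulr_sumr (NG r j) mulr_sumr.
    over.
  over.
rewrite /= (eq_bigr (fun j => \sum_l \sum_r Q l j * (U ^+ m.+1) j r * G r (N p l))); last first.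
  move=> j _; rewrite exchange_big /=; apply: eq_bigr => l _; apply: eq_bigr => r _.
  by rewrite mulrCA mulrA.
rewrite exchange_big /= big1 // => l _.
rewrite exchange_big /= big1 // => r _.
rewrite -mulr_suml; have /matrixP/(_ l r) := QU; rewrite !mxE => ->.
by rewrite mul0r.
Qed.

Lemma drinfeld_unitmx : U \in unitmx.
Proof.
have [m [e [A [eA Ae Ue]]]] := fitting U.
have eN : scomm e N by exact: (scomm_fitting eA Ae Ue).
have Qe : (1 - e) * U ^+ m.+1 = 0.
  by rewrite mulrBl mul1r Ae -mulrA -eA -[X in X - _]mulr1 -mulrBr.
have QN : scomm (1 - e) N.
  rewrite /scomm /smx map_mxB map_mx1 mulmxBl mulmxBr mul1mx mulmx1.
  by congr (_ - _); exact: eN.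
have /eqP := drinfeld_nilp QN Qe; rewrite subr_eq0 => /eqP e1.
suff /mulmx1_unit[] : (A * U ^+ m) *m U = 1%:M by [].
by rewrite -[_ *m _]/(_ * _) -mulrA -exprSr -eA -e1.
Qed.

(** [U] conjugates [N] to [S^2 N], which has the right inverse [S N]. *)
Lemma comatrix_right_inverse : exists M, N *m M = 1%:M.
Proof.
have UV := mulmxV drinfeld_unitmx; have VU := mulVmx drinfeld_unitmx.
exists (smx (invmx U) *m map_mx S N *m smx U).
have NE : N = smx (invmx U) *m map_mx (S \o S) N *m smx U.
  by rewrite -mulmxA -(UT 0) mulmxA -smxM VU smx1 mul1mx.
rewrite {1}NE !mulmxA -[_ *m smx U *m smx (invmx U)]mulmxA -smxM UV smx1 mulmx1.
by rewrite -[_ *m map_mx S N]mulmxA antipode2_mulr // mulmx1 -smxM VU smx1.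
Qed.

End RightInverse.

(** * Bases and dual families *)

Section Bases.
Context {k : fieldType}.

Lemma basis_coord (V : lmodType k) n (e : 'I_n -> V) : is_basis e ->
  exists c : 'I_n -> V -> k^o,
    [/\ forall i, linear (c i), forall v, v = \sum_i (c i v : k) *: e i &
        forall i j, c i (e j) = (i == j)%:R].
Proof.
move=> eB; pose C v := sval (cid (eB v)).
have CE v : v = \sum_i C v i *: e i.
  by rewrite /C; case: (cid (eB v)) => ? [].
have Cuniq v (b : 'I_n -> k) : v = \sum_i b i *: e i -> forall i, C v i = b i.
  move=> vE i; rewrite /C; case: (cid (eB v)) => c /= [_ /(_ [ffun i => b i])].
  by move=> ->; [rewrite ffunE|rewrite {1}vE; apply: eq_bigr => j _; rewrite ffunE].
exists (fun i v => C v i); split=> // [i a v w|i j].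
  apply: (Cuniq _ (fun i => a * C v i + C w i)).
  rewrite {1}[v]CE {1}[w]CE scaler_sumr -big_split /=.
  by apply: eq_bigr => l _; rewrite scalerDl scalerA.
apply: (Cuniq _ (fun i => (i == j)%:R)).
by rewrite (bigD1 j) //= eqxx scale1r big1 ?addr0 // => l /negbTE->; rewrite scale0r.
Qed.

Definition free_family (V : lmodType k) n (e : 'I_n -> V) :=
  forall c : 'I_n -> k, \sum_i c i *: e i = 0 -> forall i, c i = 0.

Lemma is_basis_free (V : lmodType k) n (e : 'I_n -> V) : is_basis e -> free_family e.
Proof.
move=> /basis_coord[c [cL _ ce]] b bE i.
have := congr1 (c i) bE; rewrite (linSZ _ _ _ (cL i)) (lin0 (cL i)) (bigD1 i) //= ce eqxx.
rewrite [_ *: _]mulr1 big1 ?addr0 // => l li.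
by rewrite ce eq_sym (negbTE li) scaler0.
Qed.

(** Induction: a vector, corrected by the family dual to the other functionals,
    lies in their kernels. *)
Lemma dual_vectors (V : lmodType k) n (u : 'I_n -> V -> k^o) :
  (forall i, linear (u i)) ->
  (forall c : 'I_n -> k, (forall v, \sum_i c i * (u i v : k) = 0) -> forall i, c i = 0) ->
  exists d : 'I_n -> V, forall i j, u i (d j) = (i == j)%:R.
Proof.
elim: n u => [|n IHn] u uL u_free; first by exists (fun=> 0); case.
have [|d dP] := IHn (fun i => u (lift ord0 i)) (fun i => uL _).
  move=> c cP i.
  have /(_ _ (lift ord0 i)) := u_free (fun j => oapp c 0 (unlift ord0 j)).
  rewrite liftK /=; apply=> v; rewrite big_ord_recl unlift_none /= mul0r add0r.
  by rewrite -[RHS](cP v); apply: eq_bigr => j _; rewrite liftK.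
pose p v := v - \sum_i (u (lift ord0 i) v : k) *: d i.
have up i v : u (lift ord0 i) (p v) = 0.
  rewrite linB // linSZ // (bigD1 i) //= dP eqxx.
  rewrite [_ *: _]mulr1 big1 ?addr0 ?subrr // => j ji.
  by rewrite dP eq_sym (negbTE ji) scaler0.
have [v v0] : exists v, u ord0 (p v) != 0.
  apply: contrapT => /forallNP u0; have := oner_neq0 k; apply/negP/negPn/eqP.
  have /(_ _ ord0) := u_free (fun j => oapp (fun i => - u ord0 (d i)) 1 (unlift ord0 j)).
  rewrite unlift_none /=; apply=> v; rewrite big_ord_recl unlift_none /= mul1r.
  have /negP/negPn/eqP := u0 v; rewrite linB // linSZ // => E.
  rewrite -[RHS]E; congr (_ + _).
  rewrite -sumrN; apply: eq_bigr => i _; rewrite liftK /= mulNr mulrC; congr (- _).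
pose d0 := (u ord0 (p v) : k)^-1 *: p v.
have u0d : u ord0 d0 = 1 by rewrite linZ // [_ *: _]mulVf.
have uid i : u (lift ord0 i) d0 = 0 by rewrite linZ // up scaler0.
exists (fun j => oapp (fun i => d i - (u ord0 (d i) : k) *: d0) d0 (unlift ord0 j)).
move=> i j; case: (unliftP ord0 j) => [j'|] ->; case: (unliftP ord0 i) => [i'|] -> /=.
- by rewrite linB // linZ // uid scaler0 subr0 dP (inj_eq lift_inj).
- by rewrite linB // linZ // u0d [_ *: _]mulr1 subrr.
- by rewrite uid.
- by rewrite u0d.
Qed.

End Bases.

(** * Freeness of the invariant vector fields *)

Section Injectivity.
Context {k : fieldType} {H : hopfAlgType k} {n : nat}.
Local Notation S := (@antipode k H).
Variables (chi : 'I_n -> H -> k^o) (f : 'I_n -> 'I_n -> H -> k^o).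
Variables (N : 'M[H]_n) (d : 'I_n -> H).
Hypothesis chiL : forall i, linear (chi i).
Hypothesis fL : forall i j, linear (f i j).
Hypothesis chi1 : forall i, chi i 1 = 0.
Hypothesis chi_dual : forall i j, chi i (d j) = (i == j)%:R.
Hypothesis chiM : forall i a b,
  chi i (a * b) = (chi i a : k) * counit b + \sum_j (f i j a : k) * chi j b.
Hypothesis chi_ad : forall i,
  conv (Dl chi i) S = (fun h => \sum_j (chi j h : k) *: N i j).

(** In the free frame [Dr] the coefficients are [v N]. *)
Lemma Dl_free (v : 'I_n -> H) :
  (forall h, \sum_i v i * Dl chi i h = 0) -> forall i, v i = 0.
Proof.
move=> v0; have [M NM] : exists M, N *m M = 1%:M.
  case: n chi f N d chiL fL chi1 chi_dual chiM chi_ad => [|m] *.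
    by exists 0; apply/matrixP => -[].
  apply: comatrix_right_inverse; [exact: comatrixN|eassumption|..].
  - by move=> *; apply: drinfeldN.
  - by move=> *; apply: drinfeld_unit.
  - by move=> *; apply: coeff_drinfeld.
have vN j : \sum_i v i * N i j = 0.
  move: j; apply: (Dr_free chiL chi_dual (w := fun=> 0)) => h.
  rewrite [RHS]big1 => [|j _]; last by rewrite mul0r.
  rewrite -[RHS](v0 h); under eq_bigr do rewrite mulr_suml.
  rewrite exchange_big /=; apply: eq_bigr => i _.
  by rewrite (DlE chiL chi_ad) mulr_sumr; apply: eq_bigr => j _; rewrite mulrA.
move=> i; have -> : v i = ((\row_j v j) *m (N *m M)) 0 i by rewrite NM mulmx1 mxE.
rewrite mulmxA mxE big1 // => j _; rewrite mxE.
by under eq_bigr do rewrite mxE; rewrite vN mul0r.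
Qed.

End Injectivity.

(** * The calculus of a tangent space *)

Section SweedlerMore.
Context {k : fieldType} {H : hopfAlgType k}.

Lemma sweedler_sum (U : lmodType k) (h : H) I (r : seq I) (F : I -> H -> H -> U) :
  sweedler2 h (fun a b => \sum_(i <- r) F i a b) = \sum_(i <- r) sweedler2 h (F i).
Proof. exact: exchange_big. Qed.

(** A functional applied to the middle one of three Sweedler factors can be
    absorbed on either side. *)
Lemma sweedler_slide (U : lmodType k) (F : H -> H -> U) (u : H -> k^o) (h : H) :
  bilinear_fun F -> linear u ->
  sweedler2 h (fun a b => F (conv id (scal H u) a) b)
    = sweedler2 h (fun a b => F a (conv (scal H u) id b)).
Proof.
move=> FB uL.
transitivity (sweedler2 h (fun a b => sweedler2 a (fun a1 a2 => (u a2 : k) *: F a1 b))).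
  apply: eq_sweedler => a b.
  rewrite -[LHS]/((fun x => F x b) _) sweedler_comp; last by lin.
  by apply: eq_sweedler => a1 a2; rewrite mulr_scal (linZ (f := fun x => F x b)) //; lin.
apply: etrans (sweedler_coassoc (F := fun a1 a2 b => (u a2 : k) *: F a1 b) _ _ _ _) _; try by lin.
apply: eq_sweedler => a b.
rewrite [RHS]sweedler_comp; last by lin.
by apply: eq_sweedler => a1 a2; rewrite scal_mulr (linZ (f := F a)) //; lin.
Qed.

Lemma comul_Dl n (chi : 'I_n -> H -> k^o) i h : linear (chi i) ->
  comul (Dl chi i h) = sweedler2 h (fun a b => a \ot Dl chi i b).
Proof.
move=> cL; rewrite (sweedler_comp (L := @comul k H)); last exact: linearP.
transitivity (sweedler2 h (fun a b => sweedler2 a (fun a1 a2 => (chi i b : k) *: (a1 \ot a2)))).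
  apply: eq_sweedler => a b; rewrite mulr_scal linearZ /=.
  rewrite -[comul a in LHS]tlift_tensK [RHS](_ : _ = (chi i b : k) *: sweedler2 a (@tens _ _ _)) //.
  by rewrite [RHS](sweedler_comp (L := fun x => (chi i b : k) *: x)) //; lin.
apply: etrans (sweedler_coassoc (F := fun a1 a2 b => (chi i b : k) *: (a1 \ot a2)) _ _ _ _) _;
  try by lin.
apply: eq_sweedler => a b; rewrite [RHS](sweedler_comp (L := fun x => a \ot x)); last by lin.
by apply: eq_sweedler => a1 a2; rewrite mulr_scal tensZr.
Qed.

Lemma sweedler_Dl n (chi : 'I_n -> H -> k^o) (U : lmodType k) (F : H -> H -> U) i h :
  linear (chi i) -> bilinear_fun F ->
  sweedler2 (Dl chi i h) F = sweedler2 h (fun a b => F a (Dl chi i b)).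
Proof.
move=> cL FB; rewrite {1}/sweedler2 comul_Dl // [LHS]tlift_comp; last by lin.
by apply: eq_sweedler => a b; rewrite tlift_tens.
Qed.

Lemma tmap2_comulr (U U' V V' : lmodType k) (F : U -> H -> U') (G : V -> H -> V') t b :
  bilinear_fun F -> bilinear_fun G ->
  tmap2 F G t (comul b) = sweedler2 b (fun b1 b2 => tmap2 F G t (b1 \ot b2)).
Proof.
move=> FB GB; rewrite -[comul b in LHS]tlift_tensK.
by rewrite (tlift_comp (L := tmap2 F G t)) //; lin.
Qed.

Lemma tmap2_comull (U U' V V' : lmodType k) (F : H -> U -> U') (G : H -> V -> V') t b :
  bilinear_fun F -> bilinear_fun G ->
  tmap2 F G (comul b) t = sweedler2 b (fun b1 b2 => tmap2 F G (b1 \ot b2) t).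
Proof.
move=> FB GB; rewrite -[comul b in LHS]tlift_tensK.
by rewrite (tlift_comp (L := fun s => tmap2 F G s t)) //; lin.
Qed.

End SweedlerMore.

Lemma ev_val_linear (k : fieldType) (A : algType k) (g : submodClosed (fdual A)) a :
  linear (fun v : subspace g => ev (\val v) a : k^o).
Proof. by move=> r x y; rewrite linearP. Qed.

Section TangentCalculus.
Context {k : fieldType} {H : hopfAlgType k}.
Local Notation S := (@antipode k H).
Variables (g : submodClosed (fdual H)) (n : nat) (e : 'I_n -> subspace g).
Variables (c : 'I_n -> subspace g -> k^o) (f : 'I_n -> 'I_n -> H -> k^o).
Variables (N : 'M[H]_n) (d : 'I_n -> H).
Local Notation X := (H \ot subspace g)%type.
Let chi i : H -> k^o := ev (\val (e i)).
Hypothesis cL : forall i, linear (c i).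
Hypothesis cE : forall v, v = \sum_i (c i v : k) *: e i.
Hypothesis ce : forall i j, c i (e j) = (i == j)%:R.
Hypothesis chiL : forall i, linear (chi i).
Hypothesis fL : forall i j, linear (f i j).
Hypothesis chi1 : forall i, chi i 1 = 0.
Hypothesis chi_dual : forall i j, chi i (d j) = (i == j)%:R.
Hypothesis chiM : forall i a b,
  chi i (a * b) = (chi i a : k) * counit b + \sum_j (f i j a : k) * chi j b.
Hypothesis chi_ad : forall i,
  conv (Dl chi i) S = (fun h => \sum_j (chi j h : k) *: N i j).

Let DL i : linear (Dl chi i). Proof. exact: lin_Dl. Qed.
Let EL i j : linear (El f i j). Proof. exact: lin_El. Qed.
Let E'L i j : linear (Er f i j). Proof. exact: lin_Er. Qed.

Lemma X_ext (V : lmodType k) (F G : X -> V) : linear F -> linear G ->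
  (forall h i, F (h \ot e i) = G (h \ot e i)) -> F =1 G.
Proof.
move=> FL GL FG; apply: tensor_ext => // h v.
rewrite [v]cE tens_sumr !linS //; apply: eq_bigr => i _.
by rewrite tensZr -tensZl.
Qed.

Definition xi i (x : X) : H := tlift (fun h v => (c i v : k) *: h) x.

Lemma xiL i : linear (xi i).
Proof. by rewrite /xi; lin. Qed.

Lemma xi_tens i h j : xi i (h \ot e j) = ((i == j)%:R : k) *: h.
Proof. by rewrite /xi tlift_tens ?ce //; lin. Qed.

Lemma xiE x : x = \sum_i xi i x \ot e i.
Proof.
move: x; apply: X_ext; [lin|by have := xiL; lin|move=> h j].
under eq_bigr do rewrite xi_tens tensZl eq_sym.
by rewrite (sum_delta (fun i => h \ot e i)).
Qed.

Lemma xi_inj x y : (forall i, xi i x = xi i y) -> x = y.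
Proof. by move=> xy; rewrite [x]xiE [y]xiE; apply: eq_bigr => i _; rewrite xy. Qed.

Definition Lie (x : X) (a : H) : H := \sum_i xi i x * Dl chi i a.

Lemma Lie_linear : linear Lie.
Proof. by apply: lin_fun => a; have := xiL; rewrite /Lie; lin. Qed.

Lemma Lie_endo x : linear (Lie x).
Proof. by rewrite /Lie; lin. Qed.

Lemma Lie_inj : injective Lie.
Proof.
move=> x y xy; apply: xi_inj => i; apply/eqP; rewrite -subr_eq0; apply/eqP.
move: i; apply: (Dl_free chiL fL chi1 chi_dual chiM chi_ad) => h.
under eq_bigr do rewrite mulrBl.
by rewrite sumrB -[X in X - _]/(Lie x h) xy subrr.
Qed.

Lemma Lie_tens h (v : subspace g) a :
  Lie (h \ot v) a = sweedler2 a (fun a1 a2 => ev (\val v) a2 *: (h * a1)).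
Proof.
have evL := @ev_val_linear k H g.
have Ll : linear (fun v => Lie (h \ot v) a) by have := xiL; rewrite /Lie; lin.
rewrite [v]cE (linSZ _ _ _ Ll).
transitivity (\sum_i (c i v : k) *: sweedler2 a (fun a1 a2 => (chi i a2 : k) *: (h * a1))).
  apply: eq_bigr => i _; congr (_ *: _); rewrite /Lie.
  under eq_bigr do rewrite xi_tens eq_sym -scalerAl.
  rewrite sum_delta [LHS](sweedler_comp (L := fun x => h * x)); last by lin.
  by apply: eq_sweedler => a1 a2; rewrite mulr_scal scalerAr.
rewrite (eq_bigr (fun i => sweedler2 a (fun a1 a2 =>
   (c i v : k) *: ((chi i a2 : k) *: (h * a1))))) => [|i _]; last first.
  by rewrite (sweedler_comp (L := fun x => (c i v : k) *: x)) //; lin.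
rewrite -sweedler_sum; apply: eq_sweedler => a1 a2.
rewrite (linSZ _ _ _ (evL a2)) scaler_suml; apply: eq_bigr => i _.
by rewrite scalerA.
Qed.

Definition xlact (a : H) (x : X) : X := tmap ( *%R a) idfun x.

(** The right action that the Leibniz rule dictates, by [DlM]. *)
Definition xract (x : X) (b : H) : X := \sum_j (\sum_i xi i x * El f i j b) \ot e j.

Lemma xlact_tens a h v : xlact a (h \ot v) = (a * h) \ot v.
Proof. by rewrite /xlact tmap_tens //; lin. Qed.

Lemma xlact_bilinear : bilinear_fun xlact.
Proof.
apply: bilin => [x|a]; rewrite /xlact; last by lin.
by rewrite /tmap; lin.
Qed.

Lemma xract_bilinear : bilinear_fun xract.
Proof. by have := xiL; rewrite /xract; lin. Qed.

Lemma xi_lact i a x : xi i (xlact a x) = a * xi i x.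
Proof.
have := xiL; have := xlact_bilinear => ? ?.
move: x; apply: X_ext; [lin|lin|move=> h j].
by rewrite xlact_tens !xi_tens scalerAr.
Qed.

Lemma xi_sum i (h : 'I_n -> H) : xi i (\sum_j h j \ot e j) = h i.
Proof.
rewrite (linS _ _ _ (xiL i)); under eq_bigr do rewrite xi_tens.
exact: sum_delta.
Qed.

Lemma xi_ract j x b : xi j (xract x b) = \sum_i xi i x * El f i j b.
Proof. exact: xi_sum. Qed.

Lemma xract_tens h i b : xract (h \ot e i) b = \sum_j (h * El f i j b) \ot e j.
Proof.
apply: eq_bigr => j _; congr (_ \ot _).
under eq_bigr do rewrite xi_tens eq_sym -scalerAl.
exact: sum_delta.
Qed.

Lemma Lie_lact a x b : Lie (xlact a x) b = a * Lie x b.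
Proof. by rewrite /Lie mulr_sumr; apply: eq_bigr => i _; rewrite xi_lact mulrA. Qed.

Lemma Lie_leibniz x a b : Lie x (a * b) = Lie x a * b + Lie (xract x a) b.
Proof.
rewrite /Lie mulr_suml; under [X in _ + X]eq_bigr do rewrite xi_ract mulr_suml.
rewrite exchange_big -big_split /=; apply: eq_bigr => i _.
rewrite (DlM chiL chiM) mulrDr mulrA mulr_sumr; congr (_ + _).
by apply: eq_bigr => j _; rewrite mulrA.
Qed.

(** As [Lie] is injective, this determines the right action; the bimodule axioms
    follow from it. *)
Lemma Lie_ract x a b : Lie (xract x a) b = Lie x (a * b) - Lie x a * b.
Proof. by rewrite Lie_leibniz addrC addKr. Qed.

Lemma Lie1 x : Lie x 1 = 0.
Proof.
rewrite /Lie big1 // => i _.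
by rewrite /Dl /conv sweedler_unit ?/scal ?chi1 ?scale0r ?mulr0 //; lin.
Qed.

Lemma xlact1 x : xlact 1 x = x.
Proof. by apply: xi_inj => i; rewrite xi_lact mul1r. Qed.

Lemma xlactM a b x : xlact (a * b) x = xlact a (xlact b x).
Proof. by apply: xi_inj => i; rewrite !xi_lact mulrA. Qed.

Lemma xract1 x : xract x 1 = x.
Proof.
by apply: Lie_inj; apply/funext => b; rewrite Lie_ract mul1r Lie1 mul0r subr0.
Qed.

Lemma xractM x a b : xract x (a * b) = xract (xract x a) b.
Proof.
apply: Lie_inj; apply/funext => y; rewrite !Lie_ract mulrBl !mulrA.
by rewrite opprB subrKA.
Qed.

Lemma xlract a x b : xract (xlact a x) b = xlact a (xract x b).
Proof.
apply: Lie_inj; apply/funext => y.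
by rewrite Lie_lact !Lie_ract !Lie_lact mulrBr mulrA.
Qed.

Definition xbimodule : bimodule H X :=
  Bimodule xlact_bilinear xract_bilinear xlact1 xract1 xlactM xractM xlract.

Definition lieL : {linear X -> (H -> H)} :=
  HB.pack Lie (GRing.isLinear.Build _ _ _ _ _ Lie_linear).

Definition xfovc : fovc H X :=
  @Fovc k H X xbimodule lieL Lie_endo Lie_inj Lie_lact Lie_leibniz.

Definition xlcoact (x : X) : H \ot X := tassoc (tmap comul idfun x).

Definition xrcoact (x : X) : X \ot H :=
  \sum_i \sum_j sweedler2 (xi i x) (fun a b => (a \ot e j) \ot (b * N i j)).

(* In the context for [lin]. *)
Let xiL' := xiL.
Let xlactB := xlact_bilinear.
Let xractB := xract_bilinear.

Lemma xlcoactL : linear xlcoact.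
Proof. by rewrite /xlcoact; lin. Qed.

Lemma xrcoactL : linear xrcoact.
Proof. by rewrite /xrcoact; lin. Qed.

Lemma xlcoact_tens h v : xlcoact (h \ot v) = sweedler2 h (fun a b => a \ot (b \ot v)).
Proof. by rewrite /xlcoact tmap_tens ?tassoc_tensl //; lin. Qed.

Lemma xrcoact_tens h i : xrcoact (h \ot e i)
  = \sum_j sweedler2 h (fun a b => (a \ot e j) \ot (b * N i j)).
Proof.
rewrite -[RHS](sum_delta (fun i => \sum_j sweedler2 h
  (fun a b => (a \ot e j) \ot (b * N i j)))).
apply: eq_bigr => l _; rewrite scaler_sumr; apply: eq_bigr => j _.
rewrite xi_tens eq_sym.
rewrite (linZ (f := fun x => sweedler2 x (fun a b => (a \ot e j) \ot (b * N l j)))) //.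
by lin.
Qed.

Let xlL := xlcoactL.
Let xrL := xrcoactL.

Lemma xlcoactA x :
  tassoc (tmap comul idfun (xlcoact x)) = tmap idfun xlcoact (xlcoact x).
Proof.
move: x; apply: tensor_ext; [lin|lin|move=> h v].
rewrite xlcoact_tens.
rewrite (sweedler_comp (L := fun t => tassoc (tmap comul idfun t))); last by lin.
rewrite (sweedler_comp (L := tmap idfun xlcoact)); last by lin.
transitivity (sweedler2 h (fun a b => sweedler2 a (fun a1 a2 => a1 \ot (a2 \ot (b \ot v))))).
  by apply: eq_sweedler => a b; rewrite tmap_tens ?tassoc_tensl //; lin.
apply: etrans (sweedler_coassoc (F := fun a b d => a \ot (b \ot (d \ot v))) _ _ _ _) _; try by lin.
apply: eq_sweedler => a b; rewrite tmap_tens; [|lin..].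
by rewrite xlcoact_tens (sweedler_comp (L := fun t => a \ot t)); [|lin].
Qed.

Lemma xlcoact_counit x :
  tlift (fun (a : H) (y : X) => (counit a : k) *: y) (xlcoact x) = x.
Proof.
move: x; apply: tensor_ext; [lin|lin|move=> h v].
rewrite xlcoact_tens.
rewrite (sweedler_comp (L := tlift (fun (a : H) (y : X) => (counit a : k) *: y))); last by lin.
rewrite -[RHS](sweedler_counitl (L := fun a => a \ot v)); last by lin.
by apply: eq_sweedler => a b; rewrite tlift_tens //; lin.
Qed.

Lemma xrcoactA x :
  tassoc (tmap xrcoact idfun (xrcoact x)) = tmap idfun comul (xrcoact x).
Proof.
move: x; apply: X_ext; [lin|lin|move=> h i].
have NC : comatrix N by exact: comatrixN.
rewrite xrcoact_tens.
rewrite (linS (f := fun t => tassoc (tmap xrcoact idfun t))); last by lin.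
rewrite (linS (f := tmap idfun comul)); last by lin.
transitivity (\sum_j \sum_l sweedler2 h (fun a b => sweedler2 a (fun a1 a2 =>
    (a1 \ot e l) \ot ((a2 * N j l) \ot (b * N i j))))).
  apply: eq_bigr => j _.
  rewrite (sweedler_comp (L := fun t => tassoc (tmap xrcoact idfun t))); last by lin.
  rewrite -sweedler_sum; apply: eq_sweedler => a b.
  rewrite tmap_tens; [|lin..]; rewrite xrcoact_tens tens_suml.
  rewrite (linS (f := @tassoc _ _ _ _)); last by lin.
  apply: eq_bigr => l _; rewrite tassoc_tensl tlift_comp; last by lin.
  by apply: eq_sweedler => a1 a2; rewrite tlift_tens //; lin.
rewrite exchange_big /=; apply: eq_bigr => l _.
rewrite (sweedler_comp (L := tmap idfun comul)); last by lin.
rewrite -sweedler_sum.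
rewrite (eq_sweedler (G := fun a b => sweedler2 a (fun a1 a2 => \sum_j
    (a1 \ot e l) \ot ((a2 * N j l) \ot (b * N i j))))); last first.
  by move=> a b; rewrite sweedler_sum.
apply: etrans (sweedler_coassoc (F := fun a1 a2 b => \sum_j
    (a1 \ot e l) \ot ((a2 * N j l) \ot (b * N i j))) _ _ _ _) _; try by lin.
apply: eq_sweedler => a b; rewrite tmap_tens; [|lin..].
rewrite comul_mul NC.1 mulr_sumr tens_sumr sweedler_sum; apply: eq_bigr => j _.
rewrite -[comul b]tlift_tensK.
rewrite (tlift_comp (L := fun t => (a \ot e l) \ot (t * (N j l \ot N i j)))); last by lin.
by apply: eq_sweedler => b1 b2; rewrite mul_tens.
Qed.

Lemma xrcoact_counit x :
  tlift (fun (y : X) (a : H) => (counit a : k) *: y) (xrcoact x) = x.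
Proof.
move: x; apply: X_ext; [lin|lin|move=> h i].
have NC : comatrix N by exact: comatrixN.
rewrite xrcoact_tens (linS (f := tlift _)); last by lin.
rewrite -[RHS](sum_delta (fun i => h \ot e i)); apply: eq_bigr => j _.
rewrite (sweedler_comp (L := tlift _)); last by lin.
rewrite -[RHS](sweedler_counitr (L := fun a => ((i == j)%:R : k) *: (a \ot e j))); last by lin.
apply: eq_sweedler => a b; rewrite tlift_tens; last by lin.
by rewrite counitM NC.2 scalerA.
Qed.

Lemma xlrcoact x :
  tassoc (tmap xlcoact idfun (xrcoact x)) = tmap idfun xrcoact (xlcoact x).
Proof.
move: x; apply: X_ext; [lin|lin|move=> h i].
rewrite xrcoact_tens xlcoact_tens.
rewrite (linS (f := fun t => tassoc (tmap xlcoact idfun t))); last by lin.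
rewrite (sweedler_comp (L := tmap idfun xrcoact)); last by lin.
rewrite [RHS](eq_sweedler (G := fun a b => \sum_j sweedler2 b (fun b1 b2 =>
    a \ot ((b1 \ot e j) \ot (b2 * N i j))))); last first.
  move=> a b; rewrite tmap_tens; [|lin..]; rewrite xrcoact_tens tens_sumr.
  by apply: eq_bigr => j _; rewrite (sweedler_comp (L := fun t => a \ot t)); [|lin].
rewrite sweedler_sum; apply: eq_bigr => j _.
apply: etrans _ (sweedler_coassoc (F := fun a b d => a \ot ((b \ot e j) \ot (d * N i j))) _ _ _ _); try by lin.
rewrite (sweedler_comp (L := fun t => tassoc (tmap xlcoact idfun t))); last by lin.
apply: eq_sweedler => a b; rewrite tmap_tens; [|lin..].
rewrite xlcoact_tens tassoc_tensl tlift_comp; last by lin.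
by apply: eq_sweedler => a1 a2; rewrite tlift_tens //; lin.
Qed.

Lemma xlcoact_lact a x :
  xlcoact (xlact a x) = tmap2 *%R xlact (comul a) (xlcoact x).
Proof.
move: x; apply: tensor_ext; [lin|lin|move=> h v].
rewrite xlact_tens !xlcoact_tens tmap2_comull; [|lin..].
rewrite sweedler_mul; last by lin.
apply: eq_sweedler => a1 a2.
rewrite (sweedler_comp (L := tmap2 *%R xlact (a1 \ot a2))); last by lin.
apply: eq_sweedler => h1 h2; rewrite tmap2_tens; [|lin..].
by rewrite xlact_tens.
Qed.

Lemma xlcoact_ract x b :
  xlcoact (xract x b) = tmap2 *%R xract (xlcoact x) (comul b).
Proof.
move: x; apply: X_ext; [lin|lin|move=> h i].
rewrite xract_tens xlcoact_tens (linS _ _ _ xlcoactL) tmap2_comulr; [|lin..].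
transitivity (\sum_j sweedler2 b (fun b1 b2 => sweedler2 h (fun h1 h2 =>
    (h1 * b1) \ot ((h2 * El f i j b2) \ot e j)))).
  apply: eq_bigr => j _; rewrite xlcoact_tens sweedler_mul; last by lin.
  by rewrite sweedler_exchange (sweedler_Dl (chi := f i)) //; lin.
rewrite -sweedler_sum; apply: eq_sweedler => b1 b2.
rewrite (sweedler_comp (L := fun t => tmap2 *%R xract t (b1 \ot b2))); last by lin.
rewrite -sweedler_sum; apply: eq_sweedler => h1 h2; rewrite tmap2_tens; [|lin..].
by rewrite xract_tens tens_sumr.
Qed.

Lemma xlcoact_bimodule a x b : xlcoact (xract (xlact a x) b)
  = tmap2 *%R xract (tmap2 *%R xlact (comul a) (xlcoact x)) (comul b).
Proof. by rewrite xlcoact_ract xlcoact_lact. Qed.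

Lemma xrcoact_lact a x :
  xrcoact (xlact a x) = tmap2 xlact *%R (comul a) (xrcoact x).
Proof.
move: x; apply: X_ext; [lin|lin|move=> h i].
rewrite xlact_tens !xrcoact_tens (linS (f := tmap2 xlact *%R (comul a))); last by lin.
apply: eq_bigr => j _; rewrite tmap2_comull; [|lin..].
rewrite sweedler_mul; last by lin.
apply: eq_sweedler => a1 a2.
rewrite (sweedler_comp (L := tmap2 xlact *%R (a1 \ot a2))); last by lin.
apply: eq_sweedler => h1 h2; rewrite tmap2_tens; [|lin..].
by rewrite xlact_tens mulrA.
Qed.

(** In coordinates this is [yetter_drinfeld]. *)
Lemma xrcoact_ract x b :
  xrcoact (xract x b) = tmap2 xract *%R (xrcoact x) (comul b).
Proof.
move: x; apply: X_ext; [lin|lin|move=> h i].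
rewrite xract_tens xrcoact_tens (linS _ _ _ xrcoactL).
transitivity (\sum_j sweedler2 h (fun h1 h2 => sweedler2 b (fun b1 b2 =>
    ((h1 * b1) \ot e j) \ot (h2 * \sum_l El f i l b2 * N l j)))).
  transitivity (\sum_l \sum_j sweedler2 h (fun h1 h2 => sweedler2 b (fun b1 b2 =>
    ((h1 * b1) \ot e j) \ot (h2 * (El f i l b2 * N l j))))).
    apply: eq_bigr => l _; rewrite xrcoact_tens; apply: eq_bigr => j _.
    rewrite sweedler_mul; last by lin.
    apply: eq_sweedler => h1 h2; rewrite (sweedler_Dl (chi := f i)); [|lin..].
    by apply: eq_sweedler => b1 b2; rewrite mulrA.
  rewrite exchange_big; apply: eq_bigr => j _ /=; rewrite -sweedler_sum.
  apply: eq_sweedler => h1 h2; rewrite -sweedler_sum.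
  by apply: eq_sweedler => b1 b2; rewrite mulr_sumr tens_sumr.
rewrite (linS (f := fun t => tmap2 xract *%R t (comul b))); last by lin.
transitivity (\sum_l \sum_j sweedler2 h (fun h1 h2 => sweedler2 b (fun b1 b2 =>
    ((h1 * El f l j b1) \ot e j) \ot (h2 * N i l * b2)))).
  rewrite [RHS]exchange_big /=; apply: eq_bigr => j _ /=; rewrite -sweedler_sum.
  apply: eq_sweedler => h1 h2; rewrite -sweedler_sum.
  transitivity (sweedler2 b (fun b1 b2 => \sum_l
      ((h1 * b1) \ot e j) \ot (h2 * N i l * Er f l j b2))).
    apply: eq_sweedler => b1 b2.
    rewrite (yetter_drinfeld chiL chi_dual chiM chi_ad) mulr_sumr tens_sumr.
    by apply: eq_bigr => l _; rewrite mulrA.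
  rewrite !sweedler_sum; apply: eq_bigr => l _.
  by rewrite -(sweedler_slide (F := fun b1 b2 =>
    ((h1 * b1) \ot e j) \ot (h2 * N i l * b2))); [|lin..].
apply: eq_bigr => l _.
rewrite (sweedler_comp (L := fun t => tmap2 xract *%R t (comul b))); last by lin.
rewrite -sweedler_sum; apply: eq_sweedler => h1 h2.
rewrite tmap2_comulr; [|lin..]; rewrite -sweedler_sum; apply: eq_sweedler => b1 b2.
by rewrite tmap2_tens; [rewrite xract_tens tens_suml|lin..].
Qed.

Lemma xrcoact_bimodule a x b : xrcoact (xract (xlact a x) b)
  = tmap2 xract *%R (tmap2 xlact *%R (comul a) (xrcoact x)) (comul b).
Proof. by rewrite xrcoact_ract xrcoact_lact. Qed.

Let LieL := Lie_linear.
Let LieE := Lie_endo.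

Let LieB : bilinear_fun Lie.
Proof.
by apply: bilin => [h|x]; [move=> ? ? ?; rewrite LieL | exact: Lie_endo].
Qed.

Lemma Lie_tensE h i b : Lie (h \ot e i) b = h * Dl chi i b.
Proof.
rewrite /Lie; under eq_bigr do rewrite xi_tens eq_sym -scalerAl.
exact: sum_delta.
Qed.

Lemma Lie_lcolinear x h :
  comul (Lie x h) = tmap2 *%R Lie (xlcoact x) (comul h).
Proof.
move: x; apply: X_ext; [lin|lin|move=> a i].
rewrite Lie_tensE comul_mul comul_Dl // tmap2_comulr; [|lin..].
rewrite (sweedler_comp (L := fun t => comul a * t)); last by lin.
apply: eq_sweedler => h1 h2; rewrite xlcoact_tens.
rewrite (sweedler_comp (L := fun t => tmap2 *%R Lie t (h1 \ot h2))); last by lin.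
rewrite -[comul a]tlift_tensK (tlift_comp (L := fun t => t * (h1 \ot Dl chi i h2))); last by lin.
apply: eq_sweedler => a1 a2; rewrite tmap2_tens; [|lin..].
by rewrite Lie_tensE mul_tens.
Qed.

Lemma Lie_rcolinear x h :
  comul (Lie x h) = tmap2 Lie *%R (xrcoact x) (comul h).
Proof.
move: x; apply: X_ext; [lin|lin|move=> a i].
rewrite Lie_tensE comul_mul xrcoact_tens.
rewrite (linS (f := fun t => tmap2 Lie *%R t (comul h))); last by lin.
have -> : comul (Dl chi i h)
    = \sum_j sweedler2 h (fun h1 h2 => Dl chi j h1 \ot (N i j * h2)).
  rewrite comul_Dl // (eq_sweedler (G := fun h1 h2 =>
      \sum_j h1 \ot (N i j * Dr chi j h2))); last first.
    by move=> h1 h2; rewrite (DlE chiL chi_ad) tens_sumr.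
  rewrite sweedler_sum; apply: eq_bigr => j _.
  by rewrite -(sweedler_slide (F := fun h1 h2 => h1 \ot (N i j * h2))); [|lin..].
rewrite mulr_sumr; apply: eq_bigr => j _.
rewrite tmap2_comulr; [|lin..].
rewrite (sweedler_comp (L := fun t => comul a * t)); last by lin.
apply: eq_sweedler => h1 h2.
rewrite (sweedler_comp (L := fun t => tmap2 Lie *%R t (h1 \ot h2))); last by lin.
rewrite -[comul a]tlift_tensK (tlift_comp (L := fun t => t * (Dl chi j h1 \ot (N i j * h2)))); last by lin.
apply: eq_sweedler => a1 a2; rewrite tmap2_tens; [|lin..].
by rewrite Lie_tensE mul_tens mulrA.
Qed.

Definition lcoactL : {linear X -> (H \ot X)%type} :=
  HB.pack xlcoact (GRing.isLinear.Build _ _ _ _ _ xlcoactL).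

Definition rcoactL : {linear X -> (X \ot H)%type} :=
  HB.pack xrcoact (GRing.isLinear.Build _ _ _ _ _ xrcoactL).

Definition xbicov : bicov_fovc H X :=
  @BicovFovc k H X xfovc lcoactL rcoactL xlcoactA xlcoact_counit
    xrcoactA xrcoact_counit xlrcoact xlcoact_bimodule xrcoact_bimodule
    Lie_lcolinear Lie_rcolinear.

End TangentCalculus.

(** * Existence of the calculus, and recovery of the tangent space *)

Section FiniteDualFacts.
Context {k : fieldType}.

Lemma ev_inj (A : algType k) (u v : fdual A) : (forall a, ev u a = ev v a) -> u = v.
Proof. by move=> uv; apply: val_inj; apply/funext. Qed.

Lemma ev_lin (A : algType k) (u : fdual A) : linear (ev u : A -> k^o).
Proof. by case: u => u /= /asboolP[]. Qed.

Lemma ev_arg_linear (A : algType k) (a : A) : linear (fun u : fdual A => ev u a : k^o).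
Proof. exact: ev_linear. Qed.

Lemma ev_sum (A : algType k) n (c : 'I_n -> k) (u : 'I_n -> fdual A) a :
  ev (\sum_i c i *: u i) a = \sum_i c i * ev (u i) a.
Proof. exact: (linSZ _ _ _ (ev_arg_linear a)). Qed.

Lemma ev_free (A : algType k) n (u : 'I_n -> fdual A) : free_family u ->
  exists d : 'I_n -> A, forall i j, ev (u i) (d j) = (i == j)%:R.
Proof.
move=> u_free; apply: (dual_vectors (u := fun i => ev (u i) : A -> k^o)).
  by move=> i; exact: ev_lin.
move=> c c0; apply: u_free; apply: ev_inj => a.
by rewrite ev_sum c0 (lin0 (ev_arg_linear a)).
Qed.

Context {H : hopfAlgType k}.
Local Notation S := (@antipode k H).

Lemma adE (u : fdual H) h : ad u h = conv (conv id (scal H (ev u))) S h.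
Proof.
have uL := ev_lin u; rewrite -convA; [|lin..].
apply: eq_sweedler => a b.
rewrite [RHS](sweedler_comp (L := fun x => a * x)); last by lin.
by apply: eq_sweedler => b1 b2; rewrite scal_mulr scalerAr.
Qed.

Lemma ad_linear (g : submodClosed (fdual H)) h :
  linear (fun v : subspace g => ad (\val v) h).
Proof. by have := @ev_val_linear k H g; rewrite /ad /sweedler3; lin. Qed.

Lemma fdual_comul_tangent (u v : fdual H) n (f : 'I_n -> fdual H) (w : 'I_n -> fdual H) a b :
  fdual_comul u = v \ot fdual_unit H + \sum_j f j \ot w j ->
  ev u (a * b) = ev v a * counit b + \sum_j ev (f j) a * ev (w j) b.
Proof.
move=> uE; rewrite -fdual_comulE uE (linD _ _ (fdual_pair_linear a b)).
rewrite fdual_pair_tens (linS _ _ _ (fdual_pair_linear a b)); congr (_ + _).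
by apply: eq_bigr => j _; rewrite fdual_pair_tens.
Qed.

End FiniteDualFacts.

Section TangentData.
Context {k : fieldType} {H : hopfAlgType k}.
Local Notation S := (@antipode k H).

(** A basis of a bicovariant quantum tangent space with the coefficients of the
    two structure maps in it, and a dual family of elements of [H]. *)
Definition tangent_data (g : submodClosed (fdual H)) n (e : 'I_n -> subspace g)
    (c : 'I_n -> subspace g -> k^o) (f : 'I_n -> 'I_n -> H -> k^o)
    (N : 'M[H]_n) (d : 'I_n -> H) :=
  let chi i : H -> k^o := ev (\val (e i)) in
  [/\ forall i, linear (c i), forall v, v = \sum_i (c i v : k) *: e i &
      forall i j, c i (e j) = (i == j)%:R] /\
   [/\ forall i j, linear (f i j), forall i, chi i 1 = 0,
      forall i j, chi i (d j) = (i == j)%:R,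
      forall i a b, chi i (a * b)
        = (chi i a : k) * counit b + \sum_j (f i j a : k) * chi j b &
      forall i, conv (Dl chi i) S = (fun h => \sum_j (chi j h : k) *: N i j)].

Lemma basis_val_dual (g : submodClosed (fdual H)) n (e : 'I_n -> subspace g) :
  is_basis e -> exists d : 'I_n -> H, forall i j, ev (\val (e i)) (d j) = (i == j)%:R.
Proof.
move=> eB; apply: (ev_free (u := fun i => \val (e i))) => b b0.
have /(_ b) := is_basis_free eB; apply.
apply: val_inj; rewrite linear0 -[RHS]b0 linear_sum.
by apply: eq_bigr => i _; rewrite linearZ.
Qed.

Lemma qts_data (g : bicovQTS H) : exists n (e : 'I_n -> subspace g) c f N d,
  tangent_data e c f N d.
Proof.
case: g => g [[n [e eB]] g1 gM] gad /=; exists n, e.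
have [c [cL cE ce]] := basis_coord eB.
have [d dP] := basis_val_dual eB.
have [N NP] : exists N : 'M[H]_n, forall i h,
    ad (\val (e i)) h = \sum_j ev (\val (e j)) h *: N i j.
  pose t i := sval (cid (gad _ (valP (e i)))).
  have tP i h : ad (\val (e i)) h
      = tlift (fun (y : subspace g) a => ev (\val y) h *: a) (t i).
    by rewrite /t; case: (cid _) => ? /= ->.
  exists (\matrix_(i, j) tlift (fun (y : subspace g) a => (c j y : k) *: a) (t i)) => i h.
  rewrite tP; under [RHS]eq_bigr do rewrite mxE.
  rewrite (eq_bigr (fun j => tlift (fun (y : subspace g) a =>
      ev (\val (e j)) h *: ((c j y : k) *: a)) (t i))); last first.
    by move=> j _; rewrite (tlift_comp (L := fun x => ev (\val (e j)) h *: x)) //; lin.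
  rewrite [RHS]exchange_big /= [LHS]/tlift; apply: eq_bigr => -[y a] _ /=.
  rewrite {1}[y]cE (linSZ _ _ _ (@ev_val_linear k H g h)) scaler_suml.
  by apply: eq_bigr => j _; rewrite scalerA mulrC.
have [f [fL fP]] : exists f : 'I_n -> 'I_n -> H -> k^o, (forall i j, linear (f i j)) /\
    forall i a b, ev (\val (e i)) (a * b)
      = ev (\val (e i)) a * counit b + \sum_j (f i j a : k) * ev (\val (e j)) b.
  suff /choice[f fP] : forall i, exists f : 'I_n -> H -> k^o, (forall j, linear (f j)) /\
      forall a b, ev (\val (e i)) (a * b)
        = ev (\val (e i)) a * counit b + \sum_j (f j a : k) * ev (\val (e j)) b.
    by exists f; split=> [i j|i a b]; case: (fP i).
  move=> i; have [y yg [t yt]] := gM _ (valP (e i)).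
  pose f j a : k^o := tlift (fun (u : fdual H) (v : subspace g) => (ev u a : k) * (c j v : k) : k^o) t.
  have fL j : linear (f j).
    apply: (@lin_tlift_fun _ _ _ _ k^o
      (fun a (u : fdual H) (v : subspace g) => (ev u a : k) * (c j v : k)) t) => u v.
    by apply: lin_mulk; exact: ev_lin.
  have E a b : ev (\val (e i)) (a * b) = ev y a * counit b + \sum_j (f j a : k) * ev (\val (e j)) b.
    rewrite -fdual_comulE yt (linD _ _ (fdual_pair_linear a b)) fdual_pair_tens.
    congr (_ + _); rewrite /tmap (tlift_comp (L := fun t => fdual_pair t a b)); last exact: fdual_pair_linear.
    rewrite (eq_bigr (fun j => tlift (fun (u : fdual H) (v : subspace g) =>
       (ev u a : k) * (c j v : k) * ev (\val (e j)) b : k^o) t)); last first.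
      by move=> j _; rewrite /f (tlift_comp (L := fun x : k^o => (x : k) * ev (\val (e j)) b : k^o)) //; lin.
    rewrite [RHS]exchange_big /= [LHS]/tlift; apply: eq_bigr => -[u v] _ /=.
    rewrite fdual_pair_tens {1}[v]cE (linSZ _ _ _ (@ev_val_linear k H g b)) mulr_sumr.
    by apply: eq_bigr => j _; rewrite mulrA.
  (* At [b = 1] the sum vanishes, and [y] is the given element. *)
  have yE a : ev y a = ev (\val (e i)) a.
    have := E a 1; rewrite mulr1 counit1 mulr1 big1 ?addr0 // => j _.
    by rewrite g1 ?mulr0 //; exact: valP.
  by exists f; split=> // a b; rewrite E yE.
exists c, f, N, d; split; split=> //.
- by move=> i; apply: g1; exact: valP.
- by move=> i; apply/funext => h; rewrite -adE NP.
Qed.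

Definition data_calculus (g : submodClosed (fdual H)) n (e : 'I_n -> subspace g)
    c f N d (D : tangent_data e c f N d) : bicov_fovc H (H \ot subspace g)%type :=
  let: conj (And3 cL cE ce) (And5 fL chi1 dP chiM adP) := D in
  xbicov cL cE ce (fun i => ev_lin _) fL chi1 dP chiM adP.

Lemma data_calculus_tangent (g : submodClosed (fdual H)) n (e : 'I_n -> subspace g)
    c f N d (D : tangent_data e c f N d) : tangent_calculus (data_calculus D).
Proof.
case: D => -[cL cE ce] [fL chi1 dP chiM adP] /=.
have chiL i := ev_lin (\val (e i)).
have LieT := Lie_tens cL cE ce.
split; [by move=> *; exact: xlact_tens|by move=> *; exact: xlcoact_tens|by move=> *; exact: LieT|].
move=> m chi' f' N' chi'B chi'M chi'N.
have LieE h i y : Lie e c (h \ot chi' i) y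
    = h * Dl (fun j => ev (\val (chi' j)) : H -> k^o) i y.
  rewrite LieT [RHS](sweedler_comp (L := fun x => h * x)); last by lin.
  by apply: eq_sweedler => a b; rewrite mulr_scal scalerAr.
have chi'L i : linear (ev (\val (chi' i)) : H -> k^o) := ev_lin _.
have chi'Mul i a b : ev (\val (chi' i)) (a * b) = ev (\val (chi' i)) a * counit b
    + \sum_j ev (f' i j) a * ev (\val (chi' j)) b.
  exact: fdual_comul_tangent.
split.
  move=> h a b i /=; apply: (Lie_inj cL cE ce chiL fL chi1 dP chiM adP).
  apply/funext => y.
  rewrite (Lie_ract cL ce chiL chiM) xlact_tens !LieE.
  rewrite (DlM chi'L chi'Mul) mulrDr !mulrA addrC addKr.
  have LyL : linear (fun t => Lie e c t y) by move=> r s t; rewrite (Lie_linear e cL).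
  rewrite [RHS](linS _ _ _ LyL) mulr_sumr; apply: eq_bigr => j _.
  rewrite [RHS](sweedler_comp (L := fun t => Lie e c t y)) //.
  rewrite mulrA [a * h * _](sweedler_comp (L := fun x => a * h * x)); last by lin.
  rewrite [LHS](sweedler_comp (L := fun x => x * _)); last by lin.
  by apply: eq_sweedler => b1 b2; rewrite LieE mulr_scal -scalerAr.
move=> h i /=.
have key q : \sum_p (c p (chi' i) : k) *: N p q = \sum_j (c q (chi' j) : k) *: N' i j.
  pose v q := \sum_p (c p (chi' i) : k) *: N p q.
  pose w q := \sum_j (c q (chi' j) : k) *: N' i j.
  suff /(chi_free dP)/(_ q) : forall y,
    \sum_q (ev (\val (e q)) y : k) *: v q = \sum_q (ev (\val (e q)) y : k) *: w q by [].
  move=> y; rewrite /v /w {v w}.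
  transitivity (ad (\val (chi' i)) y).
    under eq_bigr do rewrite scaler_sumr.
    rewrite exchange_big /= [chi' i in RHS]cE (linSZ _ _ _ (ad_linear y)).
    apply: eq_bigr => p _; rewrite adE adP scaler_sumr; apply: eq_bigr => r _.
    by rewrite !scalerA mulrC.
  rewrite chi'N; under [RHS]eq_bigr do rewrite scaler_sumr.
  rewrite exchange_big /=; apply: eq_bigr => j _.
  rewrite {1}[chi' j]cE (linSZ _ _ _ (@ev_val_linear k H g y)) scaler_suml.
  by apply: eq_bigr => r _; rewrite scalerA mulrC.
transitivity (\sum_q sweedler2 h (fun h1 h2 =>
    (h1 \ot e q) \ot (h2 * \sum_p (c p (chi' i) : k) *: N p q))).
  rewrite [in LHS](cE (chi' i)) tens_sumr.
  rewrite (eq_bigr (fun p => (c p (chi' i) : k) *: (h \ot e p))); last first.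
    by move=> p _; rewrite tensZr.
  rewrite (linSZ _ _ _ (xrcoactL e N cL)).
  rewrite (eq_bigr (fun p => \sum_q sweedler2 h (fun h1 h2 =>
      (c p (chi' i) : k) *: ((h1 \ot e q) \ot (h2 * N p q))))); last first.
    move=> p _; rewrite (xrcoact_tens N cL ce) scaler_sumr; apply: eq_bigr => q _.
    by rewrite (sweedler_comp (L := fun t => (c p (chi' i) : k) *: t)) //; lin.
  rewrite exchange_big /=; apply: eq_bigr => q _; rewrite -sweedler_sum.
  apply: eq_sweedler => h1 h2; rewrite mulr_sumr tens_sumr; apply: eq_bigr => p _.
  by rewrite -scalerAr tensZr.
rewrite [RHS](eq_bigr (fun j => \sum_q sweedler2 h (fun h1 h2 =>
    (c q (chi' j) : k) *: ((h1 \ot e q) \ot (h2 * N' i j))))); last first.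
  move=> j _; rewrite -sweedler_sum; apply: eq_sweedler => h1 h2.
  rewrite {1}[chi' j]cE tens_sumr tens_suml; apply: eq_bigr => q _.
  by rewrite tensZr tensZl.
rewrite [RHS]exchange_big /=; apply: eq_bigr => q _; rewrite -sweedler_sum.
apply: eq_sweedler => h1 h2; rewrite key mulr_sumr tens_sumr; apply: eq_bigr => j _.
by rewrite -scalerAr tensZr.
Qed.

Lemma exists_tangent_calculus (g : bicovQTS H) :
  exists C : bicov_fovc H (H \ot subspace g)%type, tangent_calculus C.
Proof.
have [n [e [c [f [N [d D]]]]]] := qts_data g.
by exists (data_calculus D); exact: data_calculus_tangent.
Qed.

End TangentData.

Section TangentCalculusFacts.
Context {k : fieldType} {H : hopfAlgType k} (g : submodClosed (fdual H)).
Variable C : bicov_fovc H (H \ot subspace g)%type.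
Hypothesis CT : tangent_calculus C.
Local Notation X := (H \ot subspace g)%type.

Lemma tens1_inj : injective (fun v : subspace g => (1 : H) \ot v).
Proof.
have B : bilinear_fun (fun (h : H) (v : subspace g) => (counit h : k) *: v) by lin.
move=> v w /(congr1 (tlift (fun (h : H) (v : subspace g) => (counit h : k) *: v))).
by rewrite !tlift_tens // counit1 !scale1r.
Qed.

Lemma tangent_coinvariant (x : X) : x \in left_coinvariants C <-> exists v, x = 1 \ot v.
Proof.
have [_ Cl _ _] := CT; split=> [/asboolP xC|[v ->]]; last first.
  by apply/asboolP; rewrite Cl sweedler_unit //; lin.
(* [a \ot (b \ot v) |-> a \ot epsilon(b) v] is a retraction of the coaction. *)
pose Q (t : H \ot X) : X := tlift (fun a y =>
  tlift (fun b v => a \ot ((counit b : k) *: v)) y) t.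
have QL : linear Q by rewrite /Q; lin.
have QC y : Q (lcoact C y) = y.
  move: y; apply: tensor_ext; [lin|lin|move=> h v].
  rewrite Cl sweedler_comp // -[RHS](sweedler_counitr (L := fun a => a \ot v)); last by lin.
  apply: eq_sweedler => a b; rewrite /Q tlift_tens ?tlift_tens ?tensZr //; lin.
exists (tlift (fun (b : H) (v : subspace g) => (counit b : k) *: v) x).
rewrite -[LHS]QC xC /Q tlift_tens; last by lin.
by rewrite (tlift_comp (L := fun v => (1 : H) \ot v)) //; lin.
Qed.

Lemma tangent_lie1 v h : counit (lie C (1 \ot v) h) = ev (\val v) h.
Proof.
have [_ _ Cl _] := CT; rewrite Cl.
rewrite (sweedler_comp (L := @counit k H)); last exact: linearP.
rewrite -[RHS](sweedler_counitl (L := (ev (\val v) : H -> k^o))); last exact: ev_lin.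
by apply: eq_sweedler => a b; rewrite mul1r linearZ /= [_ *: _]mulrC.
Qed.

(** The coinvariants are the fields [1 \ot v], and [tangent_lie1] reads off [v]. *)
Lemma tangent_recover (u : fdual H) : u \in g <->
  exists2 x, x \in left_coinvariants C & forall h, ev u h = counit (lie C x h).
Proof.
split=> [ug|[x /tangent_coinvariant[v ->] uE]].
  exists (1 \ot (Subspace ug : subspace g)); first by apply/tangent_coinvariant; eexists.
  by move=> h; rewrite tangent_lie1.
rewrite (_ : u = \val v); first exact: valP.
by apply: ev_inj => h; rewrite uE tangent_lie1.
Qed.

Lemma tangent_fin : finite_dim (subspace g) -> finite_dim (subspace (left_coinvariants C)).
Proof.
move=> [n [e eB]]; have [c [cL cE ce]] := basis_coord eB.
have mem v : 1 \ot v \in left_coinvariants C by apply/tangent_coinvariant; exists v.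
exists n, (fun i => Subspace (mem (e i))) => w.
have [v wE] : exists v, \val w = 1 \ot v by apply/tangent_coinvariant; exact: valP.
have sumE (b : {ffun 'I_n -> k}) :
    w = \sum_i b i *: Subspace (mem (e i)) <-> v = \sum_i b i *: e i.
  split=> [E|E].
    apply: tens1_inj; rewrite -wE E linear_sum tens_sumr; apply: eq_bigr => i _.
    by rewrite tensZr linearZ.
  apply: val_inj; rewrite wE E linear_sum tens_sumr; apply: eq_bigr => i _.
  by rewrite tensZr linearZ.
have [b [bE bU]] := eB v; exists b; split; first by apply/sumE.
by move=> b' /sumE; exact: bU.
Qed.

End TangentCalculusFacts.

(** * Isomorphisms of calculi *)

Section Isomorphisms.
Context {k : fieldType} {H : hopfAlgType k}.
Implicit Types C D E : fin_bicov_fovc H.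

Lemma tmap_id (V W : lmodType k) (t : V \ot W) : tmap idfun idfun t = t.
Proof. exact: tlift_tensK. Qed.

Lemma tmap_comp (V V' V'' W W' W'' : lmodType k) (f : V -> V') (f' : V' -> V'')
    (g : W -> W') (g' : W' -> W'') t :
  linear f -> linear f' -> linear g -> linear g' ->
  tmap f' g' (tmap f g t) = tmap (fun x => f' (f x)) (fun x => g' (g x)) t.
Proof.
move=> fL f'L gL g'L; move: t; apply: tensor_ext; [lin|lin|move=> v w].
by rewrite !tmap_tens //; lin.
Qed.

Lemma fovc_iso_refl C : fovc_iso C C.
Proof.
exists idfun; split=> [|//]; split=> [|//|//|x|x].
- by exists idfun.
- by rewrite tmap_id.
- by rewrite tmap_id.
Qed.

Lemma fovc_iso_trans C D E : fovc_iso C D -> fovc_iso D E -> fovc_iso C E.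
Proof.
move=> [F [[Fb Fl Fr Flc Frc] Fli]] [G [[Gb Gl Gr Glc Grc] Gli]].
have FL : linear F by exact: linearP.
have GL : linear G by exact: linearP.
exists (G \o F : {linear _ -> _}); split; last by move=> x; rewrite /= Gli Fli.
split=> [|h x|x h|x|x] /=.
- exact: bij_comp.
- by rewrite Fl Gl.
- by rewrite Fr Gr.
- by rewrite Glc Flc tmap_comp //; lin.
- by rewrite Grc Frc tmap_comp //; lin.
Qed.

Lemma fovc_iso_sym C D : fovc_iso C D -> fovc_iso D C.
Proof.
move=> [F [[[G FK GK] Fl Fr Flc Frc] Fli]].
have FL : linear F by exact: linearP.
have GL : linear G.
  by move=> a x y; apply: (can_inj FK); rewrite GK linearP !GK.
pose Gl : {linear vfields D -> vfields C} :=
  HB.pack G (GRing.isLinear.Build _ _ _ _ _ GL).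
have FG : (fun x => F (G x)) = idfun by apply/funext.
have GF : (fun x => G (F x)) = idfun by apply/funext.
exists Gl; split; last by move=> x; rewrite -Fli [F _]GK.
split=> [|h x|x h|x|x] /=.
- by exists F.
- by apply: (can_inj FK); rewrite Fl !GK.
- by apply: (can_inj FK); rewrite Fr !GK.
- rewrite -[x in RHS]GK Flc tmap_comp //; [|lin..].
  by rewrite GF tmap_id.
- rewrite -[x in RHS]GK Frc tmap_comp //; [|lin..].
  by rewrite GF tmap_id.
Qed.

Lemma fovc_iso_coinvariants C D (F : {linear vfields C -> vfields D}) :
  injective F -> (forall x, lcoact D (F x) = tmap idfun F (lcoact C x)) ->
  forall x, x \in left_coinvariants C -> F x \in left_coinvariants D.
Proof.
move=> Fi Flc x /asboolP xC; apply/asboolP; rewrite Flc xC tmap_tens //.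
exact: linearP.
Qed.

Lemma fovc_iso_eq C D : fovc_iso C D -> fovc_iso C = fovc_iso D.
Proof.
move=> CD; apply/funext => E; apply/propext; split=> [CE|DE].
  exact: fovc_iso_trans (fovc_iso_sym CD) CE.
exact: fovc_iso_trans CD DE.
Qed.

Lemma isoclass_eq C D : isoclass C = isoclass D <-> fovc_iso C D.
Proof.
split=> [/(congr1 sval) /= ->|/fovc_iso_eq CD]; first exact: fovc_iso_refl.
exact: eq_exist.
Qed.

End Isomorphisms.

(** * Elements of the finite dual *)

Section TensorRepresentation.
Context {k : fieldType}.

(** A shortest representation has independent second factors. *)
Lemma tensor_free_repr (V W : lmodType k) (t : V \ot W) :
  exists n (v : 'I_n -> V) (w : 'I_n -> W),
    free_family w /\ t = \sum_i v i \ot w i.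
Proof.
pose P n := `[< exists (v : 'I_n -> V) (w : 'I_n -> W), t = \sum_i v i \ot w i >].
have exP : exists n, P n.
  exists (size (repr t)); apply/asboolP.
  exists (fun i => (nth (0, 0) (repr t) i).1), (fun i => (nth (0, 0) (repr t) i).2).
  by rewrite [LHS]tensor_span (big_nth (0, 0)) big_mkord.
case: (ex_minnP exP) => n /asboolP[v [w tE]] n_min; exists n, v, w; split=> // c c0 j.
apply/eqP/negPn/negP => cj0.
case: n => [|n] in v w tE n_min c c0 j cj0 *; first by case: j cj0.
suff /n_min : P n by rewrite ltnn.
apply/asboolP.
exists (fun i => v (lift j i) - (c (lift j i) / c j) *: v j), (fun i => w (lift j i)).
have wj : w j = - \sum_i (c (lift j i) / c j) *: w (lift j i).
  apply: (scalerI cj0); rewrite scalerN; apply/eqP; rewrite -addr_eq0; apply/eqP.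
  rewrite -[RHS]c0 (bigD1_ord j) //= scaler_sumr; congr (_ + _).
  by apply: eq_bigr => i _; rewrite scalerA mulrC divfK.
rewrite tE (bigD1_ord j) //= {1}wj -scaleN1r tensZr tens_sumr scaler_sumr -big_split /=.
apply: eq_bigr => i _.
by rewrite tensDl -scaleN1r tensZl tensZl tensZr addrC.
Qed.

(** Evaluate the second factors of a representation as in [tensor_free_repr] at a
    dual family. *)
Lemma fdual_pair_inj (A : algType k) (s t : fdual A \ot fdual A) :
  (forall a b, fdual_pair s a b = fdual_pair t a b) -> s = t.
Proof.
move=> st; apply/eqP; rewrite -subr_eq0; apply/eqP.
have {st} : forall a b, fdual_pair (s - t) a b = 0.
  by move=> a b; rewrite (linB _ _ (fdual_pair_linear a b)) st subrr.
have [n [v [w [w_free ->]]]] := tensor_free_repr (s - t).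
have [d dP] := ev_free w_free => vw; apply: big1 => i _.
suff -> : v i = 0 by rewrite tens0l.
apply: ev_inj => a; rewrite (lin0 (ev_arg_linear a)) -[RHS](vw a (d i)).
rewrite (linS _ _ _ (fdual_pair_linear a (d i))) (bigD1 i) //= fdual_pair_tens dP eqxx.
rewrite mulr1 big1 ?addr0 // => j ji.
by rewrite fdual_pair_tens dP (negbTE ji) mulr0.
Qed.

Lemma finite_codim_ker (V : lmodType k) n (u : 'I_n -> V -> k^o) :
  (forall i, linear (u i)) ->
  submod_closed ([pred x | [forall i, u i x == 0]] : {pred V}) /\
  finite_codim ([pred x | [forall i, u i x == 0]] : {pred V}).
Proof.
elim: n u => [|n IHn] u uL.
  split; first by split=> [|a x y _ _]; apply/forallP => -[].
  by exists 0%N, (fun=> 0) => v; exists (fun=> 0); apply/forallP => -[].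
have [_ codI] := IHn (fun i => u (lift ord0 i)) (fun i => uL _).
have [subI _] := IHn (fun i => u (lift ord0 i)) (fun i => uL _).
split.
  split=> [|a x y /forallP x0 /forallP y0]; apply/forallP => i.
    by rewrite (lin0 (uL i)).
  by rewrite uL (eqP (x0 i)) (eqP (y0 i)) scaler0 addr0.
apply: finite_codimS (finite_codim_cap_ker subI codI (uL ord0)) => x /andP[/forallP x0 x1].
by apply/forallP => i; case: (unliftP ord0 i) => [j|] ->; [exact: x0|].
Qed.

(** For the matrix coefficients of a finite-dimensional representation, the common
    kernel is the ideal of elements that act as zero. *)
Lemma finite_dual_family (A : algType k) (T : finType) (u : T -> A -> k^o) :
  (forall t, linear (u t)) ->
  (forall a x, (forall t, u t x = 0) -> forall t, u t (a * x) = 0 /\ u t (x * a) = 0) ->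
  forall t, u t \in @finite_dual k A.
Proof.
move=> uL uI t; apply/asboolP; split=> //.
pose I : {pred A} := [pred x | [forall i, u (@enum_val T predT i) x == 0]].
have IP x : reflect (forall s, u s x = 0) (x \in I).
  apply: (iffP forallP) => [x0 s|x0 i]; last by rewrite x0.
  by have /eqP := x0 (enum_rank s); rewrite enum_rankK.
have [subI codI] := finite_codim_ker (fun i => uL (@enum_val T predT i)).
exists I; split=> // [|x /IP]; last by exact.
by split=> // a x /IP x0; split; apply/IP => s; have [] := uI a x x0 s.
Qed.

End TensorRepresentation.

(** * The coinvariants of a calculus *)

Section Converse.
Context {k : fieldType} {H : hopfAlgType k}.
Local Notation S := (@antipode k H).
Variable C : fin_bicov_fovc H.
Local Notation X := (vfields C).
Let la : H -> X -> X := lact C.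
Let ra : X -> H -> X := ract C.
Let lam : X -> H \ot X := lcoact C.
Let rc : X -> X \ot H := rcoact C.
Let L : X -> H -> H := lie C.

Let laB : bilinear_fun la. Proof. exact: lact_bilinear. Qed.
Let raB : bilinear_fun ra. Proof. exact: ract_bilinear. Qed.
Let lamL : linear lam. Proof. exact: linearP. Qed.
Let rcL : linear rc. Proof. exact: linearP. Qed.
Let LB : bilinear_fun L.
Proof.
apply: bilin => [h a x y|x]; first by rewrite /L linearP.
exact: lie_endo.
Qed.

Let la1 x : la 1 x = x. Proof. exact: lact1. Qed.

Lemma lcoact_lact a x : lam (la a x) = tmap2 *%R la (comul a) (lam x).
Proof.
have := lcoact_bimodule C a x 1; rewrite (ract1 C) comul1.
rewrite -[lcoact C _]/(lam (la a x)) => ->.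
pose F (t : H \ot X) := tmap2 *%R (ract C) t (1 \ot 1).
have FL : linear F by rewrite /F; have := ract_bilinear C; lin.
rewrite -[LHS]/(F _); set t := tmap2 _ _ _ _.
move: t; apply: tensor_ext; [lin|lin|move=> h y].
by rewrite /F tmap2_tens; [rewrite mulr1 (ract1 C)|lin|exact: ract_bilinear].
Qed.

Lemma lcoact_ract x b : lam (ra x b) = tmap2 *%R ra (lam x) (comul b).
Proof.
have := lcoact_bimodule C 1 x b; rewrite (lact1 C) comul1.
rewrite -[lcoact C _]/(lam (ra x b)) => ->; congr tmap2.
rewrite -/lam -/la; set t := lam x; move: t; apply: tensor_ext; [lin|lin|move=> h y].
by rewrite tmap2_tens; [rewrite mul1r la1|lin..].
Qed.

Lemma rcoact_lact a x : rc (la a x) = tmap2 la *%R (comul a) (rc x).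
Proof.
have := rcoact_bimodule C a x 1; rewrite (ract1 C) comul1.
rewrite -[rcoact C _]/(rc (la a x)) => ->.
pose F (t : X \ot H) := tmap2 (ract C) *%R t (1 \ot 1).
have FL : linear F by rewrite /F; have := ract_bilinear C; lin.
rewrite -[LHS]/(F _); set t := tmap2 _ _ _ _.
move: t; apply: tensor_ext; [lin|lin|move=> y h].
by rewrite /F tmap2_tens; [rewrite mulr1 (ract1 C)|exact: ract_bilinear|lin].
Qed.

Lemma coaction_coassoc (U : lmodType k) (F : H -> H -> X -> U) x :
  (forall b y, linear (fun a => F a b y)) ->
  (forall a y, linear (fun b => F a b y)) ->
  (forall a b, linear (fun y => F a b y)) ->
  tlift (fun a y => sweedler2 a (fun a1 a2 => F a1 a2 y)) (lam x)
    = tlift (fun a y => tlift (fun b z => F a b z) (lam y)) (lam x).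
Proof.
move=> F1 F2 F3.
pose G (t : H \ot (H \ot X)) := tlift (fun a s => tlift (F a) s) t.
have FB a : bilinear_fun (F a) by apply: bilin => ?; [exact: F2|exact: F3].
have GL : linear G by rewrite /G; lin.
have := congr1 G (lcoactA C x).
have -> : G (tmap idfun (lcoact C) (lcoact C x))
    = tlift (fun a y => tlift (fun b z => F a b z) (lam y)) (lam x).
  rewrite /tmap tlift_comp //; apply: eq_tlift => a y.
  by rewrite /G tlift_tens //; lin.
move=> <-; rewrite /tmap (tlift_comp (L := fun t => G (tassoc t))); last by lin.
apply: eq_tlift => a y; rewrite tassoc_tensl [RHS]tlift_comp //.
by apply: eq_tlift => a1 a2; rewrite /G tlift_tens ?tlift_tens //; lin.
Qed.

(** The projection [x |-> S(x_(-1)) x_0] to the coinvariants. *)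
Definition coinv (x : X) : X := tlift (fun a y => la (S a) y) (lam x).

Let coinvL : linear coinv.
Proof. by rewrite /coinv; lin. Qed.

(** The left factor of the reversed comultiplication of [S(x_(-1))] cancels against
    the coaction on [x_0]. *)
Lemma coinv_mem x : coinv x \in left_coinvariants C.
Proof.
apply/asboolP; rewrite -/lam {1}/coinv tlift_comp //.
pose F a b z := sweedler2 a (fun a1 a2 => (S a2 * b) \ot la (S a1) z).
transitivity (tlift (fun a y => tlift (fun b z => F a b z) (lam y)) (lam x)).
  apply: eq_tlift => a y; rewrite lcoact_lact.
  rewrite -[lam y in LHS]tlift_tensK (tlift_comp (L := tmap2 *%R la (comul (S a)))); last by lin.
  apply: eq_tlift => b z; rewrite tmap2_comull; [|lin..].
  rewrite sweedler_antipode; last by lin.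
  by apply: eq_sweedler => a1 a2; rewrite tmap2_tens; [|lin..].
rewrite -coaction_coassoc; try by rewrite /F; lin.
rewrite /coinv (tlift_comp (L := fun y => 1 \ot y)); last by lin.
apply: eq_tlift => a z; rewrite /F.
apply: etrans (sweedler_coassoc (F := fun a1 a2 b => (S a2 * b) \ot la (S a1) z) _ _ _ _) _; try by lin.
rewrite -[RHS](sweedler_counitr (L := fun a => 1 \ot la (S a) z)); last by lin.
apply: eq_sweedler => a1 a2.
rewrite -(sweedler_comp (L := fun t => t \ot la (S a1) z)); last by lin.
by rewrite [sweedler2 a2 _]antipodel tensZl.
Qed.

(** The fundamental theorem of Hopf modules: [x = x_(-2) S(x_(-1)) x_0]. *)
Lemma coinv_expand x : x = tlift (fun a y => la a (coinv y)) (lam x).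
Proof.
rewrite /coinv; transitivity (tlift (fun a y => tlift (fun b z => la (a * S b) z) (lam y)) (lam x)).
  rewrite -coaction_coassoc; try by lin.
  rewrite -[LHS](lcoact_counit C x); apply: eq_tlift => a z.
  rewrite -(sweedler_comp (L := fun t => la t z)); last by lin.
  by rewrite [sweedler2 a _]antipoder (linZ (f := fun t => la t z)) ?la1 //; lin.
apply: eq_tlift => a y; rewrite (tlift_comp (L := la a)); last by lin.
by apply: eq_tlift => b z; rewrite /la lactM.
Qed.

Definition coinv_sub x : subspace (left_coinvariants C) := Subspace (coinv_mem x).

(** A coinvariant vector field is [h |-> h_1 chi(h_2)] for the functional
    [chi = epsilon \o lie x]. *)
Definition tangent (x : X) : H -> k^o := fun h => counit (L x h).

Let tangentB : bilinear_fun tangent.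
Proof. by rewrite /tangent; lin. Qed.

(** The counit, applied to the second factor of left colinearity. *)
Lemma lie_coinv x h : x \in left_coinvariants C ->
  L x h = conv id (scal H (tangent x)) h.
Proof.
move=> /asboolP xC; have := lie_lcolinear C x h; rewrite xC tmap2_comulr; [|lin..].
move=> /(congr1 (tlift (fun a b => (counit b : k) *: a))).
rewrite [LHS](counitr (L x h)) => ->.
rewrite (sweedler_comp (L := tlift (fun a b : H => (counit b : k) *: a))); last by lin.
apply: eq_sweedler => a b; rewrite tmap2_tens; [|lin..].
by rewrite tlift_tens ?mul1r ?mulr_scal //; lin.
Qed.

Lemma lie1 x : L x 1 = 0.
Proof.
have := lie_leibniz C x 1 1; rewrite mulr1 (ract1 C) mulr1 => E.
by apply: (addrI (L x 1)); rewrite addr0; exact: esym E.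
Qed.

Section CoinvariantBasis.
Variables (n : nat) (e : 'I_n -> subspace (left_coinvariants C)).
Variable c : 'I_n -> subspace (left_coinvariants C) -> k^o.
Hypothesis eB : is_basis e.
Hypothesis cL : forall i, linear (c i).
Hypothesis cE : forall v, v = \sum_i (c i v : k) *: e i.

Let xb i : X := \val (e i).
Let p i x : k^o := c i (coinv_sub x).
Let chi i : H -> k^o := tangent (xb i).
Let f i j h : k^o := p j (ra (xb i) h).

Let pL i : linear (p i).
Proof.
by apply: lin_app (cL i) _ => a x y; apply: val_inj; rewrite linearP /= coinvL.
Qed.

Let coinv_basis x : coinv x = \sum_i (p i x : k) *: xb i.
Proof.
rewrite -[LHS]/(\val (coinv_sub x)) [coinv_sub x]cE linear_sum.
by apply: eq_bigr => i _; rewrite linearZ.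
Qed.

Let xb_coinv i : xb i \in left_coinvariants C. Proof. exact: valP. Qed.

Let chiL i : linear (chi i). Proof. exact: tangentB.2. Qed.

Let fL i j : linear (f i j).
Proof. by rewrite /f; lin. Qed.

Let LE i h : L (xb i) h = Dl chi i h.
Proof. exact: lie_coinv. Qed.

Lemma ract_coinv i h : ra (xb i) h = \sum_j la (El f i j h) (xb j).
Proof.
rewrite [LHS]coinv_expand lcoact_ract.
have /asboolP xC := xb_coinv i; rewrite /lam xC tmap2_comulr; [|lin..].
rewrite (sweedler_comp (L := tlift (fun a y => la a (coinv y)))); last by lin.
transitivity (sweedler2 h (fun a b => \sum_j la (a * scal H (f i j) b) (xb j))).
  apply: eq_sweedler => a b; rewrite tmap2_tens; [|lin..].
  rewrite tlift_tens ?mul1r; last by lin.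
  rewrite coinv_basis (linS _ _ _ (laB.2 a)); apply: eq_bigr => j _.
  rewrite mulr_scal (linZ (f := la a)); last by lin.
  by rewrite (linZ (f := fun t => la t (xb j))) //; lin.
rewrite sweedler_sum; apply: eq_bigr => j _.
by rewrite [RHS](sweedler_comp (L := fun t => la t (xb j))) //; lin.
Qed.

Lemma tangentM i a b :
  chi i (a * b) = (chi i a : k) * counit b + \sum_j (f i j a : k) * chi j b.
Proof.
rewrite /chi /tangent [L _ _](lie_leibniz C) linearD /= counitM; congr (_ + _).
rewrite -/(ra _ _) ract_coinv -/L.
rewrite (linS (f := fun x => (counit (L x b) : k^o))); last by lin.
apply: eq_bigr => j _; rewrite [L _ _](lie_lact C) counitM; congr (_ * _).
rewrite /El /conv (sweedler_comp (L := @counit k H)); last exact: linearP.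
rewrite -[RHS](sweedler_counitl (L := f i j)); last exact: fL.
by apply: eq_sweedler => x y; rewrite mulr_scal linearZ /= [_ *: _]mulrC.
Qed.

Lemma tangent1 x : tangent x 1 = 0.
Proof. by rewrite /tangent lie1 linear0. Qed.

Lemma tangent_dual : exists d : 'I_n -> H, forall i j, chi i (d j) = (i == j)%:R.
Proof.
apply: dual_vectors => // b b0.
have /(_ b) := is_basis_free eB; apply; apply: val_inj; rewrite linear0.
apply: (lie_inj (f := C)); rewrite linear0; apply/funext => h.
rewrite -/L lie_coinv; last exact: valP.
rewrite (_ : tangent _ = fun=> 0); last first.
  apply/funext => y; rewrite -[RHS](b0 y) linear_sum.
  rewrite (linS _ _ _ (tangentB.1 y)); apply: eq_bigr => i _.
  by rewrite linearZ (linZ _ _ (tangentB.1 y)).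
rewrite /conv /sweedler2 /tlift big1 // => q _.
by rewrite /scal scale0r mulr0.
Qed.

(** The coefficients of the right coaction, with its first factor projected to the
    coinvariants; by [rcoact_coinv] the projection changes nothing. *)
Definition coinv_matrix : 'M[H]_n :=
  \matrix_(i, j) tlift (fun y a => (p j y : k) *: a) (rc (xb i)).

(** Since the coactions commute, the first factor of [rcoact x] is coinvariant when
    [x] is. *)
Lemma rcoact_coinv i : rc (xb i) = \sum_j xb j \ot coinv_matrix i j.
Proof.
have xC : lam (xb i) = 1 \ot xb i by apply/asboolP; exact: xb_coinv.
pose G (t : H \ot (X \ot H)) := tlift (fun a s => tmap (la (S a)) idfun s) t.
have GL : linear G by rewrite /G /tmap; lin.
have := congr1 G (lrcoact C (xb i)).
rewrite -/lam -/rc xC tmap_tens; [|lin..].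
rewrite [G (_ \ot _)](tlift_tens _ (V := H)); last by rewrite /tmap; lin.
rewrite antipode1 (_ : la 1 = idfun) ?tmap_id; last by apply/funext.
move=> <-; transitivity (tmap coinv idfun (rc (xb i))); last first.
  rewrite /tmap; transitivity (tlift (fun y a => \sum_j xb j \ot ((p j y : k) *: a)) (rc (xb i))).
    apply: eq_tlift => y a; rewrite coinv_basis tens_suml; apply: eq_bigr => j _.
    by rewrite tensZl tensZr.
  rewrite [LHS]exchange_big /=; apply: eq_bigr => j _; rewrite mxE.
  by rewrite [RHS](tlift_comp (L := fun a => xb j \ot a)) //; lin.
set t := rc (xb i); move: t; apply: tensor_ext; [lin|lin|move=> y b].
rewrite !tmap_tens; [|lin..]; rewrite tassoc_tensl (tlift_comp (L := G)) //.
rewrite /coinv (tlift_comp (L := fun z => z \ot b)); last by lin.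
apply: eq_tlift => a z; rewrite /G tlift_tens ?tmap_tens //; rewrite /tmap; lin.
Qed.

(** The counit, applied to the first factor of right colinearity, gives
    [Dl i = \sum_j N i j * Dr j]; then cancel by the antipode. *)
Lemma tangent_ad i :
  conv (Dl chi i) S = (fun h => \sum_j (chi j h : k) *: coinv_matrix i j).
Proof.
rewrite -(conv_Dr_antipode chiL); congr conv; apply/funext => h.
have := lie_rcolinear C (xb i) h; rewrite -/rc -/L rcoact_coinv.
move=> /(congr1 (tlift (fun a b => (counit a : k) *: b))).
rewrite [LHS](counitl (L (xb i) h)) LE => ->.
rewrite tmap2_comulr; [|lin..].
rewrite (sweedler_comp (L := tlift (fun a b : H => (counit a : k) *: b))); last by lin.
transitivity (sweedler2 h (fun a b => \sum_j coinv_matrix i j * (scal H (chi j) a * b))).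
  apply: eq_sweedler => a b; rewrite (linS (f := fun t => tmap2 L *%R t (a \ot b))); last by lin.
  rewrite (linS (f := tlift _)); last by lin.
  apply: eq_bigr => j _; rewrite tmap2_tens; [|lin..].
  by rewrite tlift_tens ?scal_mulr ?scalerAr //; lin.
rewrite sweedler_sum; apply: eq_bigr => j _.
by rewrite /Dr [RHS](sweedler_comp (L := fun t => coinv_matrix i j * t)) //; lin.
Qed.

(** By the product formulas the common kernel of [chi], [f] and the counit is an
    ideal. *)
Lemma tangent_finite_dual i :
  chi i \in @finite_dual k H /\ forall j, f i j \in @finite_dual k H.
Proof.
have [d dP] := tangent_dual.
have fM := coeffM dP tangentM.
pose u (t : option ('I_n + 'I_n * 'I_n)) : H -> k^o := match t with
  | None => counit | Some (inl i) => chi i | Some (inr ij) => f ij.1 ij.2 end.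
have uD : forall t, u t \in @finite_dual k H.
  apply: finite_dual_family => [[[j|[j l]]|] /=|a x x0 t].
  - exact: chiL.
  - exact: fL.
  - exact: linearP.
  have e0 := x0 None; have c0 j := x0 (Some (inl j)).
  have f0 j l := x0 (Some (inr (j, l))); rewrite /u /= in e0 c0 f0.
  case: t => [[j|[j l]]|] /=.
  - rewrite !tangentM e0 c0 mulr0 mul0r !add0r !big1 // => l _.
      by rewrite f0 mul0r.
    by rewrite c0 mulr0.
  - rewrite !fM !big1 // => m _; first by rewrite f0 mul0r.
    by rewrite f0 mulr0.
  - by rewrite !counitM e0 mulr0 mul0r.
by split=> [|j]; [exact: (uD (Some (inl i)))|exact: (uD (Some (inr (i, j))))].
Qed.

End CoinvariantBasis.

End Converse.

(** * The tangent space of a calculus *)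

Section TangentSpace.
Context {k : fieldType} {H : hopfAlgType k}.
Implicit Types C D : fin_bicov_fovc H.

Definition tangent_space C : {pred fdual H} := fun u =>
  `[< exists2 x, x \in left_coinvariants C & forall h, ev u h = tangent x h >].

Lemma tangent_spaceP C u : u \in tangent_space C <->
  exists2 x, x \in left_coinvariants C & forall h, ev u h = tangent (C := C) x h.
Proof. by split=> [/asboolP|uC] //; apply/asboolP. Qed.

Lemma tangent_linear C h : linear (fun x : vfields C => tangent x h).
Proof. by move=> a x y; rewrite /tangent !linearP. Qed.

Lemma tangent_space_submod C : submod_closed (tangent_space C).
Proof.
have subC := left_coinvariants_submod C.
split=> [|a u v /tangent_spaceP[x xC ux] /tangent_spaceP[y yC vy]]; apply/tangent_spaceP.
  exists 0; first exact: subC.1.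
  by move=> h; rewrite (lin0 (tangent_linear h)) (lin0 (ev_arg_linear h)).
exists (a *: x + y); first exact: subC.2.
by move=> h; rewrite tangent_linear -ux -vy [LHS]ev_arg_linear.
Qed.

HB.instance Definition _ C :=
  GRing.isSubmodClosed.Build k (fdual H) (tangent_space C)
    (GRing.submod_closed_semi (tangent_space_submod C)).

Lemma tangent_space_iso C D : fovc_iso C D ->
  forall u, u \in tangent_space C -> u \in tangent_space D.
Proof.
move=> [F [[[G FK _] _ _ Flc _] Fli]] u /tangent_spaceP[x xC ux].
apply/tangent_spaceP; exists (F x).
  exact: fovc_iso_coinvariants (can_inj FK) Flc _ xC.
by move=> h; rewrite ux /tangent Fli.
Qed.

End TangentSpace.

Section Reconstruction.
Context {k : fieldType} {H : hopfAlgType k}.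
Variable C : fin_bicov_fovc H.
Local Notation X := (vfields C).
Let g := tangent_space C : submodClosed (fdual H).

Variables (n : nat) (e : 'I_n -> subspace (left_coinvariants C)).
Variable c : 'I_n -> subspace (left_coinvariants C) -> k^o.
Hypothesis eB : is_basis e.
Hypothesis cL : forall i, linear (c i).
Hypothesis cE : forall v, v = \sum_i (c i v : k) *: e i.

Let xb i : X := \val (e i).
Let M : 'M[H]_n := coinv_matrix e c.
Let chiD i := Subspace (tangent_finite_dual eB cL cE i).1 : fdual H.
Let fD i j := Subspace ((tangent_finite_dual eB cL cE i).2 j) : fdual H.

Let chiD_mem i : chiD i \in g.
Proof. by apply/tangent_spaceP; exists (xb i); [exact: valP|]. Qed.

Definition tangent_basis i : subspace g := Subspace (chiD_mem i).

Lemma tangent_basisP : is_basis tangent_basis.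
Proof.
move=> v; have [x xC vx] := (tangent_spaceP C (\val v)).1 (valP v).
have [d dP] := tangent_dual eB.
pose b : {ffun 'I_n -> k} := [ffun i => c i (Subspace xC)].
have vE : v = \sum_i b i *: tangent_basis i.
  apply: val_inj; apply: ev_inj => h; rewrite vx linear_sum.
  rewrite (linS _ _ _ (ev_arg_linear h)).
  rewrite -[x]/(\val (Subspace xC : subspace (left_coinvariants C))) [Subspace xC]cE.
  rewrite linear_sum (linS _ _ _ (tangent_linear h)); apply: eq_bigr => i _.
  by rewrite !linearZ (linZ _ _ (tangent_linear h)) (linZ _ _ (ev_arg_linear h)) ffunE.
exists b; split=> // b' vE'; apply/ffunP => i.
have evd (a : {ffun 'I_n -> k}) : v = \sum_j a j *: tangent_basis j -> a i = ev (\val v) (d i).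
  move=> ->; rewrite (linSZ _ _ _ (@ev_val_linear k H g (d i))).
  transitivity (\sum_j ((i == j)%:R : k) *: (a j : k^o)); first by rewrite sum_delta.
  by apply: eq_bigr => j _; rewrite eq_sym -(dP j i) [LHS]mulrC.
by rewrite (evd _ vE) (evd _ vE').
Qed.

Lemma tangent_basis_comul i : fdual_comul (\val (tangent_basis i))
  = \val (tangent_basis i) \ot fdual_unit H + \sum_j fD i j \ot \val (tangent_basis j).
Proof.
apply: fdual_pair_inj => a b; rewrite fdual_comulE.
rewrite (linD _ _ (fdual_pair_linear a b)) fdual_pair_tens (linS _ _ _ (fdual_pair_linear a b)).
rewrite [LHS](tangentM cL cE); congr (_ + _).
by apply: eq_bigr => j _; rewrite fdual_pair_tens.
Qed.

Lemma tangent_basis_ad i h :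
  ad (\val (tangent_basis i)) h = \sum_j ev (\val (tangent_basis j)) h *: M i j.
Proof. by rewrite adE [LHS](congr1 (fun F => F h) (tangent_ad cE i)). Qed.

Let tb_expand u (ug : u \in g) : exists b : 'I_n -> k, u = \sum_i b i *: \val (tangent_basis i).
Proof.
have [b [bE _]] := tangent_basisP (Subspace ug); exists b.
rewrite -[LHS]/(\val (Subspace ug : subspace g)) bE linear_sum.
by apply: eq_bigr => i _; rewrite linearZ.
Qed.

Lemma tangent_space_qts : quantum_tangent_space g.
Proof.
split=> [|u /tangent_spaceP[x _ ux]|u ug].
- by exists n, tangent_basis; exact: tangent_basisP.
- by rewrite ux tangent1.
exists u => //; have [b uE] := tb_expand ug.
exists (\sum_i b i *: \sum_j fD i j \ot tangent_basis j).
have vL : linear (\val : subspace g -> fdual H) by move=> r x y; rewrite linearP.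
apply: fdual_pair_inj => a a'; rewrite fdual_comulE.
have pL := fdual_pair_linear a a'.
have basisM i : ev (\val (tangent_basis i)) (a * a')
    = ev (\val (tangent_basis i)) a * counit a'
      + fdual_pair (tmap idfun (\val : subspace g -> fdual H)
          (\sum_j fD i j \ot tangent_basis j)) a a'.
  rewrite -fdual_comulE tangent_basis_comul (linD _ _ pL) fdual_pair_tens.
  congr (_ + fdual_pair _ a a'); rewrite (linS (f := tmap _ _)); last by lin.
  by apply: eq_bigr => j _; rewrite tmap_tens //; lin.
rewrite (linD _ _ pL) fdual_pair_tens (linSZ (f := tmap _ _)); last by lin.
rewrite (linSZ _ _ _ pL) {1 2}uE !ev_sum mulr_suml -big_split.
by apply: eq_bigr => i _; rewrite [in LHS]basisM mulrDr mulrA.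
Qed.

Lemma tangent_space_bicovariant : tangent_bicovariant g.
Proof.
move=> u ug; have [b uE] := tb_expand ug.
exists (\sum_i b i *: \sum_j tangent_basis j \ot M i j) => h.
have aL := ad_linear (g := g) h.
have evB : bilinear_fun (fun (y : subspace g) a => ev (\val y) h *: a : H).
  by have := @ev_val_linear k H g h; lin.
rewrite (linSZ _ _ _ (tlift_linear evB)).
have -> : ad u h = \sum_i b i *: ad (\val (tangent_basis i)) h.
  rewrite -(linSZ _ _ _ aL); congr ad; rewrite uE linear_sum.
  by apply: eq_bigr => i _; rewrite linearZ.
apply: eq_bigr => i _; rewrite tangent_basis_ad (linS _ _ _ (tlift_linear evB)).
by congr (_ *: _); apply: eq_bigr => j _; rewrite tlift_tens.
Qed.

Section Isomorphism.
Variable D : bicov_fovc H (H \ot subspace g)%type.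
Hypothesis DT : tangent_calculus D.

(** The isomorphism is [h \ot v |-> h x_v], with [x_v] the coinvariant field of the
    functional [v]. It is compatible with the maps to [End(H)], and these are
    injective: this gives its injectivity and its right linearity. It is surjective by
    [coinv_expand]. *)
Lemma tangent_reconstruction (D_fin : finite_dim (subspace (left_coinvariants D))) :
  fovc_iso (FinBicovFovc D_fin) C.
Proof.
have [b [bL bE be]] := basis_coord tangent_basisP.
have [Dl_ Dlc DL Dm] := DT.
have {Dm}[_ Drc] := Dm _ _ _ _ tangent_basisP tangent_basis_comul tangent_basis_ad.
have laB := lact_bilinear C.
pose x_ (v : subspace g) : X := \sum_i (b i v : k) *: xb i.
have xL : linear x_ by rewrite /x_; lin.
have x_coinv v : lcoact C (x_ v) = 1 \ot x_ v.
  rewrite (linSZ _ _ _ (lin_linear (lcoact C))) tens_sumr; apply: eq_bigr => i _.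
  have /asboolP xbC : \val (e i) \in left_coinvariants C := valP (e i).
  by rewrite tensZr xbC.
have x_basis i : x_ (tangent_basis i) = xb i.
  by rewrite /x_; under eq_bigr do rewrite be eq_sym; exact: sum_delta.
pose Phi := tlift (fun h v => lact C h (x_ v)).
have PB : bilinear_fun (fun h v => lact C h (x_ v)) by lin.
have PL : linear Phi by rewrite /Phi; lin.
have PE h v : Phi (h \ot v) = lact C h (x_ v) by rewrite /Phi tlift_tens.
pose Phil : {linear (H \ot subspace g)%type -> X} :=
  HB.pack Phi (GRing.isLinear.Build _ _ _ _ _ PL).
have lieP y : lie C (Phi y) = lie D y.
  have LCL := lin_linear (lie C); have LDL := lin_linear (lie D).
  move: y; apply: (X_ext bE); [lin|lin|move=> h i].
  rewrite PE x_basis; apply/funext => a; rewrite lie_lact DL.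
  rewrite [lie C (xb i) a]lie_coinv; last exact: valP.
  rewrite [LHS](sweedler_comp (L := fun t => h * t)); last by lin.
  by apply: eq_sweedler => a1 a2; rewrite mulr_scal scalerAr.
have Pinj : injective Phi.
  by move=> y y' /(congr1 (lie C)); rewrite !lieP => /lie_inj.
pose Psi (x : X) : H \ot subspace g := tlift (fun a y =>
  \sum_i ((c i (coinv_sub y) : k) *: a) \ot tangent_basis i) (lcoact C x).
have PsiK : cancel Psi Phi.
  move=> x; rewrite /Psi (tlift_comp (L := Phi)) // [RHS]coinv_expand.
  apply: eq_tlift => a y; rewrite (linS _ _ _ PL).
  rewrite -[coinv y]/(\val (coinv_sub y)) [coinv_sub y in RHS]cE linear_sum.
  rewrite (linS _ _ _ (laB.2 a)); apply: eq_bigr => i _.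
  rewrite PE x_basis linearZ (linZ (f := lact C a)); last by lin.
  by rewrite (linZ (f := fun t => lact C t (xb i))) //; lin.
exists Phil; split; last by move=> y; exact: lieP.
split=> [|h y|y h|y|y] /=.
- by exists Psi => // y; apply: Pinj; rewrite PsiK.
- have DB := lact_bilinear D; move: y; apply: tensor_ext; [lin|lin|move=> a v].
  by rewrite Dl_ !PE lactM.
- apply: (lie_inj (f := C)); rewrite lieP; apply/funext => a.
  have := lie_leibniz C (Phi y) h a; rewrite lieP lie_leibniz.
  by move=> /addrI ->.
- have lamL := lin_linear (lcoact C); have lamDL := lin_linear (lcoact D).
  move: y; apply: tensor_ext; [lin|lin|move=> a v].
  rewrite PE [lcoact C _]lcoact_lact x_coinv tmap2_comull; [|lin..].
  rewrite Dlc (sweedler_comp (L := tmap idfun Phi)); last by lin.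
  by apply: eq_sweedler => a1 a2; rewrite tmap2_tens ?tmap_tens ?mulr1 ?PE //; lin.
- have rcL := lin_linear (rcoact C); have rcDL := lin_linear (rcoact D).
  move: y; apply: (X_ext bE); [lin|lin|move=> a i].
  rewrite PE x_basis [rcoact C _]rcoact_lact [rcoact C _](rcoact_coinv cE).
  rewrite Drc (linS (f := tmap Phi idfun)); last by lin.
  rewrite (linS (f := tmap2 (lact C) *%R (comul a))); last by lin.
  apply: eq_bigr => j _; rewrite tmap2_comull; [|lin..].
  rewrite (sweedler_comp (L := tmap Phi idfun)); last by lin.
  apply: eq_sweedler => a1 a2; rewrite tmap2_tens ?tmap_tens //; try by lin.
  by rewrite PE x_basis.
Qed.

End Isomorphism.

End Reconstruction.

(** * The correspondence *)

Section Main.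
Context {k : fieldType} {H : hopfAlgType k}.

Lemma calculus_of_tangent (C : fin_bicov_fovc H) :
  exists g : bicovQTS H, forall (D : bicov_fovc H (H \ot subspace g)%type) D_fin,
    tangent_calculus D -> fovc_iso (FinBicovFovc (vfields_calculus := D) D_fin) C.
Proof.
have [n [e eB]] := vfields_fin C; have [c [cL cE _]] := basis_coord eB.
exists (BicovQTS (tangent_space_qts eB cL cE) (tangent_space_bicovariant eB cL cE)).
move=> D D_fin DT; exact: tangent_reconstruction.
Qed.

Lemma bicovQTS_ext (g g' : bicovQTS H) : (forall u, (u \in g) = (u \in g')) -> g = g'.
Proof.
case: g g' => g gT gB [g' gT' gB'] /= gg'.
have E : g = g'.
  case: g g' {gT gB gT' gB'} gg' => [s sC] [s' sC'] /= ss'.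
  have {ss'} ss' : s = s' by apply/funext => u; exact: ss'.
  case: s' / ss' in sC' *; congr GRing.SubmodClosed.Pack.
  case: sC sC' => [[a] [b]] [[a'] [b']].
  by rewrite (Prop_irrelevance a a') (Prop_irrelevance b b').
case: g' / E gT' gB' {gg'} => gT' gB'.
by rewrite (Prop_irrelevance gT gT') (Prop_irrelevance gB gB').
Qed.

End Main.

Theorem theorem3p12 (k : fieldType) (H : hopfAlgType k) :
  exists (T : forall g : bicovQTS H, bicov_fovc H (H \ot subspace g)%type)
         (T_fin : forall g, finite_dim (subspace (left_coinvariants (T g)))),
    (forall g, tangent_calculus (T g)) /\
    bijective (fun g => isoclass (FinBicovFovc (T_fin g))).
Proof.
pose T g := sval (cid (@exists_tangent_calculus k H g)).
have TT g : tangent_calculus (T g) by rewrite /T; case: (cid _).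
have T_fin g : finite_dim (subspace (left_coinvariants (T g))).
  by apply: tangent_fin (TT g) _; have [] := qts_tangent g.
exists T, T_fin; split=> //; set F := fun g => _.
have inj g g' : F g = F g' -> g = g'.
  move=> /isoclass_eq gg'; apply: bicovQTS_ext => u.
  have rec (g1 : bicovQTS H) : u \in g1 <-> u \in tangent_space (FinBicovFovc (T_fin g1)).
    by split=> [/(tangent_recover (TT g1)) ug|/tangent_spaceP ug];
      [apply/tangent_spaceP|apply/(tangent_recover (TT g1))].
  apply/idP/idP => /rec ug; apply/rec.
    exact: tangent_space_iso gg' _ ug.
  exact: tangent_space_iso (fovc_iso_sym gg') _ ug.
have surj P : exists g, F g = P.
  case: P => P [C PE]; have [g gC] := calculus_of_tangent C.
  exists g; apply: eq_exist; rewrite PE; apply: fovc_iso_eq; exact: gC.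
pose G P := sval (cid (surj P)).
have FG P : F (G P) = P by rewrite /G; case: (cid _).
by exists G => // g; apply: inj; rewrite FG.
Qed.
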